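(* Let $(H,R)$ be a quasitriangular quasi-Hopf algebra over a field $k$, with structure $(\Delta_H,\varepsilon_H,\Phi,S,\alpha,\beta)$, let $u\in H$ be the element $u=S(R^2x^2\beta S(x^3))\alpha R^1x^1$, and let $H(\theta)=H[\theta]/\langle\theta^2-uS(u)\rangle$. Then $H(\theta)$ is a quasi-Hopf algebra with structure determined by $\Delta|_H=\Delta_H$, $\varepsilon|_H=\varepsilon_H$, the antipode restricting to $S$ on $H$, $$\Delta(\theta)=(\theta\otimes\theta)(R_{21}R)^{-1},\qquad\varepsilon(\theta)=1,\qquad S(\theta)=\theta,$$ and with reassociator and distinguished elements defining the antipode equal to those of $H$. Furthermore, $(H(\theta),R)$ is quasitriangular, and $\theta^{-1}$ defines a ribbon twist $\eta$ on ${}_{H(\theta)}\mathcal M^{\mathrm{fd}}$ by $\eta_V(v)=\theta^{-1}\cdot v$ for all $V\in{}_{H(\theta)}\mathcal M^{\mathrm{fd}}$, $v\in V$.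
   Context: Quasi-Hopf algebras. A quasi-bialgebra over $k$ is $(H,\Delta,\varepsilon,\Phi)$ with $H$ a unital associative $k$-algebra, $\Phi\in H\otimes H\otimes H$ invertible, and $\Delta:H\to H\otimes H$, $\varepsilon:H\to k$ algebra morphisms such that $(\mathrm{Id}\otimes\Delta)(\Delta(h))=\Phi(\Delta\otimes\mathrm{Id})(\Delta(h))\Phi^{-1}$, $(\mathrm{Id}\otimes\varepsilon)(\Delta(h))=h=(\varepsilon\otimes\mathrm{Id})(\Delta(h))$, $(1\otimes\Phi)(\mathrm{Id}\otimes\Delta\otimes\mathrm{Id})(\Phi)(\Phi\otimes1)=(\mathrm{Id}\otimes\mathrm{Id}\otimes\Delta)(\Phi)(\Delta\otimes\mathrm{Id}\otimes\mathrm{Id})(\Phi)$ and $(\mathrm{Id}\otimes\varepsilon\otimes\mathrm{Id})(\Phi)=1\otimes1$. Write $\Delta(h)=h_1\otimes h_2$, $\Phi=X^1\otimes X^2\otimes X^3=Y^1\otimes Y^2\otimes Y^3$, $\Phi^{-1}=x^1\otimes x^2\otimes x^3=y^1\otimes y^2\otimes y^3$ (summation understood). It is a quasi-Hopf algebra if there are an anti-algebra endomorphism $S$ of $H$ and $\alpha,\beta\in H$ (the distinguished elements) with $S(h_1)\alpha h_2=\varepsilon(h)\alpha$, $h_1\beta S(h_2)=\varepsilon(h)\beta$, $X^1\beta S(X^2)\alpha X^3=1$, $S(x^1)\alpha x^2\beta S(x^3)=1$. Quasitriangular (QT). $(H,R)$ is QT if $R=R^1\otimes R^2=r^1\otimes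 r^2\in H\otimes H$ is invertible and $(\Delta\otimes\mathrm{Id})(R)=X^2R^1x^1Y^1\otimes X^3x^3r^1Y^2\otimes X^1R^2x^2r^2Y^3$, $(\mathrm{Id}\otimes\Delta)(R)=x^3R^1X^2r^1y^1\otimes x^1X^1r^2y^2\otimes x^2R^2X^3y^3$, $\Delta^{\mathrm{cop}}(h)R=R\Delta(h)$ for all $h\in H$, where $\Delta^{\mathrm{cop}}(h)=h_2\otimes h_1$. $R_{21}=R^2\otimes R^1$. In a QT quasi-Hopf algebra the element $u$ is known to be invertible with $S^2(h)=uhu^{-1}$, and $uS(u)=S(u)u$ is central. $H[\theta]$ is the $k$-algebra freely generated by $H$ and $\theta$ with relations $h\theta=\theta h$ for all $h\in H$; the class of $\theta$ in $H(\theta)$ is still denoted $\theta$. Representations. For a QT quasi-Hopf algebra $(A,R)$, ${}_A\mathcal M^{\mathrm{fd}}$ is the category of finite dimensional left $A$-modules, with tensor product action via $\Delta$, associativity constraint given by the action of $\Phi$, unit $k$ via $\varepsilon$, left dual $V^*$ with $(a\cdot v^* )(v)=v^*(S(a)\cdot v)$, $\mathrm{ev}_V(v^*\otimes v)=v^*(\alpha\cdot v)$, $\mathrm{coev}_V(1)=\sum_i\beta\cdot v_i\otimes v^i$ (dual bases), and braiding $c_{X,Y}(x\otimes y)=R^2\cdot y\otimes R^1\cdot x$. A ribbon twist on a left rigid braided category is a natural isomorphism $\eta=(\eta_V:V\to V)_V$ with $\eta_{V\otimes W}=(\eta_V\otimes\eta_W)c_{W,V}c_{V,W}$ and $\eta_{V^*}=(\eta_V)^*$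 for all $V,W$. *)

(* Defs.v *)
From HB Require Import structures.
From mathcomp Require Import all_boot all_algebra.
From mathcomp Require Import boolp classical_sets.

Set Implicit Arguments.
Unset Strict Implicit.
Unset Printing Implicit Defensive.

Import GRing.Theory.
Local Open Scope ring_scope.
Local Open Scope quotient_scope.

(* [GRing.Algebra] excludes the zero ring.  Quotients by two-sided ideals and
   tensor products are formed below without a proof that they are nonzero,
   hence this variant, which allows 1 = 0.  It carries its own product because
   the library hierarchy does not admit a common substructure of PzRing and
   Lmodule other than Lalgebra; the generic PzRing instance that follows gives
   access to the notations and lemmas of rings. *)
HB.mixin Record Lmodule_isPzAlgebra (k : fieldType) A of GRing.Lmodule k A := {
  pza_one : A;
  pza_mul : A -> A -> A;
  pza_mulA : associative pza_mul;
  pza_mul1 : left_id pza_one pza_mul;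
  pza_mulr1 : right_id pza_one pza_mul;
  pza_mulDl : left_distributive pza_mul +%R;
  pza_mulDr : right_distributive pza_mul +%R;
  pza_scaleAl : forall (a : k) (x y : A),
    a *: pza_mul x y = pza_mul (a *: x) y;
  pza_scaleAr : forall (a : k) (x y : A),
    a *: pza_mul x y = pza_mul x (a *: y)
}.

#[short(type="pzAlgType")]
HB.structure Definition PzAlgebra (k : fieldType) :=
  {A of Lmodule_isPzAlgebra k A & GRing.Lmodule k A}.

HB.instance Definition _ (k : fieldType) (A : pzAlgType k) :=
  GRing.Zmodule_isPzRing.Build (PzAlgebra.sort A)
    pza_mulA pza_mul1 pza_mulr1 pza_mulDl pza_mulDr.

Lemma pzscalerAl (k : fieldType) (A : pzAlgType k) (a : k) (x y : A) :
  a *: (x * y) = (a *: x) * y.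
Proof. exact: pza_scaleAl. Qed.

Lemma pzscalerAr (k : fieldType) (A : pzAlgType k) (a : k) (x y : A) :
  a *: (x * y) = x * (a *: y).
Proof. exact: pza_scaleAr. Qed.

HB.instance Definition _ (k : fieldType) (A : algType k) :=
  Lmodule_isPzAlgebra.Build k (GRing.Algebra.sort A)
    (@mulrA A) (@mul1r A) (@mulr1 A) (@mulrDl A) (@mulrDr A)
    (@scalerAl k A) (@scalerAr k A).

Section Inverse.
Variable A : pzRingType.

Definition invertible (x : A) := exists y : A, x * y = 1 /\ y * x = 1.

(* Meaningful only when [invertible x]; the two-sided inverse is then unique. *)
Definition inverse (x : A) : A :=
  xget 0 [set y : A | x * y = 1 /\ y * x = 1]%classic.

Lemma inverseE (x y : A) : x * y = 1 -> y * x = 1 -> inverse x = y.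
Proof.
move=> xy yx; apply: xget_unique; first by split.
by move=> z [xz zx]; rewrite -[z]mul1r -yx -mulrA xz mulr1.
Qed.

End Inverse.

Section LinearFor.
Variables (k : fieldType) (U V : lmodType k) (f : U -> V).
Hypothesis lf : linear f.

Lemma linear_for0 : f 0 = 0.
Proof. by have := lf (-1) 0 0; rewrite scaler0 addr0 scaleN1r addNr. Qed.

Lemma linear_forD x y : f (x + y) = f x + f y.
Proof. by have := lf 1 x y; rewrite !scale1r. Qed.

Lemma linear_forZ a x : f (a *: x) = a *: f x.
Proof. by have := lf a x 0; rewrite linear_for0 !addr0. Qed.

End LinearFor.

Section TensorProduct.
Variables (k : fieldType) (U V : lmodType k).

(* The list [:: (u1, v1); ...; (un, vn)] stands for the formal sum
   u1 (x) v1 + ... + un (x) vn, and [tens_eq] is the congruence on formal sums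
   generated by bilinearity. *)
Inductive tens_eq : seq (U * V) -> seq (U * V) -> Prop :=
| tens_eq_refl s : tens_eq s s
| tens_eq_sym s t : tens_eq s t -> tens_eq t s
| tens_eq_trans s t r : tens_eq s t -> tens_eq t r -> tens_eq s r
| tens_eq_cat s s' t t' :
    tens_eq s s' -> tens_eq t t' -> tens_eq (s ++ t) (s' ++ t')
| tens_eq_catC s t : tens_eq (s ++ t) (t ++ s)
| tens_eq_0l v : tens_eq [:: (0, v)] [::]
| tens_eq_Dl u u' v : tens_eq [:: (u + u', v)] [:: (u, v); (u', v)]
| tens_eq_Dr u v v' : tens_eq [:: (u, v + v')] [:: (u, v); (u, v')]
| tens_eq_Z a u v : tens_eq [:: (a *: u, v)] [:: (u, a *: v)].

Definition tens_eqb (s t : seq (U * V)) : bool := `[< tens_eq s t >].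

Lemma tens_eqb_equiv : equiv_class_of tens_eqb.
Proof.
split=> [s|s t|t s r]; first by apply/asboolP; exact: tens_eq_refl.
  by apply/asboolP/asboolP; exact: tens_eq_sym.
by move=> /asboolP st /asboolP tr; apply/asboolP; apply: tens_eq_trans st tr.
Qed.

Canonical tens_eqb_equivRel := EquivRelPack tens_eqb_equiv.
Canonical tens_eqb_encModRel := defaultEncModRel tens_eqb.

Definition tens := {eq_quot tens_eqb}.
HB.instance Definition _ : EqQuotient _ tens_eqb tens := EqQuotient.on tens.
HB.instance Definition _ := Choice.on tens.

Definition tens_of (s : seq (U * V)) : tens := \pi_tens s.
Definition tensor (u : U) (v : V) : tens := tens_of [:: (u, v)].

Lemma tens_ofP s t : tens_of s = tens_of t <-> tens_eq s t.
Proof.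
split=> [/eqP|st]; first by rewrite piE => /asboolP.
by apply/eqP; rewrite piE; apply/asboolP.
Qed.

Lemma tens_of_repr t : tens_of (repr t) = t. Proof. exact: reprK. Qed.

Lemma repr_tens_of s : tens_eq (repr (tens_of s)) s.
Proof. by apply/tens_ofP; rewrite tens_of_repr. Qed.

Definition tens_add (s t : tens) := tens_of (repr s ++ repr t).
Definition tens_scale (a : k) (t : tens) :=
  tens_of [seq (a *: p.1, p.2) | p <- repr t].
Definition tens_opp (t : tens) := tens_scale (-1) t.

Lemma tens_of_cat s t : tens_add (tens_of s) (tens_of t) = tens_of (s ++ t).
Proof. by apply/tens_ofP; apply: tens_eq_cat; apply: repr_tens_of. Qed.

Lemma tens_eq_mapZ a s t : tens_eq s t ->
  tens_eq [seq (a *: p.1, p.2) | p <- s] [seq (a *: p.1, p.2) | p <- t].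
Proof.
elim=> {s t} /=.
- by move=> s; exact: tens_eq_refl.
- by move=> s t _; exact: tens_eq_sym.
- by move=> s t r _ st _ tr; exact: tens_eq_trans st tr.
- by move=> s s' t t' _ ? _ ?; rewrite !map_cat; exact: tens_eq_cat.
- by move=> s t; rewrite !map_cat; exact: tens_eq_catC.
- by move=> v; rewrite scaler0; exact: tens_eq_0l.
- by move=> u u' v; rewrite scalerDr; exact: tens_eq_Dl.
- by move=> u v v'; exact: tens_eq_Dr.
- by move=> b u v; rewrite scalerA mulrC -scalerA; exact: tens_eq_Z.
Qed.

Lemma tens_of_scale a s :
  tens_scale a (tens_of s) = tens_of [seq (a *: p.1, p.2) | p <- s].
Proof. by apply/tens_ofP; apply: tens_eq_mapZ; apply: repr_tens_of. Qed.

Lemma tens_addA : associative tens_add.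
Proof.
move=> s t r; rewrite -[s]tens_of_repr -[t]tens_of_repr -[r]tens_of_repr.
by rewrite !tens_of_cat catA.
Qed.

Lemma tens_addC : commutative tens_add.
Proof.
move=> s t; rewrite -[s]tens_of_repr -[t]tens_of_repr !tens_of_cat.
by apply/tens_ofP; exact: tens_eq_catC.
Qed.

Lemma tens_add0 : left_id (tens_of [::]) tens_add.
Proof. by move=> t; rewrite -[t]tens_of_repr tens_of_cat. Qed.

Lemma tens_eq_0map s : tens_eq [seq (0 *: p.1, p.2) | p <- s] [::].
Proof.
elim: s => [|[u v] s IHs] /=; first exact: tens_eq_refl.
rewrite scale0r -[[::]]cat0s -cat1s.
by apply: tens_eq_cat IHs; exact: tens_eq_0l.
Qed.

Lemma tens_scaleDl t : {morph tens_scale^~ t : a b / a + b >-> tens_add a b}.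
Proof.
move=> a b /=; rewrite -[t]tens_of_repr !tens_of_scale tens_of_cat.
elim: (repr t) => [|[u v] s IHs] /=; first by [].
apply/tens_ofP; rewrite scalerDl.
set As := [seq (a *: p.1, p.2) | p <- s] in IHs *.
set Bs := [seq (b *: p.1, p.2) | p <- s] in IHs *.
apply: (@tens_eq_trans _ ([:: (a *: u, v); (b *: u, v)] ++ (As ++ Bs))).
  rewrite -cat1s; apply: tens_eq_cat; first exact: tens_eq_Dl.
  exact/tens_ofP.
change (tens_eq ([:: (a *: u, v)] ++ ([:: (b *: u, v)] ++ (As ++ Bs)))
                ([:: (a *: u, v)] ++ (As ++ ([:: (b *: u, v)] ++ Bs)))).
apply: tens_eq_cat; first exact: tens_eq_refl.
rewrite !catA; apply: tens_eq_cat; last exact: tens_eq_refl.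
exact: tens_eq_catC.
Qed.

Lemma tens_scale0 t : tens_scale 0 t = tens_of [::].
Proof. by apply/tens_ofP; exact: tens_eq_0map. Qed.

Lemma tens_scale1 : left_id 1 tens_scale.
Proof.
move=> t; rewrite -[t]tens_of_repr tens_of_scale; congr tens_of.
by elim: (repr t) => [|[u v] s IHs] //=; rewrite scale1r IHs.
Qed.

Lemma tens_addN : left_inverse (tens_of [::]) tens_opp tens_add.
Proof.
move=> t; rewrite -[X in tens_add _ X]tens_scale1 -tens_scaleDl addNr.
exact: tens_scale0.
Qed.

HB.instance Definition _ :=
  GRing.isZmodule.Build tens tens_addA tens_addC tens_add0 tens_addN.

Lemma tens_ofD s t : tens_of (s ++ t) = tens_of s + tens_of t.
Proof. by rewrite -tens_of_cat. Qed.

Lemma tens_scaleA a b t : tens_scale a (tens_scale b t) = tens_scale (a * b) t.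
Proof.
rewrite -[t]tens_of_repr !tens_of_scale -map_comp; congr tens_of.
by apply: eq_map => p /=; rewrite scalerA.
Qed.

Lemma tens_scaleDr : right_distributive tens_scale +%R.
Proof.
move=> a s t; rewrite -[s]tens_of_repr -[t]tens_of_repr.
by rewrite -tens_ofD !tens_of_scale -tens_ofD map_cat.
Qed.

HB.instance Definition _ := GRing.Zmodule_isLmodule.Build k tens
  tens_scaleA tens_scale1 tens_scaleDr tens_scaleDl.

Lemma tensorDl v : {morph tensor^~ v : u u' / u + u'}.
Proof.
move=> u u' /=; rewrite -tens_ofD; apply/tens_ofP; exact: tens_eq_Dl.
Qed.

Lemma tensorDr u : {morph tensor u : v v' / v + v'}.
Proof.
move=> v v' /=; rewrite -tens_ofD; apply/tens_ofP; exact: tens_eq_Dr.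
Qed.

Lemma tens_ofZ a s :
  a *: tens_of s = tens_of [seq (a *: p.1, p.2) | p <- s].
Proof. exact: tens_of_scale. Qed.

Lemma tensorZl a u v : tensor (a *: u) v = a *: tensor u v.
Proof. by rewrite tens_ofZ. Qed.

Lemma tensorZr a u v : tensor u (a *: v) = a *: tensor u v.
Proof. by rewrite -tensorZl; apply/tens_ofP; apply/tens_eq_sym/tens_eq_Z. Qed.

Lemma tens_ofE s : tens_of s = \sum_(p <- s) tensor p.1 p.2.
Proof.
elim: s => [|[u v] s IHs]; first by rewrite big_nil.
by rewrite big_cons -IHs -cat1s tens_ofD.
Qed.

Lemma tens_ind (P : tens -> Prop) :
    P 0 -> (forall s t, P s -> P t -> P (s + t)) ->
  (forall u v, P (tensor u v)) -> forall t, P t.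
Proof.
move=> P0 PD PT t; rewrite -[t]tens_of_repr tens_ofE.
by elim: (repr t) => [|p s IHs]; rewrite ?big_nil ?big_cons //; apply: PD.
Qed.

(* The value of [tens_sum t f] depends on the choice of the representative
   [repr t] unless [f] is bilinear, see [tens_sum_of]; every use below is with
   a bilinear [f]. *)
Definition tens_sum (W : lmodType k) (t : tens) (f : U -> V -> W) : W :=
  \sum_(p <- repr t) f p.1 p.2.

Section Sum.
Variable W : lmodType k.
Implicit Types f g : U -> V -> W.

Local Notation bilinear f := (bilinear_for *:%R *:%R f).

Lemma tens_sum_eq f s t : bilinear f -> tens_eq s t ->
  \sum_(p <- s) f p.1 p.2 = \sum_(p <- t) f p.1 p.2.
Proof.
move=> [fl fr]; elim=> {s t} //=.
- by move=> s t r _ -> _ ->.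
- by move=> s s' t t' _ e1 _ e2; rewrite !big_cat /= e1 e2.
- by move=> s t; rewrite !big_cat /= addrC.
- by move=> v; rewrite big_seq1 big_nil (linear_for0 (fl v)).
- by move=> u u' v; rewrite big_seq1 big_cons big_seq1 (linear_forD (fl v)).
- by move=> u v v'; rewrite big_seq1 big_cons big_seq1 (linear_forD (fr u)).
- by move=> a u v; rewrite !big_seq1 (linear_forZ (fl v)) (linear_forZ (fr u)).
Qed.

Lemma tens_sum_of f s : bilinear f ->
  tens_sum (tens_of s) f = \sum_(p <- s) f p.1 p.2.
Proof. by move=> bf; apply: tens_sum_eq => //; exact: repr_tens_of. Qed.

Lemma tens_sum_tensor f u v : bilinear f -> tens_sum (tensor u v) f = f u v.
Proof. by move=> bf; rewrite tens_sum_of // big_seq1. Qed.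

Lemma tens_sum0 f : bilinear f -> tens_sum 0 f = 0.
Proof. by move=> bf; rewrite tens_sum_of // big_nil. Qed.

Lemma tens_sumD f s t : bilinear f ->
  tens_sum (s + t) f = tens_sum s f + tens_sum t f.
Proof.
by move=> bf; rewrite -[s]tens_of_repr -[t]tens_of_repr -tens_ofD
  !tens_sum_of // big_cat.
Qed.

Lemma tens_sum_linear f : bilinear f -> linear (fun t => tens_sum t f).
Proof.
move=> bf a s t; rewrite tens_sumD //; congr (_ + _).
rewrite -[s]tens_of_repr tens_ofZ !tens_sum_of // big_map.
by rewrite scaler_sumr; apply: eq_bigr => p _; rewrite (linear_forZ (bf.1 p.2)).
Qed.

Lemma tens_sum_linear_fun t a f g :
  tens_sum t (fun u v => a *: f u v + g u v) = a *: tens_sum t f + tens_sum t g.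
Proof. by rewrite /tens_sum big_split /= -scaler_sumr. Qed.

Lemma eq_tens_sum t f g : (forall u v, f u v = g u v) ->
  tens_sum t f = tens_sum t g.
Proof. by move=> fg; apply: eq_bigr => p _; rewrite fg. Qed.

End Sum.

Lemma tensor_bilinear : bilinear_for *:%R *:%R tensor.
Proof.
by split=> [v|u] a x y /=; rewrite ?tensorDl ?tensorDr ?tensorZl ?tensorZr.
Qed.

Lemma tens_sum_id t : tens_sum t tensor = t.
Proof. by rewrite -[RHS]tens_of_repr tens_ofE. Qed.

End TensorProduct.

Notation "x *t y" := (tensor x y) (at level 40, left associativity) : ring_scope.

Notation "\sw2_ ( x , y <- t ) e" := (tens_sum t (fun x y => e))
  (at level 41, t at level 36, x name, y name, e at level 41) : ring_scope.
Notation "\sw3_ ( x , y , z <- t ) e" :=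
  (tens_sum t (fun p z => tens_sum p (fun x y => e)))
  (at level 41, t at level 36, x name, y name, z name, e at level 41) : ring_scope.

Section TensorMaps.
Variable k : fieldType.

Definition tmap (U V U' V' : lmodType k) (f : U -> U') (g : V -> V')
    (t : tens U V) : tens U' V' :=
  \sw2_(u, v <- t) (f u *t g v).

Definition tassoc (U V W : lmodType k) (t : tens U (tens V W)) :
    tens (tens U V) W :=
  \sw2_(u, p <- t) \sw2_(v, w <- p) (u *t v *t w).

Definition tswap (U V : lmodType k) (t : tens U V) : tens V U :=
  \sw2_(u, v <- t) (v *t u).

End TensorMaps.

Arguments tassoc {k U V W} t.
Arguments tswap {k U V} t.

Section TensorAlgebra.
Variables (k : fieldType) (A B : pzAlgType k).
Implicit Types (a c : A) (b d : B) (s t : tens A B).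

Definition tens_one : tens A B := (1 : A) *t (1 : B).
Definition tens_mul s t : tens A B :=
  \sw2_(a, b <- s) \sw2_(c, d <- t) ((a * c) *t (b * d)).

Lemma tens_mul_bilinear1 a b :
  bilinear_for *:%R *:%R (fun c d => (a * c) *t (b * d)).
Proof.
split=> [d|c] x y z /=.
  by rewrite mulrDr -pzscalerAr tensorDl tensorZl.
by rewrite mulrDr -pzscalerAr tensorDr tensorZr.
Qed.

Lemma tens_mul_bilinear2 t :
  bilinear_for *:%R *:%R
    (fun a b => \sw2_(c, d <- t) ((a * c) *t (b * d))).
Proof.
split=> [b|a] x y z /=; rewrite -tens_sum_linear_fun; apply: eq_tens_sum => c d.
  by rewrite mulrDl -pzscalerAl tensorDl tensorZl.
by rewrite mulrDl -pzscalerAl tensorDr tensorZr.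
Qed.

Lemma tens_mulE a b c d :
  tens_mul (a *t b) (c *t d) = (a * c) *t (b * d).
Proof.
rewrite /tens_mul tens_sum_tensor; last exact: tens_mul_bilinear2.
by rewrite tens_sum_tensor //; exact: tens_mul_bilinear1.
Qed.

Lemma tens_mul_linearl t : linear (tens_mul^~ t).
Proof. exact: tens_sum_linear (tens_mul_bilinear2 t). Qed.

Lemma tens_mul_linearr s : linear (tens_mul s).
Proof.
move=> x t t'; rewrite /tens_mul -tens_sum_linear_fun.
by apply: eq_tens_sum => a b; apply: (tens_sum_linear (tens_mul_bilinear1 a b)).
Qed.

Lemma tens_mulDl : left_distributive tens_mul +%R.
Proof. by move=> s s' t; rewrite (linear_forD (tens_mul_linearl t)). Qed.

Lemma tens_mulDr : right_distributive tens_mul +%R.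
Proof. by move=> s t t'; rewrite (linear_forD (tens_mul_linearr s)). Qed.

Lemma tens_mul0l t : tens_mul 0 t = 0.
Proof. exact: (linear_for0 (tens_mul_linearl t)). Qed.

Lemma tens_mul0r s : tens_mul s 0 = 0.
Proof. exact: (linear_for0 (tens_mul_linearr s)). Qed.

Lemma tens_mulA : associative tens_mul.
Proof.
move=> s t r; elim/tens_ind: s => [|s s' IH IH'|a b].
- by rewrite !tens_mul0l.
- by rewrite !tens_mulDl IH IH'.
elim/tens_ind: t => [|t t' IH IH'|c d].
- by rewrite !(tens_mul0l, tens_mul0r).
- by rewrite !(tens_mulDl, tens_mulDr) IH IH'.
elim/tens_ind: r => [|r r' IH IH'|e f].
- by rewrite !tens_mul0r.
- by rewrite !tens_mulDr IH IH'.
by rewrite !tens_mulE !mulrA.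
Qed.

Lemma tens_mul1l : left_id tens_one tens_mul.
Proof.
elim/tens_ind=> [|s s' IH IH'|a b]; first exact: tens_mul0r.
  by rewrite tens_mulDr IH IH'.
by rewrite tens_mulE !mul1r.
Qed.

Lemma tens_mul1r : right_id tens_one tens_mul.
Proof.
elim/tens_ind=> [|s s' IH IH'|a b]; first exact: tens_mul0l.
  by rewrite tens_mulDl IH IH'.
by rewrite tens_mulE !mulr1.
Qed.

Lemma tens_mul_scaleAl x s t : x *: tens_mul s t = tens_mul (x *: s) t.
Proof. by rewrite (linear_forZ (tens_mul_linearl t)). Qed.

Lemma tens_mul_scaleAr x s t : x *: tens_mul s t = tens_mul s (x *: t).
Proof. by rewrite (linear_forZ (tens_mul_linearr s)). Qed.

HB.instance Definition _ := Lmodule_isPzAlgebra.Build k (tens A B)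
  tens_mulA tens_mul1l tens_mul1r tens_mulDl tens_mulDr
  tens_mul_scaleAl tens_mul_scaleAr.
HB.instance Definition _ := GRing.Zmodule_isPzRing.Build (tens A B)
  tens_mulA tens_mul1l tens_mul1r tens_mulDl tens_mulDr.

End TensorAlgebra.

Section TensorVector.
Import VectorInternalTheory.
Variables (k : fieldType) (V W : vectType k).

Let m := dim V.
Let n := dim W.
Let ev (i : 'I_m) : V := @r2v k V (delta_mx 0 i).
Let ew (j : 'I_n) : W := @r2v k W (delta_mx 0 j).
Let cv (v : V) (i : 'I_m) : k := @v2r k V v 0 i.
Let cw (w : W) (j : 'I_n) : k := @v2r k W w 0 j.

Let coords (v : V) (w : W) : 'M[k]_(m, n) := \matrix_(i, j) (cv v i * cw w j).

Let to_mx (t : tens V W) : 'M[k]_(m, n) := tens_sum t coords.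
Let of_mx (M : 'M[k]_(m, n)) : tens V W :=
  \sum_i \sum_j M i j *: (ev i *t ew j).

Lemma tens_coords_bilinear : bilinear_for *:%R *:%R coords.
Proof.
split=> [w|v] a x y; apply/matrixP=> i j; rewrite /coords !mxE /cv /cw.
  by rewrite linearP !mxE mulrDl mulrA.
by rewrite linearP !mxE mulrDr mulrCA.
Qed.

Lemma tens_vect_of_linear : linear of_mx.
Proof.
move=> a M N; rewrite /of_mx scaler_sumr -big_split; apply: eq_bigr => i _ /=.
rewrite scaler_sumr -big_split; apply: eq_bigr => j _ /=.
by rewrite !mxE scalerDl scalerA.
Qed.

Lemma tens_vect_vE (v : V) : v = \sum_i cv v i *: ev i.
Proof.
apply: (can_inj (@v2rK k V)).
rewrite linear_sum /= [LHS]row_sum_delta; apply: eq_bigr => i _.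
by rewrite linearZ /= r2vK.
Qed.

Lemma tens_vect_wE (w : W) : w = \sum_j cw w j *: ew j.
Proof.
apply: (can_inj (@v2rK k W)).
rewrite linear_sum /= [LHS]row_sum_delta; apply: eq_bigr => i _.
by rewrite linearZ /= r2vK.
Qed.

Lemma tens_vect_toK : cancel to_mx of_mx.
Proof.
have lto : linear to_mx by exact: tens_sum_linear tens_coords_bilinear.
elim/tens_ind=> [|s t IHs IHt|v w].
- by rewrite (linear_for0 lto) (linear_for0 tens_vect_of_linear).
- by rewrite (linear_forD lto) (linear_forD tens_vect_of_linear) IHs IHt.
rewrite /to_mx tens_sum_tensor; last exact: tens_coords_bilinear.
have lr (u : V) : linear (tensor (V := W) u) by exact: (tensor_bilinear V W).2.
have ll (x : W) : linear ((@tensor _ V W)^~ x) by exact: (tensor_bilinear V W).1.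
rewrite [in RHS](tens_vect_vE v).
rewrite (big_morph (fun u => u *t w) (linear_forD (ll w)) (linear_for0 (ll w))).
apply: eq_bigr => i _; rewrite tensorZl {2}(tens_vect_wE w).
rewrite (big_morph _ (linear_forD (lr _)) (linear_for0 (lr _))) scaler_sumr.
by apply: eq_bigr => j _; rewrite tensorZr scalerA mxE.
Qed.

Lemma tens_vect_ofK : cancel of_mx to_mx.
Proof.
have lto : linear to_mx by exact: tens_sum_linear tens_coords_bilinear.
move=> M; rewrite /of_mx (big_morph _ (linear_forD lto) (linear_for0 lto)).
rewrite [RHS]matrix_sum_delta; apply: eq_bigr => i _.
rewrite (big_morph _ (linear_forD lto) (linear_for0 lto)).
apply: eq_bigr => j _; rewrite (linear_forZ lto); congr (_ *: _).
rewrite /to_mx tens_sum_tensor; last exact: tens_coords_bilinear.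
apply/matrixP=> i' j'; rewrite !mxE /cv /cw !r2vK !mxE /=.
by rewrite -natrM mulnb.
Qed.

Lemma tens_vect_iso : Vector.axiom (m * n) (tens V W).
Proof.
exists (fun t => mxvec (to_mx t)).
  have lto : linear to_mx by exact: tens_sum_linear tens_coords_bilinear.
  by move=> a s t; rewrite lto linearP.
exists (fun x => of_mx (vec_mx x)) => [t|x].
  by rewrite mxvecK tens_vect_toK.
by rewrite tens_vect_ofK vec_mxK.
Qed.

HB.instance Definition _ :=
  Lmodule_hasFinDim.Build k (tens V W) tens_vect_iso.

End TensorVector.

Section QuotientAlgebra.
Variables (k : fieldType) (A : algType k) (G : A -> Prop).

Inductive ideal_gen : A -> Prop :=
| ideal_gen0 : ideal_gen 0
| ideal_genD x y : ideal_gen x -> ideal_gen y -> ideal_gen (x + y)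
| ideal_gen_mul a g b : G g -> ideal_gen (a * g * b).

Lemma ideal_genMl a x : ideal_gen x -> ideal_gen (a * x).
Proof.
elim=> [|y z _ IHy _ IHz|b g c Gg]; first by rewrite mulr0; exact: ideal_gen0.
  by rewrite mulrDr; exact: ideal_genD.
by rewrite !mulrA; exact: ideal_gen_mul.
Qed.

Lemma ideal_genMr a x : ideal_gen x -> ideal_gen (x * a).
Proof.
elim=> [|y z _ IHy _ IHz|b g c Gg]; first by rewrite mul0r; exact: ideal_gen0.
  by rewrite mulrDl; exact: ideal_genD.
by rewrite -mulrA; exact: ideal_gen_mul.
Qed.

Lemma ideal_genN x : ideal_gen x -> ideal_gen (- x).
Proof. by rewrite -mulN1r; exact: ideal_genMl. Qed.

Lemma ideal_genZ a x : ideal_gen x -> ideal_gen (a *: x).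
Proof. by rewrite -mulr_algl; exact: ideal_genMl. Qed.

Definition quot_eqb (x y : A) : bool := `[< ideal_gen (x - y) >].

Lemma quot_eqb_equiv : equiv_class_of quot_eqb.
Proof.
split=> [x|x y|y x z].
- by apply/asboolP; rewrite subrr; exact: ideal_gen0.
- by apply/asboolP/asboolP => /ideal_genN; rewrite opprB.
- move=> /asboolP xy /asboolP yz; apply/asboolP.
  by have := ideal_genD xy yz; rewrite addrA subrK.
Qed.

Canonical quot_eqb_equivRel := EquivRelPack quot_eqb_equiv.
Canonical quot_eqb_encModRel := defaultEncModRel quot_eqb.

(* The quotient of A by the two-sided ideal generated by G. *)
Definition quot_alg := {eq_quot quot_eqb}.
HB.instance Definition _ : EqQuotient _ quot_eqb quot_alg :=
  EqQuotient.on quot_alg.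
HB.instance Definition _ := Choice.on quot_alg.

Definition quot_of (x : A) : quot_alg := \pi_quot_alg x.

Lemma quot_ofP x y : quot_of x = quot_of y <-> ideal_gen (x - y).
Proof.
split=> [/eqP|xy]; first by rewrite piE => /asboolP.
by apply/eqP; rewrite piE; apply/asboolP.
Qed.

Lemma quot_of_repr q : quot_of (repr q) = q. Proof. exact: reprK. Qed.

Lemma repr_quot_of x : ideal_gen (repr (quot_of x) - x).
Proof. by apply/quot_ofP; rewrite quot_of_repr. Qed.

Definition quot_add (p q : quot_alg) := quot_of (repr p + repr q).
Definition quot_opp (p : quot_alg) := quot_of (- repr p).
Definition quot_mul (p q : quot_alg) := quot_of (repr p * repr q).
Definition quot_scale (a : k) (p : quot_alg) := quot_of (a *: repr p).

Lemma quot_addE x y : quot_add (quot_of x) (quot_of y) = quot_of (x + y).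
Proof.
by apply/quot_ofP; rewrite opprD addrACA; apply: ideal_genD;
  exact: repr_quot_of.
Qed.

Lemma quot_oppE x : quot_opp (quot_of x) = quot_of (- x).
Proof.
by apply/quot_ofP; rewrite -opprD; apply: ideal_genN; exact: repr_quot_of.
Qed.

Lemma quot_mulE x y : quot_mul (quot_of x) (quot_of y) = quot_of (x * y).
Proof.
apply/quot_ofP; set x' := repr _; set y' := repr _.
rewrite -[x' * y'](subrK (x * y')) -addrA -mulrBl -mulrBr.
apply: ideal_genD; first by apply: ideal_genMr; exact: repr_quot_of.
by apply: ideal_genMl; exact: repr_quot_of.
Qed.

Lemma quot_scaleE a x : quot_scale a (quot_of x) = quot_of (a *: x).
Proof.
by apply/quot_ofP; rewrite -scalerBr; apply: ideal_genZ; exact: repr_quot_of.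
Qed.

Lemma quot_ind (P : quot_alg -> Prop) :
  (forall x, P (quot_of x)) -> forall q, P q.
Proof. by move=> H q; rewrite -[q]quot_of_repr. Qed.

Let quotE := (quot_addE, quot_oppE, quot_mulE, quot_scaleE).

Lemma quot_addA : associative quot_add.
Proof.
by elim/quot_ind=> x; elim/quot_ind=> y; elim/quot_ind=> z; rewrite !quotE addrA.
Qed.

Lemma quot_addC : commutative quot_add.
Proof. by elim/quot_ind=> x; elim/quot_ind=> y; rewrite !quotE addrC. Qed.

Lemma quot_add0 : left_id (quot_of 0) quot_add.
Proof. by elim/quot_ind=> x; rewrite quotE add0r. Qed.

Lemma quot_addN : left_inverse (quot_of 0) quot_opp quot_add.
Proof. by elim/quot_ind=> x; rewrite !quotE addNr. Qed.

HB.instance Definition _ :=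
  GRing.isZmodule.Build quot_alg quot_addA quot_addC quot_add0 quot_addN.

Lemma quot_of_addE x y : quot_of x + quot_of y = quot_of (x + y).
Proof. exact: quot_addE. Qed.

Lemma quot_scaleA a b p : quot_scale a (quot_scale b p) = quot_scale (a * b) p.
Proof. by elim/quot_ind: p => x; rewrite !quotE scalerA. Qed.

Lemma quot_scale1 : left_id 1 quot_scale.
Proof. by elim/quot_ind=> x; rewrite !quotE scale1r. Qed.

Lemma quot_scaleDr : right_distributive quot_scale +%R.
Proof.
by move=> a; elim/quot_ind=> x; elim/quot_ind=> y;
  rewrite !(quot_of_addE, quotE) scalerDr.
Qed.

Lemma quot_scaleDl p : {morph quot_scale^~ p : a b / a + b}.
Proof.
by elim/quot_ind: p => x a b /=; rewrite !(quot_of_addE, quotE) scalerDl.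
Qed.

HB.instance Definition _ := GRing.Zmodule_isLmodule.Build k quot_alg
  quot_scaleA quot_scale1 quot_scaleDr quot_scaleDl.

Lemma quot_mulA : associative quot_mul.
Proof.
by elim/quot_ind=> x; elim/quot_ind=> y; elim/quot_ind=> z; rewrite !quotE mulrA.
Qed.

Lemma quot_mul1l : left_id (quot_of 1) quot_mul.
Proof. by elim/quot_ind=> x; rewrite quotE mul1r. Qed.

Lemma quot_mul1r : right_id (quot_of 1) quot_mul.
Proof. by elim/quot_ind=> x; rewrite quotE mulr1. Qed.

Lemma quot_mulDl : left_distributive quot_mul +%R.
Proof.
by elim/quot_ind=> x; elim/quot_ind=> y; elim/quot_ind=> z;
  rewrite !(quot_of_addE, quotE) mulrDl.
Qed.

Lemma quot_mulDr : right_distributive quot_mul +%R.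
Proof.
by elim/quot_ind=> x; elim/quot_ind=> y; elim/quot_ind=> z;
  rewrite !(quot_of_addE, quotE) mulrDr.
Qed.

Lemma quot_mul_scaleAl a p q : a *: quot_mul p q = quot_mul (a *: p) q.
Proof.
elim/quot_ind: p => x; elim/quot_ind: q => y.
by rewrite /GRing.scale /= !quotE scalerAl.
Qed.

Lemma quot_mul_scaleAr a p q : a *: quot_mul p q = quot_mul p (a *: q).
Proof.
elim/quot_ind: p => x; elim/quot_ind: q => y.
by rewrite /GRing.scale /= !quotE scalerAr.
Qed.

HB.instance Definition _ := Lmodule_isPzAlgebra.Build k quot_alg
  quot_mulA quot_mul1l quot_mul1r quot_mulDl quot_mulDr
  quot_mul_scaleAl quot_mul_scaleAr.
HB.instance Definition _ := GRing.Zmodule_isPzRing.Build quot_alg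
  quot_mulA quot_mul1l quot_mul1r quot_mulDl quot_mulDr.

End QuotientAlgebra.

(* H[theta]: in {poly H} the indeterminate commutes with the coefficients.  The
   library makes {poly H} an H-module; this alias carries the k-algebra
   structure. *)
Definition poly_alg (k : fieldType) (H : algType k) : Type := {poly H}.

Section PolyAlgebra.
Variables (k : fieldType) (H : algType k).

HB.instance Definition _ := GRing.NzRing.copy (poly_alg H) {poly H}.

Definition poly_alg_scale (a : k) (p : poly_alg H) : poly_alg H :=
  a%:A *: (p : {poly H}).

Lemma poly_alg_scaleA a b p :
  poly_alg_scale a (poly_alg_scale b p) = poly_alg_scale (a * b) p.
Proof. by rewrite /poly_alg_scale scalerA -scalerAl mul1r scalerA. Qed.

Lemma poly_alg_scale1 : left_id 1 poly_alg_scale.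
Proof. by move=> p; rewrite /poly_alg_scale !scale1r. Qed.

Lemma poly_alg_scaleDr : right_distributive poly_alg_scale +%R.
Proof. by move=> a p q; exact: scalerDr. Qed.

Lemma poly_alg_scaleDl p : {morph poly_alg_scale^~ p : a b / a + b}.
Proof.
move=> a b; rewrite /poly_alg_scale (scalerDl (1 : H) a b); exact: scalerDl.
Qed.

HB.instance Definition _ := GRing.Zmodule_isLmodule.Build k (poly_alg H)
  poly_alg_scaleA poly_alg_scale1 poly_alg_scaleDr poly_alg_scaleDl.

Lemma poly_alg_scaleAl (a : k) (p q : poly_alg H) : a *: (p * q) = a *: p * q.
Proof. exact: scalerAl. Qed.

HB.instance Definition _ :=
  GRing.Lmodule_isLalgebra.Build k (poly_alg H) poly_alg_scaleAl.

Lemma poly_alg_scaleAr (a : k) (p q : poly_alg H) : a *: (p * q) = p * (a *: q).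
Proof.
apply/polyP=> i; rewrite [LHS]coefZ !coefM mulr_sumr; apply: eq_bigr => j _.
by rewrite [in RHS]coefZ !mulr_algl scalerAr.
Qed.

HB.instance Definition _ :=
  GRing.Lalgebra_isAlgebra.Build k (poly_alg H) poly_alg_scaleAr.

End PolyAlgebra.

(* H(theta) = H[theta] / <theta^2 - w>. *)
Definition adjoin_sqrt (k : fieldType) (H : algType k) (w : H) : Type :=
  @quot_alg k (poly_alg H) (fun p : {poly H} => p = 'X ^+ 2 - w%:P).

HB.instance Definition _ (k : fieldType) (H : algType k) (w : H) :=
  PzAlgebra.on (adjoin_sqrt w).
HB.instance Definition _ (k : fieldType) (H : algType k) (w : H) :=
  GRing.PzRing.on (adjoin_sqrt w).

Definition adjoin_in (k : fieldType) (H : algType k) (w : H) (h : H) :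
    adjoin_sqrt w :=
  quot_of _ (h%:P : poly_alg H).

Definition adjoin_theta (k : fieldType) (H : algType k) (w : H) :
    adjoin_sqrt w :=
  quot_of _ ('X : poly_alg H).

Section QuasiHopf.
Variables (k : fieldType) (A : pzAlgType k).

Record quasi_hopf_data := QuasiHopfData {
  qh_comul : A -> tens A A;
  qh_counit : A -> k;
  qh_reassoc : tens (tens A A) A;
  qh_antipode : A -> A;
  qh_alpha : A;
  qh_beta : A
}.

(* Every triple (quadruple) tensor power is bracketed to the left, and [tassoc]
   rebrackets. *)
Definition is_quasi_bialgebra (D : quasi_hopf_data) : Prop :=
  let Delta := qh_comul D in let eps := qh_counit D in
  let Phi := qh_reassoc D in
  [/\ linear Delta /\ monoid_morphism Delta,
      scalar eps /\ monoid_morphism eps,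
      invertible Phi
    & [/\ forall h, tassoc (tmap id Delta (Delta h)) =
                    Phi * tmap Delta id (Delta h) * inverse Phi,
          forall h, \sw2_(h1, h2 <- Delta h) (eps h2 *: h1) = h /\
                    \sw2_(h1, h2 <- Delta h) (eps h1 *: h2) = h,
          tmap tassoc id (tassoc ((1 : A) *t Phi)) *
          tmap (fun t => tassoc (tmap id Delta t)) id Phi * (Phi *t (1 : A)) =
          tassoc (tmap id Delta Phi) * tmap (tmap Delta id) id Phi
        & \sw3_(X1, X2, X3 <- Phi) (eps X2 *: (X1 *t X3)) = 1]].

Definition is_quasi_hopf (D : quasi_hopf_data) : Prop :=
  let Delta := qh_comul D in let eps := qh_counit D in
  let Phi := qh_reassoc D in let S := qh_antipode D in
  let alpha := qh_alpha D in let beta := qh_beta D in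
  [/\ is_quasi_bialgebra D,
      [/\ linear S, S 1 = 1 & forall x y, S (x * y) = S y * S x],
      forall h, \sw2_(h1, h2 <- Delta h) (S h1 * alpha * h2) = eps h *: alpha /\
                \sw2_(h1, h2 <- Delta h) (h1 * beta * S h2) = eps h *: beta,
      \sw3_(X1, X2, X3 <- Phi) (X1 * beta * S X2 * alpha * X3) = 1
    & \sw3_(x1, x2, x3 <- inverse Phi) (S x1 * alpha * x2 * beta * S x3) = 1].

Record quasi_hopf := QuasiHopf {
  qh_data :> quasi_hopf_data;
  qh_axioms : is_quasi_hopf qh_data
}.

Definition quasitriangular (D : quasi_hopf_data) (R : tens A A) : Prop :=
  let Delta := qh_comul D in let Phi := qh_reassoc D in
  let phi := inverse Phi in
  [/\ invertible R,
      tmap Delta id R =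
      \sw3_(X1, X2, X3 <- Phi) \sw2_(R1, R2 <- R) \sw3_(x1, x2, x3 <- phi)
      \sw2_(r1, r2 <- R) \sw3_(Y1, Y2, Y3 <- Phi)
        ((X2 * R1 * x1 * Y1) *t (X3 * x3 * r1 * Y2) *t (X1 * R2 * x2 * r2 * Y3)),
      tassoc (tmap id Delta R) =
      \sw3_(x1, x2, x3 <- phi) \sw2_(R1, R2 <- R) \sw3_(X1, X2, X3 <- Phi)
      \sw2_(r1, r2 <- R) \sw3_(y1, y2, y3 <- phi)
        ((x3 * R1 * X2 * r1 * y1) *t (x1 * X1 * r2 * y2) *t (x2 * R2 * X3 * y3))
    & forall h, tswap (Delta h) * R = R * Delta h].

Definition qt_u (D : quasi_hopf_data) (R : tens A A) : A :=
  let S := qh_antipode D in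
  \sw2_(R1, R2 <- R) \sw3_(x1, x2, x3 <- inverse (qh_reassoc D))
    (S (R2 * x2 * qh_beta D * S x3) * qh_alpha D * R1 * x1).

End QuasiHopf.

Section Representations.
Variables (k : fieldType) (A : pzAlgType k).

Definition is_action (V : vectType k) (act : A -> V -> V) : Prop :=
  [/\ forall v, linear (act^~ v), forall a, linear (act a),
      forall v, act 1 v = v & forall a b v, act (a * b) v = act a (act b v)].

Record rep := Rep {
  rep_space :> vectType k;
  rep_act : A -> rep_space -> rep_space;
  rep_actP : is_action rep_act
}.

Definition is_rep_morphism (V W : rep) (f : V -> W) : Prop :=
  linear f /\ forall a v, f (rep_act a v) = rep_act a (f v).

Definition tens_act (V W : rep) (r : tens A A) (t : tens V W) : tens V W :=
  \sw2_(a, b <- r) \sw2_(v, w <- t) (rep_act a v *t rep_act b w).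

Definition tens_act3 (U V W : rep) (r : tens (tens A A) A)
    (t : tens (tens U V) W) : tens (tens U V) W :=
  \sw2_(p, c <- r) \sw2_(q, w <- t) (tens_act p q *t rep_act c w).

Lemma rep_act_linearl (V : rep) (v : V) : linear ((@rep_act V)^~ v).
Proof. by case: (rep_actP V) => + _ _ _; apply. Qed.

Lemma rep_act_linearr (V : rep) a : linear (@rep_act V a).
Proof. by case: (rep_actP V) => _ + _ _; apply. Qed.

Lemma rep_act1 (V : rep) (v : V) : rep_act 1 v = v.
Proof. by case: (rep_actP V) => _ _ + _; apply. Qed.

Lemma rep_actM (V : rep) a b (v : V) :
  rep_act (a * b) v = rep_act a (rep_act b v).
Proof. by case: (rep_actP V) => _ _ _; apply. Qed.

Section TensAct.
Variables V W : rep.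

Lemma tens_act_bilinear1 a b :
  bilinear_for *:%R *:%R (fun (v : V) (w : W) => rep_act a v *t rep_act b w).
Proof.
split=> [w|v] x y z /=; rewrite rep_act_linearr.
  by rewrite tensorDl tensorZl.
by rewrite tensorDr tensorZr.
Qed.

Lemma tens_act_bilinear2 (t : tens V W) :
  bilinear_for *:%R *:%R
    (fun a b => \sw2_(v, w <- t) (rep_act a v *t rep_act b w)).
Proof.
split=> [b|a] x y z /=; rewrite -tens_sum_linear_fun; apply: eq_tens_sum => v w;
  rewrite rep_act_linearl.
  by rewrite tensorDl tensorZl.
by rewrite tensorDr tensorZr.
Qed.

Lemma tens_actE a b (v : V) (w : W) :
  tens_act (a *t b) (v *t w) = rep_act a v *t rep_act b w.
Proof.
rewrite /tens_act tens_sum_tensor; last exact: tens_act_bilinear2.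
by rewrite tens_sum_tensor //; exact: tens_act_bilinear1.
Qed.

Lemma tens_act_linearl (t : tens V W) : linear ((@tens_act V W)^~ t).
Proof. exact: tens_sum_linear (tens_act_bilinear2 t). Qed.

Lemma tens_act_linearr r : linear (@tens_act V W r).
Proof.
move=> x t t'; rewrite /tens_act -tens_sum_linear_fun.
by apply: eq_tens_sum => a b; apply: (tens_sum_linear (tens_act_bilinear1 a b)).
Qed.

Lemma tens_act1 (t : tens V W) : tens_act 1 t = t.
Proof.
elim/tens_ind: t => [|s t IHs IHt|v w].
- by rewrite (linear_for0 (tens_act_linearr _)).
- by rewrite (linear_forD (tens_act_linearr _)) IHs IHt.
by rewrite tens_actE !rep_act1.
Qed.

Lemma tens_actM r s (t : tens V W) :
  tens_act (r * s) t = tens_act r (tens_act s t).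
Proof.
elim/tens_ind: r => [|r r' IH IH'|a b].
- by rewrite mul0r !(linear_for0 (tens_act_linearl _)).
- by rewrite mulrDl !(linear_forD (tens_act_linearl _)) IH IH'.
elim/tens_ind: s => [|s s' IH IH'|c d].
- rewrite mulr0 !(linear_for0 (tens_act_linearl _)).
  by rewrite (linear_for0 (tens_act_linearr _)).
- rewrite mulrDr !(linear_forD (tens_act_linearl _)) IH IH'.
  by rewrite (linear_forD (tens_act_linearr _)).
elim/tens_ind: t => [|t t' IH IH'|v w].
- by rewrite !(linear_for0 (tens_act_linearr _)).
- by rewrite !(linear_forD (tens_act_linearr _)) IH IH'.
by rewrite [_ * _]tens_mulE !tens_actE !rep_actM.
Qed.

End TensAct.

Variable Q : quasi_hopf A.
Let Delta := qh_comul Q.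
Let eps := qh_counit Q.
Let S := qh_antipode Q.

Lemma rep_tens_subproof (V W : rep) :
  is_action (fun a (t : tens V W) => tens_act (Delta a) t).
Proof.
have [[[lD [D1 DM]] _ _ _] _ _ _ _] := qh_axioms Q.
split=> [t a x y|a|t|a b t].
- by rewrite /Delta lD tens_act_linearl.
- exact: tens_act_linearr.
- by rewrite /Delta D1 tens_act1.
- by rewrite /Delta DM tens_actM.
Qed.

Definition rep_tens (V W : rep) : rep := Rep (rep_tens_subproof V W).

Lemma rep_unit_subproof : is_action (fun a (x : k^o) => eps a *: x).
Proof.
have [[_ [le [e1 eM]] _ _] _ _ _ _] := qh_axioms Q.
split=> [x a y z|a b x y|x|a b x].
- by rewrite /eps le scalerDl scalerA.
- by rewrite scalerDr !scalerA mulrC.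
- by rewrite /eps e1 scale1r.
- by rewrite /eps eM scalerA.
Qed.

Definition rep_unit : rep := Rep rep_unit_subproof.

Definition dual_act (V : rep) (a : A) (f : 'Hom(V, k^o)) : 'Hom(V, k^o) :=
  linfun (fun v => f (rep_act (S a) v)).

Lemma dual_actE (V : rep) a (f : 'Hom(V, k^o)) v :
  dual_act a f v = f (rep_act (S a) v).
Proof.
have lf : linear (fun v => f (rep_act (S a) v)).
  by move=> x y z; rewrite rep_act_linearr linearP.
pose F := HB.pack_for {linear V -> k^o} (fun v => f (rep_act (S a) v))
  (GRing.isLinear.Build _ _ _ _ _ lf).
exact: (lfunE F).
Qed.

Lemma rep_dual_subproof (V : rep) : is_action (@dual_act V).
Proof.
have [_ [lS S1 SM] _ _ _] := qh_axioms Q.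
split=> [f a x y|a x f g|f|a b f]; apply/lfunP=> v;
  rewrite ?(add_lfunE, scale_lfunE, dual_actE) //.
- by rewrite /S lS rep_act_linearl linearP.
- by rewrite /S S1 rep_act1.
- by rewrite /S SM rep_actM.
Qed.

Definition rep_dual (V : rep) : rep := Rep (@rep_dual_subproof V).

Definition rep_ev (V : rep) (t : tens (rep_dual V) V) : k^o :=
  \sw2_(f, v <- t) (f (rep_act (qh_alpha Q) v)).

(* The dual bases are [vbasis] and its coordinate functions. *)
Definition rep_coev (V : rep) (c : k^o) : tens V (rep_dual V) :=
  (c : k) *: \sum_(i < \dim {:V})
    (rep_act (qh_beta Q) (vbasis {:V})`_i *t
     (linfun (coord (vbasis {:V}) i : V -> k^o) : rep_dual V)).

Definition rep_lunit (V : rep) (t : tens k^o V) : V := \sw2_(c, v <- t) ((c : k) *: v).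

(* X (x) (Y (x) Z) -> (X (x) Y) (x) Z, the inverse of the associativity
   constraint given by the action of Phi. *)
Definition rep_assoc_inv (X Y Z : rep) (t : tens X (tens Y Z)) :
    tens (tens X Y) Z :=
  tens_act3 (inverse (qh_reassoc Q)) (tassoc t).

(* f^* : W^* -> W^* (x) (V (x) V^* ) -> (W^* (x) V) (x) V^*
       -> (W^* (x) W) (x) V^* -> V^* *)
Definition rep_dual_morphism (V W : rep) (f : V -> W) (g : rep_dual W) :
    rep_dual V :=
  rep_lunit (tmap (@rep_ev W) id
    (tmap (tmap id f) id (rep_assoc_inv (g *t rep_coev V 1)))).

Definition rep_braiding (R : tens A A) (X Y : rep) (t : tens X Y) : tens Y X :=
  \sw2_(R1, R2 <- R) \sw2_(x, y <- t) (rep_act R2 y *t rep_act R1 x).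

Definition ribbon_twist (R : tens A A) (eta : forall V : rep, V -> V) : Prop :=
  [/\ forall V : rep, is_rep_morphism (@eta V) /\ bijective (@eta V),
      forall (V W : rep) (f : V -> W), is_rep_morphism f ->
        forall v, f (eta V v) = eta W (f v),
      forall (V W : rep) (t : tens V W),
        eta (rep_tens V W) t =
        tmap (@eta V) (@eta W) (rep_braiding R (rep_braiding R t))
    & forall (V : rep) (g : rep_dual V),
        eta (rep_dual V) g = rep_dual_morphism (@eta V) g].

End Representations.

(* D' is the structure on H(theta) prescribed by D on H and by its values on
   theta. *)
Definition extends_to_theta (k : fieldType) (H : algType k)
    (D : quasi_hopf_data H) (R : tens H H) (w : H)
    (D' : quasi_hopf_data (adjoin_sqrt w)) : Prop :=
  let i := adjoin_in w in let theta := adjoin_theta w in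
  [/\ [/\ forall h, qh_comul D' (i h) = tmap i i (qh_comul D h),
          forall h, qh_counit D' (i h) = qh_counit D h
        & forall h, qh_antipode D' (i h) = i (qh_antipode D h)],
      [/\ qh_comul D' theta =
          (theta *t theta) * inverse (tswap (tmap i i R) * tmap i i R),
          qh_counit D' theta = 1
        & qh_antipode D' theta = theta]
    & [/\ qh_reassoc D' = tmap (tmap i i) i (qh_reassoc D),
          qh_alpha D' = i (qh_alpha D)
        & qh_beta D' = i (qh_beta D)]].

(* Main.v *)
(** Write M = R_21 R, w = u S(u), T(a (x) b) = S(a) alpha b, and let a pairing of
    two modules be invariant when it is H-linear to k.  By the pentagon every
    invariant pairing factors through T, so T(M) = w alpha says that M acts as w
    on every invariant pairing.  Applying this to the two bracketings of an
    invariant trilinear form, with the full twist identity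
    M_12 M_(12)3 = M_23 M_1(23) (up to Phi) and the encircling of the middle
    strand M_12 M_23 = w_2, gives Delta(w) M^2 = w (x) w without the Drinfeld
    twist f of S.  The element u is invertible because the pairing ev o c and the
    copairing c^-1 o coev satisfy both zigzag identities, which follow from the
    hexagons; hence S is bijective and w is central and invertible.  Finally
    H(theta) is free over H on 1 and theta, so the structure maps extend by
    theta |-> (theta (x) theta) M^-1 since the square of the right-hand side is
    Delta(w), and the axioms are checked on H and on theta: coassociativity is the
    full twist identity, and the antipode axioms are T(M) = w alpha and its dual. *)

Require Import Defs.
From mathcomp Require Import all_boot all_algebra.
From mathcomp Require Import boolp ring.
Set Implicit Arguments.
Unset Strict Implicit.
Unset Printing Implicit Defensive.
Import GRing.Theory.
Local Open Scope ring_scope.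

(** * Tensor calculus *)

(** The value of theta^2 is dictated by the antipode axiom: for central theta with S(theta) = theta
    the axiom at theta reads theta^2 T(M^-1) = alpha, and w T(M^-1) = alpha is T(M) = w alpha
    applied to M M^-1 = 1. Two obstacles shape the proof. The antipode reverses the coproduct only
    up to a twist, so Delta(w) is read off from a form in which Delta(S(c)) is never expanded. And
    alpha, beta need not be invertible, so the key identities first appear multiplied by alpha: the
    unknown factor is then shown to commute with enough elements to be cancelled by S(x1) alpha x2
    beta S(x3) = 1. This happens for u v = 1 and again for Delta(w). All braid calculations take
    place in an arbitrary algebra B, with commuting algebra maps A -> B as strands. Doubling a
    strand with Delta or erasing it with the counit gives again such a map, so an identity proved
    for strands p, q, r also serves for composite ones, and the rebracketing of tensor powers
    disappears. *)

Section Linear.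
Variable k : fieldType.
Implicit Types U V W : lmodType k.

Lemma linear_for_sum U V (f : U -> V) (lf : linear f) (I : Type) (r : seq I)
    (F : I -> U) :
  f (\sum_(i <- r) F i) = \sum_(i <- r) f (F i).
Proof. exact: (big_morph f (linear_forD lf) (linear_for0 lf)). Qed.

Lemma linear_id U : linear (@id U). Proof. by []. Qed.

Lemma linear_comp U V W (f : V -> W) (g : U -> V) :
  linear f -> linear g -> linear (f \o g).
Proof. by move=> lf lg a x y; rewrite /= lg lf. Qed.

(** Both sides sum over the same representative of [t], so linearity carries [f] inside. With
    [eq_tens_sum] this reduces identities between nested Sweedler sums to their general terms. *)
Lemma lin_tens_sum U V W W' (f : W -> W') (lf : linear f) (t : tens U V)
    (g : U -> V -> W) :
  f (\sw2_(u, v <- t) g u v) = \sw2_(u, v <- t) f (g u v).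
Proof. exact: linear_for_sum. Qed.

Lemma tens_lin_ext U V W (f g : tens U V -> W) : linear f -> linear g ->
  (forall u v, f (u *t v) = g (u *t v)) -> forall t, f t = g t.
Proof.
move=> lf lg fg; elim/tens_ind=> [|s t IHs IHt|u v] //.
  by rewrite (linear_for0 lf) (linear_for0 lg).
by rewrite (linear_forD lf) (linear_forD lg) IHs IHt.
Qed.

Lemma tmap_bilinear U V U' V' (f : U -> U') (g : V -> V') :
  linear f -> linear g -> bilinear_for *:%R *:%R (fun u v => f u *t g v).
Proof.
by move=> lf lg; split=> [v|u] a x y /=;
  rewrite ?lf ?lg ?(tensorDl, tensorDr, tensorZl, tensorZr).
Qed.

Lemma tmap_linear U V U' V' (f : U -> U') (g : V -> V') :
  linear f -> linear g -> linear (tmap f g).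
Proof. by move=> lf lg; apply/tens_sum_linear/tmap_bilinear. Qed.

Lemma tmapE U V U' V' (f : U -> U') (g : V -> V') : linear f -> linear g ->
  forall u v, tmap f g (u *t v) = f u *t g v.
Proof. by move=> lf lg u v; rewrite [LHS]tens_sum_tensor //; apply: tmap_bilinear. Qed.

Lemma tswap_linear U V : linear (@tswap k U V).
Proof.
apply: tens_sum_linear; split=> [v|u] a x y /=;
  by rewrite ?(tensorDl, tensorDr, tensorZl, tensorZr).
Qed.

Lemma tswapE U V (u : U) (v : V) : tswap (u *t v) = v *t u.
Proof.
rewrite [LHS]tens_sum_tensor //; split=> [y|x] a z t /=;
  by rewrite ?(tensorDl, tensorDr, tensorZl, tensorZr).
Qed.

Lemma tassoc_bilinear_in U V W (u : U) :
  bilinear_for *:%R *:%R (fun (v : V) (w : W) => u *t v *t w).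
Proof.
split=> [y|x] a z t /=;
  by rewrite ?(tensorDl, tensorDr, tensorZl, tensorZr).
Qed.

Lemma tassoc_bilinear U V W :
  bilinear_for *:%R *:%R
    (fun (u : U) (p : tens V W) => \sw2_(v, w <- p) (u *t v *t w)).
Proof.
split=> [p|u] a x y /=.
  rewrite -tens_sum_linear_fun; apply: eq_tens_sum => v w.
  by rewrite !(tensorDl, tensorZl).
have := tens_sum_linear (@tassoc_bilinear_in _ V W u) a x y; exact.
Qed.

Lemma tassoc_linear U V W : linear (@tassoc k U V W).
Proof. exact: tens_sum_linear (tassoc_bilinear U V W). Qed.

Lemma tassocE U V W (u : U) (v : V) (w : W) :
  tassoc (u *t (v *t w)) = u *t v *t w.
Proof.
rewrite /tassoc tens_sum_tensor; last exact: tassoc_bilinear.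
by rewrite tens_sum_tensor //; exact: tassoc_bilinear_in.
Qed.

End Linear.

(** * Algebra maps and leg notation *)

Section Algebra.
Variable k : fieldType.
Implicit Types A B C : pzAlgType k.

Definition algmor A B (f : A -> B) : Prop := linear f /\ monoid_morphism f.

Definition commuting (U V : Type) B (f : U -> B) (g : V -> B) : Prop :=
  forall a b, f a * g b = g b * f a.

Lemma algmor_lin A B (f : A -> B) : algmor f -> linear f. Proof. by case. Qed.
Lemma algmor1 A B (f : A -> B) : algmor f -> f 1 = 1. Proof. by case=> _ []. Qed.
Lemma algmorM A B (f : A -> B) : algmor f -> forall x y, f (x * y) = f x * f y.
Proof. by case=> _ []. Qed.

Lemma algmor_id A : algmor (@id A). Proof. by []. Qed.

Lemma algmor_comp A B C (f : B -> C) (g : A -> B) :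
  algmor f -> algmor g -> algmor (f \o g).
Proof.
move=> [lf [f1 fM]] [lg [g1 gM]]; split; first exact: linear_comp.
by split=> [|x y] /=; rewrite ?g1 ?f1 ?gM ?fM.
Qed.

Lemma mulr_linearl A (x : A) : linear (fun y : A => x * y).
Proof. by move=> a y z; rewrite mulrDr pzscalerAr. Qed.

Lemma mulr_linearr A (x : A) : linear (fun y : A => y * x).
Proof. by move=> a y z; rewrite mulrDl pzscalerAl. Qed.

Lemma tens_sum_mull A (U V : lmodType k) (t : tens U V) (f : U -> V -> A) x :
  (\sw2_(u, v <- t) f u v) * x = \sw2_(u, v <- t) (f u v * x).
Proof. exact: (lin_tens_sum (mulr_linearr x)). Qed.

Lemma tens_sum_mulr A (U V : lmodType k) (t : tens U V) (f : U -> V -> A) x :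
  x * (\sw2_(u, v <- t) f u v) = \sw2_(u, v <- t) (x * f u v).
Proof. exact: (lin_tens_sum (mulr_linearl x)). Qed.

Lemma tensM A B (a c : A) (b d : B) :
  (a *t b) * (c *t d) = (a * c) *t (b * d).
Proof. exact: tens_mulE. Qed.

Lemma commuting_sym (U V : Type) B (f : U -> B) (g : V -> B) :
  commuting f g -> commuting g f.
Proof. by move=> fg a b; rewrite fg. Qed.

Lemma commuting_comp (U U' V : Type) B (f : U -> B) (g : V -> B) (h : U' -> U) :
  commuting f g -> commuting (f \o h) g.
Proof. by move=> fg a b; exact: fg. Qed.

Lemma commuting_compr (U U' V : Type) B (f : U -> B) (g : V -> B) (h : U' -> V) :
  commuting f g -> commuting f (g \o h).
Proof. by move=> fg a b; exact: fg. Qed.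

Lemma invertibleW A (x : A) : invertible x -> x * inverse x = 1 /\ inverse x * x = 1.
Proof. by move=> [y [xy yx]]; rewrite (inverseE xy yx). Qed.

Lemma algmor_inverse A B (f : A -> B) x : algmor f -> invertible x ->
  invertible (f x) /\ inverse (f x) = f (inverse x).
Proof.
move=> mf ix; have [xy yx] := invertibleW ix.
have fxy : f x * f (inverse x) = 1 by rewrite -algmorM // xy algmor1.
have fyx : f (inverse x) * f x = 1 by rewrite -algmorM // yx algmor1.
by split; [exists (f (inverse x)) | apply: inverseE].
Qed.

(* t_{pq} in leg notation; p and q are usually algebra maps with commuting
   images, such as two of the inclusions of H in a tensor power of H. *)
Definition tmul (U V : lmodType k) B (p : U -> B) (q : V -> B) (t : tens U V) : B :=
  \sw2_(a, b <- t) (p a * q b).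

Section Tmul.
Variables (U V : lmodType k) (B : pzAlgType k) (p : U -> B) (q : V -> B).
Hypotheses (lp : linear p) (lq : linear q).

Lemma tmul_bilinear : bilinear_for *:%R *:%R (fun a b => p a * q b).
Proof.
split=> [b|a] x y z /=; first by rewrite lp mulrDl pzscalerAl.
by rewrite lq mulrDr pzscalerAr.
Qed.

Lemma tmul_linear : linear (tmul p q).
Proof. exact: tens_sum_linear tmul_bilinear. Qed.

Lemma tmulE a b : tmul p q (a *t b) = p a * q b.
Proof. exact: tens_sum_tensor tmul_bilinear. Qed.

Lemma tmul_tmap (U' V' : lmodType k) (f : U' -> U) (g : V' -> V) t :
  linear f -> linear g -> tmul p q (tmap f g t) = tmul (p \o f) (q \o g) t.
Proof.
move=> lf lg; rewrite [LHS](lin_tens_sum tmul_linear).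
by apply: eq_tens_sum => a b; rewrite tmulE.
Qed.

Lemma commuting_tmull (W : Type) (r : W -> B) :
  commuting p r -> commuting q r -> commuting (tmul p q) r.
Proof.
move=> pr qr t b; rewrite tens_sum_mull tens_sum_mulr.
by apply: eq_tens_sum => x y; rewrite -mulrA qr mulrA pr mulrA.
Qed.

End Tmul.

Lemma tmul_swap (U V : lmodType k) B (p : U -> B) (q : V -> B) t :
  linear p -> linear q -> commuting p q -> tmul q p (tswap t) = tmul p q t.
Proof.
move=> lp lq pq; move: t; apply: (tens_lin_ext (f := tmul q p \o tswap)).
- exact: linear_comp (tmul_linear lq lp) (@tswap_linear _ _ _).
- exact: tmul_linear.
by move=> a b /=; rewrite tswapE !tmulE.
Qed.

Lemma tmul_assoc (U V W : lmodType k) B (p : U -> B) (q : V -> B) (r : W -> B) t :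
  linear p -> linear q -> linear r ->
  tmul (tmul p q) r (tassoc t) = tmul p (tmul q r) t.
Proof.
move=> lp lq lr; have lpq := tmul_linear lp lq; have lqr := tmul_linear lq lr.
move: t; apply: (tens_lin_ext (f := tmul (tmul p q) r \o tassoc)) => [||u].
- by apply: linear_comp; [exact: tmul_linear | exact: tassoc_linear].
- exact: tmul_linear.
move=> v /=; rewrite (tmulE lp lqr); move: v.
apply: (tens_lin_ext (f := fun v => tmul (tmul p q) r (tassoc (u *t v)))
                     (g := fun v => p u * tmul q r v)).
- move=> a x y; rewrite tensorDr tensorZr (@tassoc_linear _ U V W a) tmul_linear //.
- exact: (linear_comp (mulr_linearl _)).
by move=> v w; rewrite tassocE !tmulE // mulrA.
Qed.

(** The universal property of the tensor product of algebras. Substituting strands into an identity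
    of tensors means applying this map to both sides. *)
Lemma tmul_algmor A1 A2 B (p : A1 -> B) (q : A2 -> B) :
  algmor p -> algmor q -> commuting p q -> algmor (tmul p q).
Proof.
move=> [lp [p1 pM]] [lq [q1 qM]] pq; split; first exact: tmul_linear.
split=> [|s t]; first by rewrite tmulE // p1 q1 mul1r.
have l := tmul_linear lp lq.
move: s; apply: (tens_lin_ext (f := fun s => tmul p q (s * t))
  (g := fun s => tmul p q s * tmul p q t)).
- exact: (linear_comp l (mulr_linearr t)).
- exact: (linear_comp (mulr_linearr _) l).
move=> a b; move: t; apply: (tens_lin_ext (f := fun t => tmul p q (a *t b * t))
  (g := fun t => tmul p q (a *t b) * tmul p q t)).
- exact: (linear_comp l (mulr_linearl _)).
- exact: (linear_comp (mulr_linearl _) l).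
by move=> c d; rewrite tensM !tmulE // pM qM !mulrA -(mulrA _ (p c)) pq mulrA.
Qed.

End Algebra.

Lemma commuting_tmulr (k : fieldType) (U V : lmodType k) (W : Type)
    (B : pzAlgType k) (p : U -> B) (q : V -> B) (r : W -> B) :
  commuting r p -> commuting r q -> commuting r (tmul p q).
Proof.
move=> rp rq; apply/commuting_sym/commuting_tmull; exact: commuting_sym.
Qed.

Section TmulMore.
Variables (k : fieldType) (B : pzAlgType k).

(** Naturality of the braiding in leg form: typically [y] is an R-matrix in two strands, [f] and [g]
    are these strands doubled in the two orders, and [r] is a strand that [y] does not touch. *)
Lemma tmul_intertwine (U V : lmodType k) (f g : U -> B) (r : V -> B) y :
  (forall a, y * f a = g a * y) -> (forall b, y * r b = r b * y) ->
  forall t, y * tmul f r t = tmul g r t * y.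
Proof.
move=> fg yr t; rewrite tens_sum_mull tens_sum_mulr; apply: eq_tens_sum => a b.
by rewrite mulrA fg -mulrA yr mulrA.
Qed.

Lemma tmul_intertwiner (U V : lmodType k) (f g : U -> B) (r : V -> B) y :
  (forall a, y * f a = g a * y) -> (forall b, y * r b = r b * y) ->
  forall t, y * tmul r f t = tmul r g t * y.
Proof.
move=> fg yr t; rewrite tens_sum_mull tens_sum_mulr; apply: eq_tens_sum => a b.
by rewrite mulrA yr -mulrA fg mulrA.
Qed.

Lemma commutes_tmul (U V : lmodType k) (W : Type) (p : U -> B) (q : V -> B)
    (r : W -> B) : commuting p r -> commuting q r ->
  forall t b, tmul p q t * r b = r b * tmul p q t.
Proof. by move=> pr qr; exact: commuting_tmull. Qed.

End TmulMore.

Notation tmul3 p q r := (tmul (tmul p q) r).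

Section Legs.
Variables (k : fieldType) (A : pzAlgType k).

(* The legs p and q doubled into a single one by the comultiplication. *)
Definition cab (D : quasi_hopf_data A) (B : pzAlgType k) (p q : A -> B) (h : A) : B :=
  tmul p q (qh_comul D h).

(* The leg on which H acts through the counit. *)
Definition uleg (D : quasi_hopf_data A) (B : pzAlgType k) (h : A) : B :=
  qh_counit D h *: (1 : B).

Lemma commuting_cabl D (B : pzAlgType k) (p q : A -> B) (W : Type) (r : W -> B) :
  commuting p r -> commuting q r -> commuting (cab D p q) r.
Proof. by move=> pr qr h b; exact: commuting_tmull. Qed.

Lemma commuting_cabr D (B : pzAlgType k) (p q : A -> B) (W : Type) (r : W -> B) :
  commuting r p -> commuting r q -> commuting r (cab D p q).
Proof. by move=> pr qr h b; exact: commuting_tmulr. Qed.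

Lemma commuting_ulegl D (B : pzAlgType k) (W : Type) (r : W -> B) :
  commuting (uleg D B) r.
Proof. by move=> h b; rewrite /uleg -pzscalerAl -pzscalerAr mul1r mulr1. Qed.

Lemma commuting_ulegr D (B : pzAlgType k) (W : Type) (r : W -> B) :
  commuting r (uleg D B).
Proof. exact/commuting_sym/commuting_ulegl. Qed.

Lemma cab_algmor (D : quasi_hopf_data A) (B : pzAlgType k) (p q : A -> B) :
  algmor (qh_comul D) -> algmor p -> algmor q -> commuting p q ->
  algmor (cab D p q).
Proof. by move=> mD mp mq pq; apply: algmor_comp => //; exact: tmul_algmor. Qed.

End Legs.

Create HintDb legs_db.

(** Side conditions on strands, namely commutation, multiplicativity and linearity, follow the way a
    strand is built from [tmul], [cab], [uleg] and composition. *)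
Ltac leg :=
  first [ assumption | solve [auto with legs_db] | match goal with
  | |- commuting (tmul _ _) _ => apply: commuting_tmull; leg
  | |- commuting (cab _ _ _) _ => apply: commuting_cabl; leg
  | |- commuting (uleg _ _) _ => exact: commuting_ulegl
  | |- commuting (_ \o _) _ => apply: commuting_comp; leg
  | |- commuting _ (tmul _ _) => apply: commuting_tmulr; leg
  | |- commuting _ (cab _ _ _) => apply: commuting_cabr; leg
  | |- commuting _ (uleg _ _) => exact: commuting_ulegr
  | |- commuting _ (_ \o _) => apply: commuting_compr; leg
  | |- commuting _ _ => apply: commuting_sym; first [assumption | solve [auto with legs_db]]
  | |- algmor (tmul _ _) => apply: tmul_algmor; leg
  | |- algmor (cab _ _ _) => apply: cab_algmor; leg
  | |- algmor (_ \o _) => apply: algmor_comp; leg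
  | |- algmor id => exact: algmor_id
  | |- GRing.linear_for _ (tmul _ _) => apply: tmul_linear; leg
  | |- GRing.linear_for _ (_ \o _) => apply: linear_comp; leg
  | |- GRing.linear_for _ (tmap _ _) => apply: tmap_linear; leg
  | |- GRing.linear_for _ tassoc => exact: tassoc_linear
  | |- GRing.linear_for _ tswap => exact: tswap_linear
  | |- GRing.linear_for _ id => exact: linear_id
  | |- GRing.linear_for _ _ => apply: algmor_lin; leg
  end ].
Ltac legs := solve [leg].

(** * Legs in a quasi-bialgebra *)

Section QuasiBialgebra.
Variables (k : fieldType) (A : pzAlgType k) (Q : quasi_hopf A).

Local Notation Delta := (qh_comul Q).
Local Notation eps := (qh_counit Q).

Lemma comul_algmor : algmor Delta.
Proof. by have [[] ] := qh_axioms Q. Qed.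
#[local] Hint Resolve comul_algmor : legs_db.

Lemma counit_scalar : scalar eps.
Proof. by have [[_ []] ] := qh_axioms Q. Qed.

Lemma counit1 : eps 1 = 1.
Proof. by have [[_ [_ []]]] := qh_axioms Q. Qed.

Lemma counitM x y : eps (x * y) = eps x * eps y.
Proof. by have [[_ [_ [_ h]] _ _] _ _ _ _] := qh_axioms Q; exact: h. Qed.

Lemma comul_counitr h : \sw2_(h1, h2 <- Delta h) (eps h2 *: h1) = h.
Proof. by have [[_ _ _ [_ /(_ h)[] ]]] := qh_axioms Q. Qed.

Lemma comul_counitl h : \sw2_(h1, h2 <- Delta h) (eps h1 *: h2) = h.
Proof. by have [[_ _ _ [_ /(_ h)[] ]]] := qh_axioms Q. Qed.

Lemma reassoc_invertible : invertible (qh_reassoc Q).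
Proof. by have [[_ _ ? _] ] := qh_axioms Q. Qed.

Lemma uleg_algmor (B : pzAlgType k) : algmor (uleg Q B).
Proof.
split=> [a x y|]; first by rewrite /uleg counit_scalar scalerDl scalerA.
split=> [|x y]; first by rewrite /uleg counit1 scale1r.
by rewrite /uleg counitM -pzscalerAl mul1r scalerA.
Qed.
#[local] Hint Resolve uleg_algmor : legs_db.

Variable B : pzAlgType k.
Implicit Types p q r s : A -> B.

Local Notation cab := (cab Q).
Local Notation u_ := (uleg Q B).
Definition Phi p q r : B := tmul3 p q r (qh_reassoc Q).
Definition phi p q r : B := tmul3 p q r (inverse (qh_reassoc Q)).

(** The counit axiom for strands: doubling a strand and erasing one half changes nothing.
    Specializing pentagons and hexagons to erased strands rests on this and on [uleg_cab]. *)
Lemma cab_uleg p : linear p -> cab p u_ = p.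
Proof.
move=> lp; apply/funext => h.
rewrite -[in RHS](comul_counitr h) (lin_tens_sum lp); apply: eq_tens_sum => a b.
by rewrite (linear_forZ lp) /uleg -pzscalerAr mulr1.
Qed.

Lemma uleg_cab p : linear p -> cab u_ p = p.
Proof.
move=> lp; apply/funext => h.
rewrite -[in RHS](comul_counitl h) (lin_tens_sum lp); apply: eq_tens_sum => a b.
by rewrite (linear_forZ lp) /uleg -pzscalerAl mul1r.
Qed.

Section Three.
Variables p q r : A -> B.
Hypotheses (mp : algmor p) (mq : algmor q) (mr : algmor r).
Hypotheses (pq : commuting p q) (pr : commuting p r) (qr : commuting q r).

Lemma PhiK : Phi p q r * phi p q r = 1.
Proof.
have m : algmor (tmul3 p q r) by legs.
by rewrite -(algmorM m) (invertibleW reassoc_invertible).1 algmor1.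
Qed.

Lemma phiK : phi p q r * Phi p q r = 1.
Proof.
have m : algmor (tmul3 p q r) by legs.
by rewrite -(algmorM m) (invertibleW reassoc_invertible).2 algmor1.
Qed.

(** Quasi-coassociativity with the inverse reassociator moved across, for any three commuting
    strands. *)
Lemma cab_coassoc h :
  cab p (cab q r) h * Phi p q r = Phi p q r * cab (cab p q) r h.
Proof.
have m : algmor (tmul3 p q r) by legs.
have [[_ _ _ [/(_ h) e _ _ _]]] := qh_axioms Q.
have /(congr1 (tmul3 p q r)) : tassoc (tmap id Delta (Delta h)) * qh_reassoc Q =
    qh_reassoc Q * tmap Delta id (Delta h).
  by rewrite e -mulrA (invertibleW reassoc_invertible).2 mulr1.
rewrite !(algmorM m) tmul_assoc; try legs.
rewrite !tmul_tmap; legs.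
Qed.

Lemma cab_coassoc' h :
  phi p q r * cab p (cab q r) h = cab (cab p q) r h * phi p q r.
Proof.
rewrite -[LHS]mulr1 -PhiK mulrA -(mulrA _ (cab _ _ _)) cab_coassoc.
by rewrite !mulrA phiK mul1r.
Qed.

End Three.

Lemma Phi_uleg_mid p q : algmor p -> algmor q -> commuting p q ->
  Phi p u_ q = 1.
Proof.
move=> mp mq pq.
have [[_ _ _ [_ _ _ /(congr1 (tmul p q)) e]] _ _ _ _] := qh_axioms Q.
move: e; rewrite (algmor1 (tmul_algmor mp mq pq)) => <-.
have l := tmul_linear (algmor_lin mp) (algmor_lin mq).
rewrite (lin_tens_sum l); apply: eq_tens_sum => t c.
rewrite (lin_tens_sum l) tens_sum_mull; apply: eq_tens_sum => a b.
rewrite (linear_forZ l) tmulE /uleg; try legs.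
by rewrite -pzscalerAr -pzscalerAl mulr1.
Qed.

Lemma pentagon p q r s :
  algmor p -> algmor q -> algmor r -> algmor s ->
  commuting p q -> commuting p r -> commuting p s ->
  commuting q r -> commuting q s -> commuting r s ->
  Phi q r s * Phi p (cab q r) s * Phi p q r =
  Phi p q (cab r s) * Phi (cab p q) r s.
Proof.
move=> mp mq mr ms pq pr ps qr qs rs.
have m : algmor (tmul (tmul3 p q r) s) by apply: tmul_algmor; legs.
have [[_ _ _ [_ _ /(congr1 (tmul (tmul3 p q r) s)) e _]] _ _ _ _] := qh_axioms Q.
move: e.
(* Rebracketing becomes associativity of the product of [B], so every [tassoc] disappears. *)
have e3 : tmul3 p q r \o tassoc = tmul p (tmul q r).
  by apply/funext => t; rewrite /= tmul_assoc; legs.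
have e4 : (tmul3 p q r) \o (fun t => tassoc (tmap id Delta t)) = tmul p (cab q r).
  by apply/funext => t; rewrite /= tmul_assoc ?tmul_tmap; legs.
have lA : linear (@tassoc k A A A) by exact: tassoc_linear.
have lT : linear (fun t : tens A A => tassoc (tmap id Delta t)).
  by apply: (linear_comp (@tassoc_linear _ _ _ _)); legs.
have l3 : linear (tmul3 p q r) by apply: algmor_lin; legs.
rewrite !(algmorM m) !tmul_tmap // ?e3 ?e4; try legs.
rewrite tmul_assoc; try legs.
rewrite !tmulE; try legs.
rewrite (algmor1 mp) (algmor1 ms) mul1r mulr1 => ->; congr (_ * _).
  rewrite tmul_assoc; try legs.
  by rewrite tmul_tmap; legs.
congr (tmul _ _ _); apply/funext => t.
by rewrite /= tmul_tmap; legs.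
Qed.

(** With its first two strands erased, the pentagon says that this invertible element is
    idempotent. *)
Lemma Phi_uleg_left q r : algmor q -> algmor r -> commuting q r ->
  Phi u_ q r = 1.
Proof.
move=> mq mr qr; have := @pentagon u_ u_ q r.
rewrite !uleg_cab ?Phi_uleg_mid ?mul1r ?mulr1; try legs.
move=> e.
have {}e : Phi u_ q r * Phi u_ q r = Phi u_ q r by apply: e; legs.
rewrite -[LHS]mulr1 -(@PhiK u_ q r) ?mulrA ?e ?PhiK //; legs.
Qed.

Lemma Phi_uleg_right p q : algmor p -> algmor q -> commuting p q ->
  Phi p q u_ = 1.
Proof.
move=> mp mq pq; have := @pentagon p q u_ u_.
rewrite !cab_uleg ?Phi_uleg_mid ?mul1r ?mulr1; try legs.
move=> e.
have {}e : Phi p q u_ * Phi p q u_ = Phi p q u_ by apply: e; legs.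
rewrite -[LHS]mulr1 -(@PhiK p q u_) ?mulrA ?e ?PhiK //; legs.
Qed.

Lemma phi_of_Phi1 p q r : algmor p -> algmor q -> algmor r ->
  commuting p q -> commuting p r -> commuting q r ->
  Phi p q r = 1 -> phi p q r = 1.
Proof. by move=> *; rewrite -[LHS]mul1r -(_ : Phi p q r = 1) ?PhiK. Qed.

End QuasiBialgebra.

#[local] Hint Resolve comul_algmor uleg_algmor : legs_db.

(** * Multilinear maps and the standard strands *)

Section Multilinear.
Variable k : fieldType.

Lemma tens_sum_linear_param (P U V W : lmodType k) (f : P -> U -> V -> W) t :
  (forall u v, linear (f^~ u ^~ v)) -> linear (fun p => \sw2_(u, v <- t) f p u v).
Proof.
move=> lf a x y; rewrite -tens_sum_linear_fun; apply: eq_tens_sum => u v.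
exact: lf.
Qed.

Definition bilinear2 (U V W : lmodType k) (g : U -> V -> W) : Prop :=
  (forall v, linear (g^~ v)) /\ (forall u, linear (g u)).

Definition trilinear (U V W X : lmodType k) (g : U -> V -> W -> X) : Prop :=
  (forall c, bilinear2 (fun a b => g a b c)) /\ (forall a b, linear (g a b)).

Definition quadrilinear (U V W X Y : lmodType k) (g : U -> V -> W -> X -> Y) : Prop :=
  (forall d, trilinear (fun a b c => g a b c d)) /\ (forall a b c, linear (g a b c)).

Definition lift2 (U V W : lmodType k) (g : U -> V -> W) (t : tens U V) : W :=
  \sw2_(a, b <- t) g a b.

Definition lift3 (U V W X : lmodType k) (g : U -> V -> W -> X) : tens (tens U V) W -> X :=
  lift2 (fun p c => lift2 (fun a b => g a b c) p).

Definition lift4 (U V W X Y : lmodType k) (g : U -> V -> W -> X -> Y) :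
    tens (tens (tens U V) W) X -> Y :=
  lift2 (fun p d => lift3 (fun a b c => g a b c d) p).

Lemma lift2_linear (U V W : lmodType k) (g : U -> V -> W) :
  bilinear2 g -> linear (lift2 g).
Proof. by move=> [gl gr]; apply: tens_sum_linear; split. Qed.

Lemma lift2E (U V W : lmodType k) (g : U -> V -> W) :
  bilinear2 g -> forall a b, lift2 g (a *t b) = g a b.
Proof. by move=> [gl gr] a b; apply: tens_sum_tensor; split. Qed.

Lemma lift3_bilinear (U V W X : lmodType k) (g : U -> V -> W -> X) :
  trilinear g -> bilinear2 (fun p c => lift2 (fun a b => g a b c) p).
Proof.
move=> [gl gr]; split=> [c|p]; first exact: lift2_linear.
by apply: tens_sum_linear_param => a b; exact: gr.
Qed.

Lemma lift3_linear (U V W X : lmodType k) (g : U -> V -> W -> X) :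
  trilinear g -> linear (lift3 g).
Proof. by move=> /lift3_bilinear; exact: lift2_linear. Qed.

Lemma lift3E (U V W X : lmodType k) (g : U -> V -> W -> X) :
  trilinear g -> forall a b c, lift3 g (a *t b *t c) = g a b c.
Proof. by move=> tg a b c; rewrite /lift3 !lift2E //; [case: tg | exact: lift3_bilinear]. Qed.

Lemma lift4_bilinear (U V W X Y : lmodType k) (g : U -> V -> W -> X -> Y) :
  quadrilinear g -> bilinear2 (fun p d => lift3 (fun a b c => g a b c d) p).
Proof.
move=> [gl gr]; split=> [d|p]; first exact: lift3_linear.
apply: (@tens_sum_linear_param X _ _ Y (fun d t c => lift2 (fun a b => g a b c d) t)).
by move=> t c; apply: tens_sum_linear_param => a b; exact: gr.
Qed.

Lemma lift4_linear (U V W X Y : lmodType k) (g : U -> V -> W -> X -> Y) :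
  quadrilinear g -> linear (lift4 g).
Proof. by move=> /lift4_bilinear; exact: lift2_linear. Qed.

Lemma lift4E (U V W X Y : lmodType k) (g : U -> V -> W -> X -> Y) :
  quadrilinear g -> forall a b c d, lift4 g (a *t b *t c *t d) = g a b c d.
Proof.
move=> qg a b c d; rewrite /lift4 lift2E; last exact: lift4_bilinear.
by rewrite lift3E //; case: qg.
Qed.

End Multilinear.

Section Inclusions.
Variables (k : fieldType) (A B : pzAlgType k).

Definition tensl (a : A) : tens A B := a *t (1 : B).
Definition tensr (b : B) : tens A B := (1 : A) *t b.

Lemma tensl_algmor : algmor tensl.
Proof.
split=> [a x y|]; first by rewrite /tensl tensorDl tensorZl.
by split=> [|x y] //; rewrite /tensl tensM mulr1.
Qed.

Lemma tensr_algmor : algmor tensr.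
Proof.
split=> [a x y|]; first by rewrite /tensr tensorDr tensorZr.
by split=> [|x y] //; rewrite /tensr tensM mulr1.
Qed.

Lemma tensl_tensr : commuting tensl tensr.
Proof. by move=> a b; rewrite /tensl /tensr !tensM !mulr1 !mul1r. Qed.

Lemma tensor_tensl_tensr a b : a *t b = tensl a * tensr b.
Proof. by rewrite /tensl /tensr tensM mulr1 mul1r. Qed.

Lemma tmul_tensl_tensr t : tmul tensl tensr t = t.
Proof.
move: t; apply: (tens_lin_ext (g := id)) => // [|a b].
  by apply: tmul_linear; apply: algmor_lin; [exact: tensl_algmor | exact: tensr_algmor].
rewrite tmulE ?tensor_tensl_tensr //; apply: algmor_lin;
  [exact: tensl_algmor | exact: tensr_algmor].
Qed.

End Inclusions.
Arguments tensl {k A B}.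
Arguments tensr {k A B}.
#[local] Hint Resolve tensl_algmor tensr_algmor tensl_tensr : legs_db.

Section Legs3.
Variables (k : fieldType) (A : pzAlgType k).
Local Notation A2 := (tens A A).
Local Notation A3 := (tens A2 A).
Local Notation A4 := (tens A3 A).

Definition leg1 : A -> A3 := tensl \o tensl.
Definition leg2 : A -> A3 := tensl \o tensr.
Definition leg3 : A -> A3 := tensr.

Lemma leg1_algmor : algmor leg1. Proof. by rewrite /leg1; legs. Qed.
Lemma leg2_algmor : algmor leg2. Proof. by rewrite /leg2; legs. Qed.
Lemma leg3_algmor : algmor leg3. Proof. by rewrite /leg3; legs. Qed.

Lemma leg12 : commuting leg1 leg2.
Proof.
move=> a b; have m := algmorM (@tensl_algmor k A2 A).
by rewrite /leg1 /leg2 /= -[LHS]m -[RHS]m tensl_tensr.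
Qed.

Lemma leg13 : commuting leg1 leg3.
Proof. by rewrite /leg1 /leg3; legs. Qed.

Lemma leg23 : commuting leg2 leg3.
Proof. by rewrite /leg2 /leg3; legs. Qed.

End Legs3.
Arguments leg1 {k A}.
Arguments leg2 {k A}.
Arguments leg3 {k A}.
#[local] Hint Resolve leg1_algmor leg2_algmor leg3_algmor leg12 leg13 leg23 : legs_db.

Lemma tmul_leg12 (k : fieldType) (A : pzAlgType k) (t : tens A A) :
  tmul (@leg1 k A) leg2 t = tensl t.
Proof.
have m := @tensl_algmor k (tens A A) A.
rewrite -[in RHS](tmul_tensl_tensr t) [RHS](lin_tens_sum (algmor_lin m)).
by apply: eq_tens_sum => a b; rewrite (algmorM m).
Qed.

(** For the standard inclusions the leg notation gives back the tensor; identities between strands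
    return to the tensor cube this way. *)
Lemma tmul_legs (k : fieldType) (A : pzAlgType k) (t : tens (tens A A) A) :
  tmul3 leg1 leg2 leg3 t = t.
Proof.
rewrite -[RHS]tmul_tensl_tensr; congr (tmul _ _ _); apply/funext => s.
exact: tmul_leg12.
Qed.

(** * Invariant pairings and the antipode *)

Section Contraction.
Variables (k : fieldType) (A : pzAlgType k) (Q : quasi_hopf A).
Variables (B : pzAlgType k) (V : lmodType k).
Implicit Types (G : B -> V) (p q r s : A -> B).
Local Notation Delta := (qh_comul Q).
Local Notation eps := (qh_counit Q).
Local Notation u_ := (uleg Q B).
Local Notation cab := (cab Q).

(** Left invariance is that of a pairing of the strands [p] and [q], right invariance that of a
    copairing; [t] stands for the rest of the diagram. *)
Definition linv G p q := forall h t, G (cab p q h * t) = eps h *: G t.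
Definition rinv G p q := forall h t, G (t * cab p q h) = eps h *: G t.

Lemma lin_tmul_congr (U1 U2 : lmodType k) G (y t : B) (f f' : U1 -> B) (g g' : U2 -> B) x :
  linear G ->
  (forall a b, G (y * (f a * g b) * t) = G (y * (f' a * g' b) * t)) ->
  G (y * tmul f g x * t) = G (y * tmul f' g' x * t).
Proof.
move=> lG e; rewrite !tens_sum_mulr !tens_sum_mull !(lin_tens_sum lG).
by apply: eq_tens_sum.
Qed.

Lemma lin_tmul3_congr (U1 U2 U3 : lmodType k) G (y t : B) (f f' : U1 -> B)
    (g g' : U2 -> B) (h h' : U3 -> B) x : linear G ->
  (forall a b c, G (y * (f a * g b * h c) * t) = G (y * (f' a * g' b * h' c) * t)) ->
  G (y * tmul3 f g h x * t) = G (y * tmul3 f' g' h' x * t).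
Proof.
move=> lG e; rewrite !(tens_sum_mulr, tens_sum_mull) !(lin_tens_sum lG).
apply: eq_tens_sum => u c; rewrite !(tens_sum_mulr, tens_sum_mull) !(lin_tens_sum lG).
by apply: eq_tens_sum.
Qed.

Section Linv.
Variables (G : B -> V) (p q : A -> B).
Hypotheses (lG : linear G) (Gi : linv G p q).

(** At the outer left end, a doubled strand may be replaced by the erased one. The lemmas that
    follow bring the doubled strand to that end through the strands commuting with it. *)
Lemma linvu h t : G (cab p q h * t) = G (u_ h * t).
Proof. by rewrite Gi /uleg -pzscalerAl mul1r (linear_forZ lG). Qed.

Lemma linv_tmul1 (U : lmodType k) (r : U -> B) x t :
  G (tmul (cab p q) r x * t) = G (tmul u_ r x * t).
Proof.
rewrite -[tmul (cab p q) r x]mul1r -[tmul u_ r x]mul1r.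
by apply: lin_tmul_congr => // a b; rewrite !mul1r -!mulrA linvu.
Qed.

Lemma linv_tmul2 (U : lmodType k) (r : U -> B) x t :
  commuting p r -> commuting q r ->
  G (tmul r (cab p q) x * t) = G (tmul r u_ x * t).
Proof.
move=> pr qr.
rewrite -[tmul r (cab p q) x]mul1r -[tmul r u_ x]mul1r.
apply: lin_tmul_congr => // a b; rewrite !mul1r.
rewrite -[r a * cab p q b](_ : cab p q b * r a = _); last by apply: commuting_cabl.
by rewrite -(@commuting_ulegl _ _ Q B _ r) -!mulrA linvu.
Qed.

Lemma linv_tmul31 (U W : lmodType k) (r : U -> B) (s : W -> B) x t :
  G (tmul3 (cab p q) r s x * t) = G (tmul3 u_ r s x * t).
Proof.
rewrite -[tmul3 (cab p q) r s x]mul1r -[tmul3 u_ r s x]mul1r.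
by apply: lin_tmul3_congr => // a b c; rewrite !mul1r -!mulrA linvu.
Qed.

Lemma linv_tmul32 (U W : lmodType k) (r : U -> B) (s : W -> B) x t :
  commuting p r -> commuting q r ->
  G (tmul3 r (cab p q) s x * t) = G (tmul3 r u_ s x * t).
Proof.
move=> pr qr.
rewrite -[tmul3 r (cab p q) s x]mul1r -[tmul3 r u_ s x]mul1r.
apply: lin_tmul3_congr => // a b c; rewrite !mul1r.
rewrite -[r a * cab p q b](_ : cab p q b * r a = _); last by apply: commuting_cabl.
by rewrite -(@commuting_ulegl _ _ Q B _ r) -!mulrA linvu.
Qed.

Lemma linv_tmul33 (U W : lmodType k) (r : U -> B) (s : W -> B) x t :
  commuting p r -> commuting q r -> commuting p s -> commuting q s ->
  G (tmul3 r s (cab p q) x * t) = G (tmul3 r s u_ x * t).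
Proof.
move=> pr qr ps qs.
apply: (linv_tmul2 (r := tmul r s)); exact: commuting_tmulr.
Qed.

End Linv.

Section Rinv.
Variables (G : B -> V) (p q : A -> B).
Hypotheses (lG : linear G) (Gi : rinv G p q).

Lemma rinvu h t : G (t * cab p q h) = G (t * u_ h).
Proof. by rewrite Gi /uleg -pzscalerAr mulr1 (linear_forZ lG). Qed.

Lemma rinv_tmul2 (U : lmodType k) (r : U -> B) x t :
  G (t * tmul r (cab p q) x) = G (t * tmul r u_ x).
Proof.
rewrite -[t * tmul r (cab p q) x]mulr1 -[t * tmul r u_ x]mulr1.
by apply: lin_tmul_congr => // a b; rewrite !mulr1 !mulrA rinvu.
Qed.

Lemma rinv_tmul1 (U : lmodType k) (r : U -> B) x t :
  commuting p r -> commuting q r ->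
  G (t * tmul (cab p q) r x) = G (t * tmul u_ r x).
Proof.
move=> pr qr.
rewrite -[t * tmul (cab p q) r x]mulr1 -[t * tmul u_ r x]mulr1.
apply: lin_tmul_congr => // a b; rewrite !mulr1.
rewrite [cab p q a * r b](_ : _ = r b * cab p q a); last by apply: commuting_cabl.
by rewrite (@commuting_ulegl _ _ Q B _ r) !mulrA rinvu.
Qed.

Lemma rinv_tmul33 (U W : lmodType k) (r : U -> B) (s : W -> B) x t :
  G (t * tmul3 r s (cab p q) x) = G (t * tmul3 r s u_ x).
Proof. exact: rinv_tmul2. Qed.

Lemma rinv_tmul32 (U W : lmodType k) (r : U -> B) (s : W -> B) x t :
  commuting p s -> commuting q s ->
  G (t * tmul3 r (cab p q) s x) = G (t * tmul3 r u_ s x).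
Proof.
move=> ps qs.
rewrite -[t * tmul3 r (cab p q) s x]mulr1 -[t * tmul3 r u_ s x]mulr1.
apply: lin_tmul3_congr => // a b c; rewrite !mulr1 -!(mulrA (r a)).
rewrite [cab p q b * s c](_ : _ = s c * cab p q b); last by apply: commuting_cabl.
by rewrite (@commuting_ulegl _ _ Q B _ s) !mulrA rinvu.
Qed.

Lemma rinv_tmul31 (U W : lmodType k) (r : U -> B) (s : W -> B) x t :
  commuting p r -> commuting q r -> commuting p s -> commuting q s ->
  G (t * tmul3 (cab p q) r s x) = G (t * tmul3 u_ r s x).
Proof.
move=> pr qr ps qs.
rewrite -[t * tmul3 (cab p q) r s x]mulr1 -[t * tmul3 u_ r s x]mulr1.
apply: lin_tmul3_congr => // a b c; rewrite !mulr1 -!(mulrA _ (r b)).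
rewrite [cab p q a * _](_ : _ = r b * s c * cab p q a); last first.
  by rewrite mulrA (commuting_cabl Q pr qr) -mulrA (commuting_cabl Q ps qs) mulrA.
rewrite [uleg Q B a * _](_ : _ = r b * s c * uleg Q B a); last first.
  by rewrite /uleg -pzscalerAl -pzscalerAr mul1r mulr1.
by rewrite !mulrA rinvu.
Qed.

End Rinv.

Section Snake.
Variables (G : B -> V) (p q r s : A -> B).
Hypotheses (mp : algmor p) (mq : algmor q) (mr : algmor r) (ms : algmor s).
Hypotheses (pq : commuting p q) (pr : commuting p r) (ps : commuting p s).
Hypotheses (qr : commuting q r) (qs : commuting q s) (rs : commuting r s).
Hypothesis lG : linear G.

(** Invariance erases every doubled strand of the pentagon, which trivializes three of its five
    factors and leaves the two compared here. The copairing sits between the two pairings, as in a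
    zigzag. *)
Lemma snake_pairing : linv G p q -> rinv G q r -> linv G r s ->
  G (Phi Q q r s) = G (phi Q p q r).
Proof.
move=> Gpq Gqr Grs.
transitivity (G (Phi Q q r s * Phi Q p (cab q r) s)).
  rewrite (rinv_tmul32 lG Gqr); try legs.
  by rewrite [tmul3 _ _ _ _]Phi_uleg_mid ?mulr1 //; legs.
rewrite -[Phi Q q r s * _]mulr1 -(@PhiK _ _ Q B p q r) // mulrA pentagon //.
rewrite -!mulrA (linv_tmul33 lG Grs); try legs.
rewrite [tmul3 _ _ _ _]Phi_uleg_right // mul1r (linv_tmul31 lG Gpq).
by rewrite [tmul3 _ _ _ _]Phi_uleg_left // mul1r.
Qed.

(** Mirror image of [snake_pairing]: one pairing between two copairings, and the pentagon solved for
    its other end. *)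
Lemma snake_copairing : rinv G p q -> linv G q r -> rinv G r s ->
  G (Phi Q p q r) = G (phi Q q r s).
Proof.
move=> Gpq Gqr Grs.
transitivity (G (Phi Q p (cab q r) s * Phi Q p q r)).
  rewrite (linv_tmul32 lG Gqr); try legs.
  by rewrite [tmul3 _ _ _ _]Phi_uleg_mid ?mul1r //; legs.
rewrite -[Phi Q p (cab q r) s * _]mul1r -(@phiK _ _ Q B q r s) // -mulrA.
rewrite [Phi Q q r s * _]mulrA pentagon // !mulrA.
rewrite (rinv_tmul31 lG Gpq); try legs.
rewrite [tmul3 _ _ _ _]Phi_uleg_left // mulr1 (rinv_tmul33 lG Grs).
by rewrite [tmul3 _ _ _ _]Phi_uleg_right // mulr1.
Qed.

End Snake.

End Contraction.

Section Expand.
Variable k : fieldType.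

Lemma lin_expand2 (U V W : lmodType k) (F : tens U V -> W) t :
  linear F -> F t = \sw2_(a, b <- t) F (a *t b).
Proof. by move=> lF; rewrite -(lin_tens_sum lF) tens_sum_id. Qed.

Lemma lin_expand3 (U V W X : lmodType k) (F : tens (tens U V) W -> X) t :
  linear F -> F t = \sw3_(a, b, c <- t) F (a *t b *t c).
Proof.
move=> lF; rewrite (lin_expand2 t lF); apply: eq_tens_sum => p c.
apply: (@lin_expand2 _ _ _ (fun p => F (p *t c)) p).
by move=> a x y; rewrite tensorDl tensorZl lF.
Qed.

Lemma lin_expand4 (U V W X Y : lmodType k)
    (F : tens (tens (tens U V) W) X -> Y) t : linear F ->
  F t = \sw2_(q, d <- t) \sw3_(a, b, c <- q) F (a *t b *t c *t d).
Proof.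
move=> lF; rewrite (lin_expand2 t lF); apply: eq_tens_sum => p c.
apply: (@lin_expand3 _ _ _ _ (fun p => F (p *t c)) p).
by move=> a x y; rewrite tensorDl tensorZl lF.
Qed.

Lemma tens3_lin_ext (U V W X : lmodType k) (F G : tens (tens U V) W -> X) :
  linear F -> linear G ->
  (forall a b c, F (a *t b *t c) = G (a *t b *t c)) -> forall t, F t = G t.
Proof.
move=> lF lG e t; rewrite (lin_expand3 t lF) (lin_expand3 t lG).
by do 2 apply: eq_tens_sum => ? ?.
Qed.

Lemma scale_linear (U V : lmodType k) (F : U -> V) (a : k) :
  linear F -> linear (fun x => a *: F x).
Proof. by move=> lF b x y; rewrite lF scalerDr !scalerA mulrC. Qed.

End Expand.

Section Invariant3.
Variables (k : fieldType) (A : pzAlgType k) (Q : quasi_hopf A) (V : lmodType k).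
Local Notation Delta := (qh_comul Q).
Local Notation eps := (qh_counit Q).
Local Notation A3 := (tens (tens A A) A).
Variable g : A -> A -> A -> V.
Hypothesis tg : trilinear g.
Let lG := lift3_linear tg.

Lemma lift3M t a b c :
  lift3 g (t * (a *t b *t c)) = \sw3_(x, y, z <- t) g (x * a) (y * b) (z * c).
Proof.
rewrite (lin_expand3 (F := fun t => lift3 g (t * (a *t b *t c)))); last first.
  exact: (linear_comp lG (mulr_linearr _)).
by do 2 apply: eq_tens_sum => ? ?; rewrite !tensM lift3E.
Qed.

Lemma lift3Ml t a b c :
  lift3 g (a *t b *t c * t) = \sw3_(x, y, z <- t) g (a * x) (b * y) (c * z).
Proof.
rewrite (lin_expand3 (F := fun t => lift3 g (a *t b *t c * t))); last first.
  exact: (linear_comp lG (mulr_linearl _)).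
by do 2 apply: eq_tens_sum => ? ?; rewrite !tensM lift3E.
Qed.

Lemma linv12 :
  (forall h a b c, \sw2_(x, y <- Delta h) g (x * a) (y * b) c = eps h *: g a b c) ->
  linv Q (lift3 g) leg1 leg2.
Proof.
move=> e h; apply: tens3_lin_ext (linear_comp lG (mulr_linearl _)) (scale_linear _ lG) _.
move=> a b c; rewrite lift3E // -e /cab /tmul /= tens_sum_mull (lin_tens_sum lG).
by apply: eq_tens_sum => x y; rewrite !tensM !mulr1 !mul1r lift3E.
Qed.

Lemma linv23 :
  (forall h a b c, \sw2_(x, y <- Delta h) g a (x * b) (y * c) = eps h *: g a b c) ->
  linv Q (lift3 g) leg2 leg3.
Proof.
move=> e h; apply: tens3_lin_ext (linear_comp lG (mulr_linearl _)) (scale_linear _ lG) _.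
move=> a b c; rewrite lift3E // -e /cab /tmul /= tens_sum_mull (lin_tens_sum lG).
by apply: eq_tens_sum => x y; rewrite !tensM !mulr1 !mul1r lift3E.
Qed.

Lemma rinv12 :
  (forall h a b c, \sw2_(x, y <- Delta h) g (a * x) (b * y) c = eps h *: g a b c) ->
  rinv Q (lift3 g) leg1 leg2.
Proof.
move=> e h; apply: tens3_lin_ext (linear_comp lG (mulr_linearr _)) (scale_linear _ lG) _.
move=> a b c; rewrite lift3E // -e /cab /tmul /= tens_sum_mulr (lin_tens_sum lG).
by apply: eq_tens_sum => x y; rewrite !tensM !mulr1 ?mul1r lift3E.
Qed.

Lemma rinv23 :
  (forall h a b c, \sw2_(x, y <- Delta h) g a (b * x) (c * y) = eps h *: g a b c) ->
  rinv Q (lift3 g) leg2 leg3.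
Proof.
move=> e h; apply: tens3_lin_ext (linear_comp lG (mulr_linearr _)) (scale_linear _ lG) _.
move=> a b c; rewrite lift3E // -e /cab /tmul /= tens_sum_mulr (lin_tens_sum lG).
by apply: eq_tens_sum => x y; rewrite !tensM !mulr1 ?mul1r lift3E.
Qed.

End Invariant3.

Section Invariant4.
Variables (k : fieldType) (A : pzAlgType k) (Q : quasi_hopf A) (V : lmodType k).
Local Notation Delta := (qh_comul Q).
Local Notation eps := (qh_counit Q).
Local Notation A3 := (tens (tens A A) A).
Definition tens4 : pzAlgType k := tens A3 A.
Local Notation A4 := tens4.
Variable g : A -> A -> A -> A -> V.
Hypothesis qg : quadrilinear g.
Let G : A4 -> V := lift4 g.
Let lG : linear G. Proof. exact: lift4_linear. Qed.

Let p : A -> A4 := tensl \o leg1.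
Let q : A -> A4 := tensl \o leg2.
Let r : A -> A4 := tensl \o leg3.
Let s : A -> A4 := tensr.

Let inl_commuting (f f' : A -> A3) : commuting f f' -> commuting (tensl \o f) ((tensl : A3 -> A4) \o f').
Proof.
move=> ff a b; have m := algmorM (@tensl_algmor k A3 A).
by rewrite /= -[LHS]m -[RHS]m ff.
Qed.

Let mp : algmor p. Proof. by apply: algmor_comp; [exact: tensl_algmor | legs]. Qed.
Let mq : algmor q. Proof. by apply: algmor_comp; [exact: tensl_algmor | legs]. Qed.
Let mr : algmor r. Proof. by apply: algmor_comp; [exact: tensl_algmor | legs]. Qed.
Let ms : algmor s. Proof. exact: tensr_algmor. Qed.
Let pq : commuting p q. Proof. by apply: inl_commuting; legs. Qed.
Let pr : commuting p r. Proof. by apply: inl_commuting; legs. Qed.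
Let qr : commuting q r. Proof. by apply: inl_commuting; legs. Qed.
Let ps : commuting p s. Proof. by move=> a b; exact: tensl_tensr. Qed.
Let qs : commuting q s. Proof. by move=> a b; exact: tensl_tensr. Qed.
Let rs : commuting r s. Proof. by move=> a b; exact: tensl_tensr. Qed.

Let eq4 (F F' : A4 -> V) : linear F -> linear F' ->
  (forall a b c d, F (a *t b *t c *t d) = F' (a *t b *t c *t d)) ->
  forall t, F t = F' t.
Proof.
move=> lF lF' e t; rewrite (lin_expand4 t lF) (lin_expand4 t lF').
by do 3 apply: eq_tens_sum => ? ?.
Qed.

Let lift4_left t : G (tmul3 p q r t) = \sw3_(x, y, z <- t) g x y z 1.
Proof.
rewrite (lin_expand3 t (F := fun t => G (tmul3 p q r t))); last first.
  by apply: (linear_comp lG); legs.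
do 2 apply: eq_tens_sum => ? ?.
by rewrite !tmulE; try legs; rewrite !tensM !mulr1 !mul1r [G _]lift4E.
Qed.

Let lift4_right t : G (tmul3 q r s t) = \sw3_(x, y, z <- t) g 1 x y z.
Proof.
rewrite (lin_expand3 t (F := fun t => G (tmul3 q r s t))); last first.
  by apply: (linear_comp lG); legs.
do 2 apply: eq_tens_sum => ? ?.
by rewrite !tmulE; try legs; rewrite !tensM !mulr1 !mul1r [G _]lift4E.
Qed.

Lemma snake_pairing4 :
  (forall h a b c d,
     \sw2_(x, y <- Delta h) g (x * a) (y * b) c d = eps h *: g a b c d) ->
  (forall h a b c d,
     \sw2_(x, y <- Delta h) g a (b * x) (c * y) d = eps h *: g a b c d) ->
  (forall h a b c d,
     \sw2_(x, y <- Delta h) g a b (x * c) (y * d) = eps h *: g a b c d) ->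
  \sw3_(x, y, z <- qh_reassoc Q) g 1 x y z =
  \sw3_(x, y, z <- inverse (qh_reassoc Q)) g x y z 1.
Proof.
move=> e12 e23 e34; rewrite -lift4_left -lift4_right.
apply: snake_pairing => // h.
- apply: eq4 (linear_comp lG (mulr_linearl _)) (scale_linear _ lG) _ => a b c d.
  rewrite [G _]lift4E // -e12 /cab /tmul /= tens_sum_mull (lin_tens_sum lG).
  by apply: eq_tens_sum => x y; rewrite !tensM !mulr1 !mul1r [G _]lift4E.
- apply: eq4 (linear_comp lG (mulr_linearr _)) (scale_linear _ lG) _ => a b c d.
  rewrite [G _]lift4E // -e23 /cab /tmul /= tens_sum_mulr (lin_tens_sum lG).
  by apply: eq_tens_sum => x y; rewrite !tensM !mulr1 ?mul1r [G _]lift4E.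
- apply: eq4 (linear_comp lG (mulr_linearl _)) (scale_linear _ lG) _ => a b c d.
  rewrite [G _]lift4E // -e34 /cab /tmul /= tens_sum_mull (lin_tens_sum lG).
  by apply: eq_tens_sum => x y; rewrite !tensM !mulr1 !mul1r [G _]lift4E.
Qed.

Lemma snake_copairing4 :
  (forall h a b c d,
     \sw2_(x, y <- Delta h) g (a * x) (b * y) c d = eps h *: g a b c d) ->
  (forall h a b c d,
     \sw2_(x, y <- Delta h) g a (x * b) (y * c) d = eps h *: g a b c d) ->
  (forall h a b c d,
     \sw2_(x, y <- Delta h) g a b (c * x) (d * y) = eps h *: g a b c d) ->
  \sw3_(x, y, z <- qh_reassoc Q) g x y z 1 =
  \sw3_(x, y, z <- inverse (qh_reassoc Q)) g 1 x y z.
Proof.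
move=> e12 e23 e34; rewrite -lift4_left -lift4_right.
apply: (snake_copairing (p := p) (s := s)) => // h.
- apply: eq4 (linear_comp lG (mulr_linearr _)) (scale_linear _ lG) _ => a b c d.
  rewrite [G _]lift4E // -e12 /cab /tmul /= tens_sum_mulr (lin_tens_sum lG).
  by apply: eq_tens_sum => x y; rewrite !tensM !mulr1 ?mul1r [G _]lift4E.
- apply: eq4 (linear_comp lG (mulr_linearl _)) (scale_linear _ lG) _ => a b c d.
  rewrite [G _]lift4E // -e23 /cab /tmul /= tens_sum_mull (lin_tens_sum lG).
  by apply: eq_tens_sum => x y; rewrite !tensM !mulr1 !mul1r [G _]lift4E.
- apply: eq4 (linear_comp lG (mulr_linearr _)) (scale_linear _ lG) _ => a b c d.
  rewrite [G _]lift4E // -e34 /cab /tmul /= tens_sum_mulr (lin_tens_sum lG).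
  by apply: eq_tens_sum => x y; rewrite !tensM !mulr1 ?mul1r [G _]lift4E.
Qed.

End Invariant4.

(** * Factorization of invariant pairings and copairings *)

Section Antipode.
Variables (k : fieldType) (A : pzAlgType k) (Q : quasi_hopf A).

Local Notation Delta := (qh_comul Q).
Local Notation eps := (qh_counit Q).
Local Notation S := (qh_antipode Q).
Local Notation alpha := (qh_alpha Q).
Local Notation beta := (qh_beta Q).
Local Notation Phi0 := (qh_reassoc Q).
Local Notation phi0 := (inverse Phi0).

Lemma antipode_linear : linear S.
Proof. by have [_ []] := qh_axioms Q. Qed.

Lemma antipode1 : S 1 = 1.
Proof. by have [_ []] := qh_axioms Q. Qed.

Lemma antipodeM x y : S (x * y) = S y * S x.
Proof. by have [_ [_ _ SM] _ _ _] := qh_axioms Q; exact: SM. Qed.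

Lemma antipode_alpha h : \sw2_(h1, h2 <- Delta h) (S h1 * alpha * h2) = eps h *: alpha.
Proof. by have [_ _ /(_ h)[]] := qh_axioms Q. Qed.

Lemma antipode_beta h : \sw2_(h1, h2 <- Delta h) (h1 * beta * S h2) = eps h *: beta.
Proof. by have [_ _ /(_ h)[]] := qh_axioms Q. Qed.

Lemma antipode_Phi : \sw3_(X1, X2, X3 <- Phi0) (X1 * beta * S X2 * alpha * X3) = 1.
Proof. by have [] := qh_axioms Q. Qed.

Lemma antipode_phi : \sw3_(x1, x2, x3 <- phi0) (S x1 * alpha * x2 * beta * S x3) = 1.
Proof. by have [] := qh_axioms Q. Qed.

Lemma antipode_alpha_in h a c :
  \sw2_(x, y <- Delta h) (S (x * a) * alpha * (y * c)) = eps h *: (S a * alpha * c).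
Proof.
rewrite -(mulrA (S a)) pzscalerAr pzscalerAl -antipode_alpha tens_sum_mull tens_sum_mulr.
by apply: eq_tens_sum => x y; rewrite antipodeM !mulrA.
Qed.

Lemma antipode_beta_in h a c :
  \sw2_(x, y <- Delta h) (a * x * beta * S (c * y)) = eps h *: (a * beta * S c).
Proof.
rewrite -(mulrA a) pzscalerAr pzscalerAl -antipode_beta tens_sum_mull tens_sum_mulr.
by apply: eq_tens_sum => x y; rewrite antipodeM !mulrA.
Qed.

Let lS := antipode_linear.

Section Pairing.
Variables (V : lmodType k) (b : A -> A -> V).
Hypotheses (bl : forall c, linear (b^~ c)) (br : forall a, linear (b a)).

Local Ltac multilin :=
  repeat split; intros; move=> ? ? ? /=;
  rewrite ?(mulrDl, mulrDr, lS, bl, br, =^~ pzscalerAl, =^~ pzscalerAr) //.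

Section Left.
(* The invariant pairings are those of the form b(a, c) = F(S(a) alpha c). *)
Hypothesis inv : forall h a c,
  \sw2_(x, y <- Delta h) b (x * a) (y * c) = eps h *: b a c.

(** The pairing [b], the copairing beta and the pairing alpha are strung along four strands, and
    [snake_pairing4] straightens them: its side with the reassociator collapses by
    [antipode_Phi]. *)
Lemma pairing_factor a c :
  \sw3_(x1, x2, x3 <- phi0) b (x1 * a) (x2 * beta * S x3 * alpha * c) = b a c.
Proof.
pose g x y z t := b (x * a) (y * beta * S z * alpha * t * c).
have qg : quadrilinear g by rewrite /g; multilin.
have := snake_pairing4 (Q := Q) qg; rewrite /g.
under [X in _ -> _ -> _ -> _ = X]eq_tens_sum => x y.
  under eq_tens_sum do rewrite mulr1.
  over.
move=> <- //.
- transitivity (b (1 * a) ((\sw3_(X1, X2, X3 <- Phi0) (X1 * beta * S X2 * alpha * X3)) * c)).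
    rewrite tens_sum_mull (lin_tens_sum (br _)); apply: eq_tens_sum => x y.
    by rewrite tens_sum_mull (lin_tens_sum (br _)).
  by rewrite antipode_Phi !mul1r.
- move=> h x y z t; rewrite -inv; apply: eq_tens_sum => u v.
  by rewrite !mulrA.
- move=> h x y z t.
  have l : linear (fun s : A => b (x * a) (s * alpha * t * c)) by multilin.
  by rewrite -(linear_forZ l) -antipode_beta_in (lin_tens_sum l).
- move=> h x y z t.
  have l : linear (fun s : A => b (x * a) (y * beta * s * c)) by multilin.
  transitivity (eps h *: b (x * a) (y * beta * (S z * alpha * t) * c)).
    rewrite -(linear_forZ l) -antipode_alpha_in (lin_tens_sum l).
    by apply: eq_tens_sum => u v; rewrite !mulrA.
  by rewrite !mulrA.
Qed.

(** Slides [a] around the copairing. Right multiplication on strand 1 is a threefold coproduct whose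
    strands 2 and 3 are absorbed by beta; quasi-coassociativity moves it to the left, where [b]
    absorbs strands 1 and 2 and strand 3 is left. *)
Lemma pairing_transpose a y :
  \sw3_(x1, x2, x3 <- phi0) b (x1 * a) (x2 * beta * S x3 * y) =
  \sw3_(x1, x2, x3 <- phi0) b x1 (x2 * beta * S x3 * S a * y).
Proof.
pose g x1 x2 x3 := b x1 (x2 * beta * S x3 * y).
have tg : trilinear g by rewrite /g; multilin.
have lG := lift3_linear tg.
transitivity (lift3 g (phi0 * leg1 a)).
  rewrite lift3M //; do 2 apply: eq_tens_sum => ? ?; by rewrite !mulr1.
transitivity (lift3 g (leg3 a * phi0)); last first.
  rewrite lift3Ml //; do 2 apply: eq_tens_sum => ? ?.
  by rewrite /g !mul1r antipodeM !mulrA.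
have e := @cab_coassoc' _ _ Q _ _ _ _ (@leg1_algmor k A) (@leg2_algmor k A)
  (@leg3_algmor k A) (@leg12 k A) (@leg13 k A) (@leg23 k A) a.
have {}e : phi0 * cab Q leg1 (cab Q leg2 leg3) a = cab Q (cab Q leg1 leg2) leg3 a * phi0.
  by move: e; rewrite /phi tmul_legs.
transitivity (lift3 g (phi0 * cab Q leg1 (cab Q leg2 leg3) a)).
  rewrite [in RHS]/cab (rinv_tmul2 lG (p := leg2) (q := leg3)).
    by rewrite [tmul _ _ _](_ : _ = cab Q leg1 (uleg Q _) a) // cab_uleg //; legs.
  apply: rinv23 => // h x1 x2 x3; rewrite /g.
  have l : linear (fun s : A => b x1 (s * y)) by multilin.
  by rewrite -(linear_forZ l) -antipode_beta_in (lin_tens_sum l).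
rewrite e [in LHS]/cab (linv_tmul1 lG (p := leg1) (q := leg2)).
  by rewrite [tmul _ _ _](_ : _ = cab Q (uleg Q _) leg3 a) // uleg_cab //; legs.
apply: linv12 => // h x1 x2 x3; rewrite /g -inv.
by apply: eq_tens_sum => u v; rewrite !mulrA.
Qed.

End Left.

Section Right.
Hypothesis inv : forall h a c,
  \sw2_(x, y <- Delta h) b (a * x) (c * y) = eps h *: b a c.

(** Mirror image of [pairing_factor], with the copairings beta and [b] on either side of the pairing
    alpha. *)
Lemma copairing_factor a c :
  \sw3_(x1, x2, x3 <- phi0) b (a * beta * S x1 * alpha * x2) (c * x3) = b a c.
Proof.
pose g x y z t := b (a * x * beta * S y * alpha * z) (c * t).
have qg : quadrilinear g by rewrite /g; multilin.
have := snake_copairing4 (Q := Q) qg; rewrite /g.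
under [X in _ -> _ -> _ -> _ = X]eq_tens_sum => x y.
  under eq_tens_sum do rewrite mulr1.
  over.
move=> <- //.
- transitivity (b (a * (\sw3_(X1, X2, X3 <- Phi0) (X1 * beta * S X2 * alpha * X3))) (c * 1)).
    rewrite tens_sum_mulr (lin_tens_sum (bl _)); apply: eq_tens_sum => x y.
    rewrite tens_sum_mulr (lin_tens_sum (bl _)); apply: eq_tens_sum => u v.
    by rewrite !mulrA.
  by rewrite antipode_Phi !mulr1.
- move=> h x y z t.
  have l : linear (fun s : A => b (a * s * alpha * z) (c * t)) by multilin.
  transitivity (eps h *: b (a * (x * beta * S y) * alpha * z) (c * t)).
    rewrite -(linear_forZ l) -antipode_beta_in (lin_tens_sum l).
    by apply: eq_tens_sum => u v; rewrite !mulrA.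
  by rewrite !mulrA.
- move=> h x y z t.
  have l : linear (fun s : A => b (a * x * beta * s) (c * t)) by multilin.
  transitivity (eps h *: b (a * x * beta * (S y * alpha * z)) (c * t)).
    rewrite -(linear_forZ l) -antipode_alpha_in (lin_tens_sum l).
    by apply: eq_tens_sum => u v; rewrite !mulrA.
  by rewrite !mulrA.
- move=> h x y z t; rewrite -inv; apply: eq_tens_sum => u v.
  by rewrite !mulrA.
Qed.

Lemma copairing_transpose h y :
  \sw3_(x1, x2, x3 <- phi0) b (y * S x1 * alpha * x2) (h * x3) =
  \sw3_(x1, x2, x3 <- phi0) b (y * S h * S x1 * alpha * x2) x3.
Proof.
pose g x1 x2 x3 := b (y * S x1 * alpha * x2) x3.
have tg : trilinear g by rewrite /g; multilin.
have lG := lift3_linear tg.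
transitivity (lift3 g (leg3 h * phi0)).
  rewrite lift3Ml //; do 2 apply: eq_tens_sum => ? ?; by rewrite !mul1r.
transitivity (lift3 g (phi0 * leg1 h)); last first.
  rewrite lift3M //; do 2 apply: eq_tens_sum => ? ?.
  by rewrite /g !mulr1 antipodeM !mulrA.
have e := @cab_coassoc' _ _ Q _ _ _ _ (@leg1_algmor k A) (@leg2_algmor k A)
  (@leg3_algmor k A) (@leg12 k A) (@leg13 k A) (@leg23 k A) h.
have {}e : phi0 * cab Q leg1 (cab Q leg2 leg3) h = cab Q (cab Q leg1 leg2) leg3 h * phi0.
  by move: e; rewrite /phi tmul_legs.
transitivity (lift3 g (phi0 * cab Q leg1 (cab Q leg2 leg3) h)); last first.
  rewrite [in LHS]/cab (rinv_tmul2 lG (p := leg2) (q := leg3)).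
    by rewrite [tmul _ _ _](_ : _ = cab Q leg1 (uleg Q _) h) // cab_uleg //; legs.
  by apply: rinv23 => // h' x1 x2 x3; rewrite /g -inv; apply: eq_tens_sum => u v;
    rewrite !mulrA.
rewrite e [in RHS]/cab (linv_tmul1 lG (p := leg1) (q := leg2)).
  by rewrite [tmul _ _ _](_ : _ = cab Q (uleg Q _) leg3 h) // uleg_cab //; legs.
apply: linv12 => // h' x1 x2 x3; rewrite /g.
have l : linear (fun s : A => b (y * s) x3) by multilin.
transitivity (eps h' *: b (y * (S x1 * alpha * x2)) x3).
  rewrite -(linear_forZ l) -antipode_alpha_in (lin_tens_sum l).
  by apply: eq_tens_sum => u v; rewrite !mulrA.
by rewrite !mulrA.
Qed.

End Right.
End Pairing.
End Antipode.

(** * Hexagons and the full twist *)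

Lemma mulK1 (B : pzRingType) (x y z : B) : x * y = 1 -> z * x * y = z.
Proof. by move=> xy; rewrite -mulrA xy mulr1. Qed.

Section Hexagons.
Variables (k : fieldType) (A B : pzAlgType k).
Variables (p q r : A -> B).
Hypotheses (mp : algmor p) (mq : algmor q) (mr : algmor r).
Hypotheses (pq : commuting p q) (pr : commuting p r) (qr : commuting q r).
Variables (F f : tens (tens A A) A) (R : tens A A).

Let qpK x a b : x * q a * p b = x * p b * q a.
Proof. by rewrite -!mulrA pq. Qed.
Let rpK x a b : x * r a * p b = x * p b * r a.
Proof. by rewrite -!mulrA pr. Qed.
Let rqK x a b : x * r a * q b = x * q b * r a.
Proof. by rewrite -!mulrA qr. Qed.
Let qp a b : q a * p b = p b * q a. Proof. by rewrite pq. Qed.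
Let rp a b : r a * p b = p b * r a. Proof. by rewrite pr. Qed.
Let rq a b : r a * q b = q b * r a. Proof. by rewrite qr. Qed.

Let m3 : algmor (tmul3 p q r). Proof. legs. Qed.
Let l3 := algmor_lin m3.

Local Ltac pull := do ?rewrite tens_sum_mull; do ?rewrite tens_sum_mulr.

(** Distinct strands commute, so the factors of the Sweedler sum can be sorted into R-matrices and
    reassociators. This turns the quasitriangularity axioms into hexagons. *)
Lemma hexagon_legs1 :
  tmul3 p q r
    (\sw3_(X1, X2, X3 <- F) \sw2_(R1, R2 <- R) \sw3_(x1, x2, x3 <- f)
     \sw2_(r1, r2 <- R) \sw3_(Y1, Y2, Y3 <- F)
       ((X2 * R1 * x1 * Y1) *t (X3 * x3 * r1 * Y2) *t (X1 * R2 * x2 * r2 * Y3))) =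
  tmul3 r p q F * tmul p r R * tmul3 p r q f * tmul q r R * tmul3 p q r F.
Proof.
rewrite (lin_tens_sum l3) -!mulrA [in RHS]/tmul; pull; apply: eq_tens_sum => X X3.
rewrite (lin_tens_sum l3); pull; apply: eq_tens_sum => X1 X2.
rewrite (lin_tens_sum l3); pull; apply: eq_tens_sum => R1 R2.
rewrite (lin_tens_sum l3); pull; apply: eq_tens_sum => x x3.
rewrite (lin_tens_sum l3); pull; apply: eq_tens_sum => x1 x2.
rewrite (lin_tens_sum l3); pull; apply: eq_tens_sum => r1 r2.
rewrite (lin_tens_sum l3); pull; apply: eq_tens_sum => Y Y3.
rewrite (lin_tens_sum l3); pull; apply: eq_tens_sum => Y1 Y2.
rewrite !tmulE; try legs.
rewrite !(algmorM mp) !(algmorM mq) !(algmorM mr) !mulrA.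
by rewrite !(rp, qp, rq, qpK, rpK, rqK).
Qed.

Lemma hexagon_legs2 :
  tmul3 p q r
    (\sw3_(x1, x2, x3 <- f) \sw2_(R1, R2 <- R) \sw3_(X1, X2, X3 <- F)
     \sw2_(r1, r2 <- R) \sw3_(y1, y2, y3 <- f)
       ((x3 * R1 * X2 * r1 * y1) *t (x1 * X1 * r2 * y2) *t (x2 * R2 * X3 * y3))) =
  tmul3 q r p f * tmul p r R * tmul3 q p r F * tmul p q R * tmul3 p q r f.
Proof.
rewrite (lin_tens_sum l3) -!mulrA [in RHS]/tmul; pull; apply: eq_tens_sum => X X3.
rewrite (lin_tens_sum l3); pull; apply: eq_tens_sum => X1 X2.
rewrite (lin_tens_sum l3); pull; apply: eq_tens_sum => R1 R2.
rewrite (lin_tens_sum l3); pull; apply: eq_tens_sum => x x3.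
rewrite (lin_tens_sum l3); pull; apply: eq_tens_sum => x1 x2.
rewrite (lin_tens_sum l3); pull; apply: eq_tens_sum => r1 r2.
rewrite (lin_tens_sum l3); pull; apply: eq_tens_sum => Y Y3.
rewrite (lin_tens_sum l3); pull; apply: eq_tens_sum => Y1 Y2.
rewrite !tmulE; try legs.
rewrite !(algmorM mp) !(algmorM mq) !(algmorM mr) !mulrA.
by rewrite !(rp, qp, rq, qpK, rpK, rqK).
Qed.

End Hexagons.

Section Braiding.
Variables (k : fieldType) (A : pzAlgType k) (Q : quasi_hopf A).
Variables (R : tens A A) (hR : quasitriangular Q R).
Local Notation Delta := (qh_comul Q).

Lemma R_invertible : invertible R. Proof. by case: hR. Qed.

Definition monodromy : tens A A := tswap R * R.

Variable B : pzAlgType k.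
Implicit Types p q r s : A -> B.

Local Notation cab := (cab Q).
Local Notation u_ := (uleg Q B).
Local Notation Phi := (@Phi k A Q B).
Local Notation phi := (@phi k A Q B).
Local Notation R_ p q := (tmul p q R).
Local Notation Ri p q := (tmul p q (inverse R)).
Local Notation M_ p q := (tmul p q monodromy).

Lemma RK p q : algmor p -> algmor q -> commuting p q -> R_ p q * Ri p q = 1.
Proof.
move=> mp mq pq; have m := tmul_algmor mp mq pq.
by rewrite -(algmorM m) (invertibleW R_invertible).1 algmor1.
Qed.

Lemma RiK p q : algmor p -> algmor q -> commuting p q -> Ri p q * R_ p q = 1.
Proof.
move=> mp mq pq; have m := tmul_algmor mp mq pq.
by rewrite -(algmorM m) (invertibleW R_invertible).2 algmor1.
Qed.

Lemma monodromyE p q : algmor p -> algmor q -> commuting p q ->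
  M_ p q = R_ q p * R_ p q.
Proof.
move=> mp mq pq; rewrite (algmorM (tmul_algmor mp mq pq)) tmul_swap //; legs.
Qed.

Lemma R_cab p q h : algmor p -> algmor q -> commuting p q ->
  R_ p q * cab p q h = cab q p h * R_ p q.
Proof.
move=> mp mq pq; have m := tmul_algmor mp mq pq; have [_ _ _ /(_ h)] := hR.
move=> /(congr1 (tmul p q)); rewrite !(algmorM m) tmul_swap; by [|legs].
Qed.

Lemma Ri_cab p q h : algmor p -> algmor q -> commuting p q ->
  Ri p q * cab q p h = cab p q h * Ri p q.
Proof.
move=> mp mq pq; rewrite -[LHS]mulr1 -(RK mp mq pq) mulrA -(mulrA (Ri p q)).
by rewrite -R_cab // mulrA RiK // mul1r.
Qed.

Lemma M_cab p q h : algmor p -> algmor q -> commuting p q ->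
  M_ p q * cab p q h = cab p q h * M_ p q.
Proof.
move=> mp mq pq; have qp := commuting_sym pq.
by rewrite monodromyE // -mulrA R_cab // !mulrA R_cab.
Qed.

Section Three.
Variables p q r : A -> B.
Hypotheses (mp : algmor p) (mq : algmor q) (mr : algmor r).
Hypotheses (pq : commuting p q) (pr : commuting p r) (qr : commuting q r).

Lemma hexagon1 :
  R_ (cab p q) r = Phi r p q * R_ p r * phi p r q * R_ q r * Phi p q r.
Proof.
have [_ /(congr1 (tmul3 p q r)) e _ _] := hR.
move: e; rewrite hexagon_legs1 // => <-.
by rewrite tmul_tmap; legs.
Qed.

Lemma hexagon2 :
  R_ p (cab q r) = phi q r p * R_ p r * Phi q p r * R_ p q * phi p q r.
Proof.
have [_ _ /(congr1 (tmul3 p q r)) e _] := hR.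
move: e; rewrite hexagon_legs2 // => <-.
rewrite tmul_assoc; try legs.
by rewrite tmul_tmap; legs.
Qed.

End Three.

(** With two strands erased, the hexagon makes this invertible element idempotent. *)
Lemma R_ulegl q : algmor q -> R_ u_ q = 1.
Proof.
move=> mq; have mu : algmor u_ by legs.
have uu : commuting u_ u_ by legs.
have uq : commuting u_ q by legs.
have qu : commuting q u_ by legs.
have e : R_ u_ q = R_ u_ q * R_ u_ q.
  have := hexagon1 mu mu mq uu uq uq; rewrite uleg_cab; last by legs.
  by rewrite (Phi_uleg_left Q mu mq) // (Phi_uleg_right Q mq mu) //
    (@phi_of_Phi1 _ _ _ _ u_ q u_) ?(Phi_uleg_left Q mq mu) // mul1r !mulr1.
by rewrite -[LHS]mulr1 -(RK mu mq uq) mulrA -e.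
Qed.

Lemma R_ulegr q : algmor q -> R_ q u_ = 1.
Proof.
move=> mq; have mu : algmor u_ by legs.
have uu : commuting u_ u_ by legs.
have uq : commuting u_ q by legs.
have qu : commuting q u_ by legs.
have e : R_ q u_ = R_ q u_ * R_ q u_.
  have := hexagon2 mq mu mu qu qu uu; rewrite uleg_cab; last by legs.
  by rewrite (Phi_uleg_left Q mq mu) // (@phi_of_Phi1 _ _ _ _ u_ u_ q) ?(Phi_uleg_left Q mu mq) //
    (@phi_of_Phi1 _ _ _ _ q u_ u_) ?(Phi_uleg_right Q mq mu) // mul1r !mulr1.
by rewrite -[LHS]mulr1 -(RK mq mu qu) mulrA -e.
Qed.

Lemma Ri_ulegl q : algmor q -> Ri u_ q = 1.
Proof.
move=> mq; have := @RK u_ q; rewrite R_ulegl // mul1r; apply; legs.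
Qed.

Lemma Ri_ulegr q : algmor q -> Ri q u_ = 1.
Proof.
move=> mq; have := @RK q u_; rewrite R_ulegr // mul1r; apply; legs.
Qed.

Section Twist.
Variables p q r : A -> B.
Hypotheses (mp : algmor p) (mq : algmor q) (mr : algmor r).
Hypotheses (pq : commuting p q) (pr : commuting p r) (qr : commuting q r).
Let qp := commuting_sym pq.
Let rp := commuting_sym pr.
Let rq := commuting_sym qr.

Let mpq : algmor (cab p q). Proof. legs. Qed.
Let mqr : algmor (cab q r). Proof. legs. Qed.
Let cpqr : commuting (cab p q) r. Proof. legs. Qed.
Let cqrp : commuting (cab q r) p. Proof. legs. Qed.
Let cpqr' := commuting_sym cpqr.
Let cqrp' := commuting_sym cqrp.

(* Both sides are the full twist on three strands. *)
Lemma full_twist :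
  M_ p q * M_ (cab p q) r =
  phi p q r * M_ q r * M_ p (cab q r) * Phi p q r.
Proof.
(* The common value, read from right to left: [p] crosses [q] and then [r], these two make a full
   twist, and [p] crosses back. *)
transitivity (R_ q p * phi q p r * R_ r p * Phi q r p * M_ q r * phi q r p *
              R_ p r * Phi q p r * R_ p q).
  rewrite monodromyE // (monodromyE mpq mr cpqr).
  have e1 : R_ p q * R_ r (cab p q) = R_ r (cab q p) * R_ p q.
    apply: tmul_intertwiner => a; first exact: R_cab.
    by apply: commutes_tmul.
  have e2 : R_ p q * R_ (cab p q) r = R_ (cab q p) r * R_ p q.
    apply: tmul_intertwine => a; first exact: R_cab.
    by apply: commutes_tmul.
  rewrite mulrA -(mulrA (R_ q p)) e1 -!mulrA e2 hexagon2 // hexagon1 //.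
  rewrite [M_ q r](monodromyE mq mr qr) -!mulrA.
  by rewrite (mulrA (phi r q p)) phiK // mul1r.
rewrite [M_ p (cab q r)]monodromyE //.
have e : M_ q r * R_ (cab q r) p = R_ (cab q r) p * M_ q r.
  apply: tmul_intertwine => a; first exact: M_cab.
  by apply: commutes_tmul.
rewrite -!mulrA [M_ q r * (R_ _ p * _)]mulrA e (hexagon1 mq mr mp) // hexagon2 //.
rewrite !mulrA phiK // mul1r.
by rewrite (mulK1 _ (phiK Q mp mq mr pq pr qr)).
Qed.

(** Both hexagons, read from right to left: [q] crosses [p], makes a full twist with [r], and
    crosses [p] back. *)
Lemma monodromy_cabr :
  M_ q (cab p r) = Phi q p r * R_ p q * phi p q r * M_ q r * Phi p q r * R_ q p * phi q p r.
Proof.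
have mpr : algmor (cab p r) by legs.
have c : commuting q (cab p r) by legs.
rewrite monodromyE // (hexagon1 mp mr mq) // (hexagon2 mq mp mr) //.
rewrite (monodromyE mq mr qr) !mulrA.
by rewrite (mulK1 _ (PhiK Q mp mr mq pr pq rq)).
Qed.

Lemma snake_braiding1 (V : lmodType k) (Z : B -> V) :
  linear Z -> linv Q Z q r -> rinv Q Z p q ->
  Z (R_ r q * phi r q p * Ri q p) = Z (Phi p q r).
Proof.
move=> lZ Zl Zr; have T := hexagon2 mr mq mp rq rp qp.
have {}T : R_ r q * phi r q p = phi q r p * Ri r p * Phi q p r * R_ r (cab q p).
  rewrite T !mulrA (mulK1 _ (PhiK Q mq mp mr qp qr pr)) (mulK1 _ (RiK mr mp rp)).
  by rewrite phiK // mul1r.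
have e : R_ r (cab q p) * Ri q p = Ri q p * R_ r (cab p q).
  apply/esym/tmul_intertwiner => a; first exact: Ri_cab.
  by apply: commutes_tmul.
rewrite T -(mulrA _ (R_ r (cab q p))) e !mulrA (rinv_tmul2 lZ Zr) R_ulegr // mulr1.
have E := hexagon1 mq mr mp qr qp rp.
have {}E : phi q r p * Ri r p * Phi q p r * Ri q p = Ri (cab q r) p * Phi p q r.
  rewrite -[LHS]mul1r -(RiK mqr mp cqrp) -(mulrA (Ri _ p)) E !mulrA.
  rewrite (mulK1 _ (PhiK Q mq mr mp qr qp rp)) (mulK1 _ (RK mr mp rp)).
  by rewrite (mulK1 _ (phiK Q mq mp mr qp qr pr)) (mulK1 _ (RK mq mp qp)).
by rewrite E (linv_tmul1 lZ Zl) Ri_ulegl // mul1r.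
Qed.

Lemma snake_braiding2 (V : lmodType k) (Z : B -> V) :
  linear Z -> linv Q Z p q -> rinv Q Z q r ->
  Z (R_ q p * Phi r q p * Ri r q) = Z (phi p q r).
Proof.
move=> lZ Zl Zr; have T := hexagon1 mr mq mp rq rp qp.
have {}T : R_ q p * Phi r q p = Phi r p q * Ri r p * phi p r q * R_ (cab r q) p.
  rewrite T !mulrA (mulK1 _ (phiK Q mp mr mq pr pq rq)) (mulK1 _ (RiK mr mp rp)).
  by rewrite PhiK // mul1r.
have e : R_ (cab r q) p * Ri r q = Ri r q * R_ (cab q r) p.
  apply/esym/tmul_intertwine => a; first exact: Ri_cab.
  by apply: commutes_tmul.
rewrite T -(mulrA _ (R_ (cab r q) p)) e !mulrA (rinv_tmul1 lZ Zr); try legs.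
rewrite R_ulegl // mulr1.
have E := hexagon2 mr mp mq rp rq pq.
have {}E : Phi r p q * Ri r p * phi p r q * Ri r q = Ri r (cab p q) * phi p q r.
  rewrite -[LHS]mul1r -(RiK mr mpq cpqr') -(mulrA (Ri r _)) E !mulrA.
  rewrite (mulK1 _ (phiK Q mr mp mq rp rq pq)) (mulK1 _ (RK mr mp rp)).
  by rewrite (mulK1 _ (PhiK Q mp mr mq pr pq rq)) (mulK1 _ (RK mr mq rq)).
by rewrite E (linv_tmul2 lZ Zl) // Ri_ulegr // mul1r.
Qed.

End Twist.

End Braiding.

(** * The elements u and w *)

Lemma tens_sum_exchange (k : fieldType) (U V U' V' W : lmodType k)
    (s : tens U V) (t : tens U' V') (f : U -> V -> U' -> V' -> W) :
  \sw2_(a, b <- s) \sw2_(c, d <- t) f a b c d =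
  \sw2_(c, d <- t) \sw2_(a, b <- s) f a b c d.
Proof. exact: exchange_big. Qed.

Section Drinfeld.
Variables (k : fieldType) (A : pzAlgType k) (Q : quasi_hopf A).
Variables (R : tens A A) (hR : quasitriangular Q R).

Local Notation Delta := (qh_comul Q).
Local Notation eps := (qh_counit Q).
Local Notation S := (qh_antipode Q).
Local Notation alpha := (qh_alpha Q).
Local Notation beta := (qh_beta Q).
Local Notation Phi0 := (qh_reassoc Q).
Local Notation phi0 := (inverse Phi0).
Local Notation u := (qt_u Q R).
Let lS := antipode_linear Q.

Local Ltac multilin :=
  repeat split; intros; move=> ? ? ? /=;
  rewrite ?(mulrDl, mulrDr, lS, =^~ pzscalerAl, =^~ pzscalerAr) //.

(* The elements of the pairing ev o c and of the copairing c^-1 o coev. *)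
Definition braided_alpha : A := \sw2_(R1, R2 <- R) (S R2 * alpha * R1).
Definition braided_beta : A := \sw2_(R1, R2 <- inverse R) (R2 * beta * S R1).
(* The inverse of u. *)
Definition qt_v : A :=
  \sw3_(x1, x2, x3 <- phi0) (x3 * braided_beta * S (S x1 * alpha * x2)).
Local Notation v := qt_v.

(** Since [R] exchanges [Delta h] with its flip, the reversed coproduct becomes the one of
    [antipode_alpha]. *)
Lemma braided_alpha_inv h :
  \sw2_(x, y <- Delta h) (S y * braided_alpha * x) = eps h *: braided_alpha.
Proof.
pose g (a c : A) := S c * alpha * a.
have bg : bilinear2 g by rewrite /g; multilin.
have lG := lift2_linear bg.
transitivity (lift2 g (R * Delta h)).
  rewrite -{2}[Delta h]tens_sum_id tens_sum_mulr (lin_tens_sum lG).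
  apply: eq_tens_sum => x y; rewrite tens_sum_mulr tens_sum_mull.
  rewrite (lin_expand2 R (F := fun t => lift2 g (t * (x *t y)))); last first.
    exact: (linear_comp lG (mulr_linearr _)).
  by apply: eq_tens_sum => a c; rewrite tensM lift2E // /g antipodeM !mulrA.
have [_ _ _ <-] := hR.
rewrite (lin_expand2 R (F := fun t => lift2 g (_ * t))); last first.
  exact: (linear_comp lG (mulr_linearl _)).
rewrite /braided_alpha (lin_tens_sum (f := fun s => eps h *: s)); last first.
  exact: scale_linear.
apply: eq_tens_sum => a c.
rewrite -[Delta h]tens_sum_id (lin_tens_sum (@tswap_linear _ _ _)) tens_sum_mull.
rewrite (lin_tens_sum lG).
transitivity ((S c * (eps h *: alpha)) * a); last by rewrite -pzscalerAr -pzscalerAl.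
rewrite -antipode_alpha tens_sum_mulr tens_sum_mull; apply: eq_tens_sum => x y.
by rewrite tswapE tensM lift2E // /g antipodeM !mulrA.
Qed.

Lemma inverse_R_comul h : inverse R * tswap (Delta h) = Delta h * inverse R.
Proof.
have [RV VR] := invertibleW (R_invertible hR); have [_ _ _ e] := hR.
by rewrite -[LHS]mulr1 -RV mulrA -(mulrA (inverse R)) e mulrA VR mul1r.
Qed.

Lemma braided_beta_inv h :
  \sw2_(x, y <- Delta h) (y * braided_beta * S x) = eps h *: braided_beta.
Proof.
pose g (a c : A) := c * beta * S a.
have bg : bilinear2 g by rewrite /g; multilin.
have lG := lift2_linear bg.
transitivity (lift2 g (Delta h * inverse R)).
  rewrite -{2}[Delta h]tens_sum_id tens_sum_mull (lin_tens_sum lG).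
  apply: eq_tens_sum => x y; rewrite tens_sum_mulr tens_sum_mull.
  rewrite (lin_expand2 (inverse R) (F := fun t => lift2 g (x *t y * t))); last first.
    exact: (linear_comp lG (mulr_linearl _)).
  by apply: eq_tens_sum => a c; rewrite tensM lift2E // /g antipodeM !mulrA.
rewrite -inverse_R_comul.
rewrite (lin_expand2 (inverse R) (F := fun t => lift2 g (t * _))); last first.
  exact: (linear_comp lG (mulr_linearr _)).
rewrite /braided_beta (lin_tens_sum (f := fun s => eps h *: s)); last first.
  exact: scale_linear.
apply: eq_tens_sum => a c.
rewrite -[Delta h]tens_sum_id (lin_tens_sum (@tswap_linear _ _ _)) tens_sum_mulr.
rewrite (lin_tens_sum lG).
transitivity ((c * (eps h *: beta)) * S a); last by rewrite -pzscalerAr -pzscalerAl.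
rewrite -antipode_beta tens_sum_mulr tens_sum_mull; apply: eq_tens_sum => x y.
by rewrite tswapE tensM lift2E // /g antipodeM !mulrA.
Qed.

Let b a c := S c * braided_alpha * a.
Let b' a c := c * braided_beta * S a.

Let bl c : linear (b^~ c). Proof. by rewrite /b; multilin. Qed.
Let br a : linear (b a). Proof. by rewrite /b; multilin. Qed.
Let bl' c : linear (b'^~ c). Proof. by rewrite /b'; multilin. Qed.
Let br' a : linear (b' a). Proof. by rewrite /b'; multilin. Qed.

Let b_inv h a c : \sw2_(x, y <- Delta h) b (x * a) (y * c) = eps h *: b a c.
Proof.
rewrite /b -(mulrA (S c)) pzscalerAr pzscalerAl -braided_alpha_inv.
rewrite tens_sum_mull tens_sum_mulr; apply: eq_tens_sum => x y.
by rewrite antipodeM !mulrA.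
Qed.

Let b'_inv h a c : \sw2_(x, y <- Delta h) b' (a * x) (c * y) = eps h *: b' a c.
Proof.
rewrite /b' -(mulrA c) pzscalerAr pzscalerAl -braided_beta_inv.
rewrite tens_sum_mull tens_sum_mulr; apply: eq_tens_sum => x y.
by rewrite antipodeM !mulrA.
Qed.

(** In this form [u] is the invariant pairing [b] evaluated along [phi0], so the general facts on
    pairings give both its commutation with [A] and its relation to [braided_alpha]. *)
Lemma qt_uE :
  u = \sw3_(x1, x2, x3 <- phi0) (S (x2 * beta * S x3) * braided_alpha * x1).
Proof.
rewrite /qt_u tens_sum_exchange; apply: eq_tens_sum => p x3.
rewrite tens_sum_exchange; apply: eq_tens_sum => x1 x2.
rewrite tens_sum_mulr tens_sum_mull; apply: eq_tens_sum => R1 R2.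
by rewrite -!(mulrA R2) antipodeM !mulrA.
Qed.

(** [pairing_transpose] moves [h] to the second argument of [b] as [S h], and [b] applies [S] to
    that argument once more. *)
Lemma qt_uM h : u * h = S (S h) * u.
Proof.
have := pairing_transpose bl br b_inv h 1; rewrite /b => e.
transitivity (\sw3_(x1, x2, x3 <- phi0) b (x1 * h) (x2 * beta * S x3 * 1)).
  rewrite qt_uE; do 2 (rewrite tens_sum_mull; apply: eq_tens_sum => ? ?).
  by rewrite /b mulr1 !mulrA.
rewrite [LHS]e qt_uE; do 2 (rewrite tens_sum_mulr; apply: eq_tens_sum => ? ?).
by rewrite mulr1 (antipodeM _ _ (S h)) !mulrA.
Qed.

(** The value of [b] at (1, 1), factored through alpha by [pairing_factor]. *)
Lemma braided_alphaE : S alpha * u = braided_alpha.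
Proof.
have := pairing_factor bl br b_inv 1 1; rewrite /b antipode1 mul1r mulr1 => <-.
rewrite qt_uE; do 2 (rewrite tens_sum_mulr; apply: eq_tens_sum => ? ?).
by rewrite !mulr1 (antipodeM _ _ alpha) !mulrA.
Qed.

Lemma qt_vM h : h * v = v * S (S h).
Proof.
have := copairing_transpose bl' br' b'_inv h 1; rewrite /b' => e.
transitivity (\sw3_(x1, x2, x3 <- phi0) b' (1 * S x1 * alpha * x2) (h * x3)).
  rewrite /qt_v; do 2 (rewrite tens_sum_mulr; apply: eq_tens_sum => ? ?).
  by rewrite /b' mul1r !mulrA.
rewrite [LHS]e /qt_v; do 2 (rewrite tens_sum_mull; apply: eq_tens_sum => ? ?).
by rewrite mul1r -!(mulrA (S h)) antipodeM !mulrA.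
Qed.

Lemma braided_betaE : v * S beta = braided_beta.
Proof.
transitivity (b' 1 1); last by rewrite /b' antipode1 mul1r mulr1.
rewrite -(copairing_factor bl' br' b'_inv) /b'.
rewrite /qt_v; do 2 (rewrite tens_sum_mull; apply: eq_tens_sum => ? ?).
by rewrite !mul1r -!(mulrA beta) (antipodeM _ beta) !mulrA.
Qed.

(** Pulling [v] through S^2 turns the product into a zigzag of the braided pairing and copairing,
    which [snake_braiding1] straightens to [antipode_Phi]. *)
Lemma qt_vu : v * u = 1.
Proof.
(* The zigzag with none, one or both of alpha and beta replaced by the braided ones; each
   replacement amounts to an [R] or its inverse in two strands. *)
pose z a b c := a * beta * S b * alpha * c.
pose z2 a b c := a * beta * S b * braided_alpha * c.
pose z3 a b c := a * braided_beta * S b * braided_alpha * c.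
have tz : trilinear z by rewrite /z; multilin.
have tz2 : trilinear z2 by rewrite /z2; multilin.
have tz3 : trilinear z3 by rewrite /z3; multilin.
have lZ := lift3_linear tz; have lZ2 := lift3_linear tz2; have lZ3 := lift3_linear tz3.
transitivity (lift3 z3 (phi Q leg3 leg2 leg1)).
  rewrite (lin_expand3 phi0 (F := fun t => lift3 z3 (tmul3 leg3 leg2 leg1 t))); last first.
    by apply: (linear_comp lZ3); legs.
  rewrite qt_uE; do 2 (rewrite tens_sum_mulr; apply: eq_tens_sum => ? ?).
  rewrite !tmulE; try legs.
  rewrite !tensM !mul1r ?mulr1 lift3E // /z3 -braided_betaE !mulrA qt_vM.
  by rewrite 2!antipodeM !mulrA.
transitivity (lift3 z2 (phi Q leg3 leg2 leg1 * tmul leg2 leg1 (inverse R))).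
  apply: (tens3_lin_ext (F := lift3 z3) (G := fun t => lift3 z2 (t * _)) lZ3).
    exact: (linear_comp lZ2 (mulr_linearr _)).
  move=> a d c; rewrite lift3E // tens_sum_mulr (lin_tens_sum lZ2).
  rewrite /z3 /braided_beta tens_sum_mulr !tens_sum_mull; apply: eq_tens_sum => x y.
  by rewrite !tensM !mul1r !mulr1 lift3E // /z2 antipodeM !mulrA.
transitivity (lift3 z (tmul leg3 leg2 R * (phi Q leg3 leg2 leg1 * tmul leg2 leg1 (inverse R)))).
  apply: (tens3_lin_ext (F := lift3 z2) (G := fun t => lift3 z (_ * t)) lZ2).
    exact: (linear_comp lZ (mulr_linearl _)).
  move=> a d c; rewrite lift3E // tens_sum_mull (lin_tens_sum lZ).
  rewrite /z2 /braided_alpha tens_sum_mulr !tens_sum_mull; apply: eq_tens_sum => x y.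
  by rewrite !tensM !mul1r ?mulr1 lift3E // /z antipodeM !mulrA.
rewrite mulrA (snake_braiding1 hR) //; try legs.
- rewrite /Phi tmul_legs -[RHS](antipode_Phi Q).
  by do 2 apply: eq_tens_sum => ? ?.
- apply: linv23 => // h a d c; rewrite /z.
  have l : linear (fun s : A => a * beta * s) by multilin.
  transitivity (eps h *: (a * beta * (S d * alpha * c))); last by rewrite !mulrA.
  rewrite -(linear_forZ l) -antipode_alpha_in (lin_tens_sum l).
  by apply: eq_tens_sum => x y; rewrite !mulrA.
- apply: rinv12 => // h a d c; rewrite /z.
  have l : linear (fun s : A => s * alpha * c) by multilin.
  by rewrite -(linear_forZ l) -antipode_beta_in (lin_tens_sum l).
Qed.

Definition zigzag (a b c : A) : A := S a * alpha * b * beta * S c.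

Lemma zigzag_trilinear : trilinear zigzag.
Proof. by rewrite /zigzag; multilin. Qed.

Lemma zigzag_linv : linv Q (lift3 zigzag) leg1 leg2.
Proof.
apply: linv12; first exact: zigzag_trilinear.
move=> h a d c; rewrite /zigzag.
have l : linear (fun s : A => s * beta * S c) by multilin.
by rewrite -(linear_forZ l) -antipode_alpha_in (lin_tens_sum l).
Qed.

Lemma zigzag_rinv : rinv Q (lift3 zigzag) leg2 leg3.
Proof.
apply: rinv23; first exact: zigzag_trilinear.
move=> h a d c; rewrite /zigzag.
have l : linear (fun s : A => S a * alpha * s) by multilin.
transitivity (eps h *: (S a * alpha * (d * beta * S c))); last by rewrite !mulrA.
rewrite -(linear_forZ l) -antipode_beta_in (lin_tens_sum l).
by apply: eq_tens_sum => x y; rewrite !mulrA.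
Qed.

Lemma zigzag_phi : lift3 zigzag (phi Q leg1 leg2 leg3) = 1.
Proof.
rewrite /phi tmul_legs -[RHS](antipode_phi Q).
by do 2 apply: eq_tens_sum => ? ?.
Qed.

(** The second zigzag yields only [e], where [g = u * v] is caught between two factors, and [g] is
    so far known to commute with the image of S^2. It is therefore first absorbed by [S alpha], and
    then cancelled with [antipode_phi]. *)
Lemma qt_uv : u * v = 1.
Proof.
pose z2 a b c := S a * braided_alpha * b * beta * S c.
pose z3 a b c := S a * braided_alpha * b * braided_beta * S c.
have tz := zigzag_trilinear.
have tz2 : trilinear z2 by rewrite /z2; multilin.
have tz3 : trilinear z3 by rewrite /z3; multilin.
have lZ := lift3_linear tz; have lZ2 := lift3_linear tz2; have lZ3 := lift3_linear tz3.
have [g gE] : exists g, g = u * v by exists (u * v).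
have gS h : g * S (S h) = S (S h) * g by rewrite gE -mulrA -qt_vM mulrA qt_uM mulrA.
have e : \sw3_(X1, X2, X3 <- Phi0) (S (alpha * X3) * g * S (X1 * beta * S X2)) = 1.
  transitivity (lift3 z3 (Phi Q leg3 leg2 leg1)).
    rewrite [RHS](lin_expand3 Phi0 (F := fun t => lift3 z3 (tmul3 leg3 leg2 leg1 t)));
      last by apply: (linear_comp lZ3); legs.
    apply: eq_tens_sum => X X3; apply: eq_tens_sum => X1 X2.
    rewrite !tmulE; try legs.
    rewrite !tensM !mul1r ?mulr1 lift3E // /z3 -braided_betaE -braided_alphaE.
    by rewrite gE !antipodeM !mulrA -(mulrA _ X2 v) (qt_vM X2) !mulrA.
  transitivity (lift3 z2 (Phi Q leg3 leg2 leg1 * tmul leg3 leg2 (inverse R))).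
    apply: (tens3_lin_ext (F := lift3 z3) (G := fun t => lift3 z2 (t * _)) lZ3).
      exact: (linear_comp lZ2 (mulr_linearr _)).
    move=> a d c; rewrite lift3E // tens_sum_mulr (lin_tens_sum lZ2).
    rewrite /z3 /braided_beta tens_sum_mulr !tens_sum_mull; apply: eq_tens_sum => x y.
    by rewrite !tensM !mul1r !mulr1 lift3E // /z2 antipodeM !mulrA.
  transitivity (lift3 zigzag
      (tmul leg2 leg1 R * (Phi Q leg3 leg2 leg1 * tmul leg3 leg2 (inverse R)))).
    apply: (tens3_lin_ext (F := lift3 z2) (G := fun t => lift3 zigzag (_ * t)) lZ2).
      exact: (linear_comp lZ (mulr_linearl _)).
    move=> a d c; rewrite lift3E // tens_sum_mull (lin_tens_sum lZ).
    rewrite /z2 /braided_alpha tens_sum_mulr !tens_sum_mull; apply: eq_tens_sum => x y.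
    by rewrite !tensM !mul1r ?mulr1 lift3E // /zigzag antipodeM !mulrA.
  rewrite mulrA (snake_braiding2 hR) ?zigzag_phi //; try legs.
    exact: zigzag_linv.
  exact: zigzag_rinv.
rewrite -gE; have ag : S alpha * g = S alpha.
  (* In the snake for [h], the reassociator side is [e] times [S alpha], and the other side is
     [S alpha * g] by [antipode_phi]. *)
  pose h a b c d := S (alpha * d) * g * S (S a * alpha * b * beta * S c).
  have qh : quadrilinear h by rewrite /h; multilin.
  have l : linear (fun s : A => S alpha * g * S s) by multilin.
  have e4 := snake_pairing4 (Q := Q) qh.
  transitivity (\sw3_(x, y, z <- phi0) h x y z 1).
    transitivity (S alpha * g *
        S (\sw3_(x1, x2, x3 <- phi0) (S x1 * alpha * x2 * beta * S x3))).
      by rewrite antipode_phi antipode1 mulr1.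
    do 2 (rewrite (lin_tens_sum l); apply: eq_tens_sum => ? ?).
    by rewrite /h mulr1.
  rewrite -e4.
  - rewrite -[RHS]mul1r -[1 in RHS]e; do 2 (rewrite tens_sum_mull; apply: eq_tens_sum => ? ?).
    by rewrite /h antipode1 mul1r -!mulrA !(antipodeM _ alpha) !mulrA.
  - move=> t a d c x; rewrite /h.
    have l1 : linear (fun s : A => S (alpha * x) * g * S (s * beta * S c)) by multilin.
    by rewrite -(linear_forZ l1) -antipode_alpha_in (lin_tens_sum l1).
  - move=> t a d c x; rewrite /h.
    have l1 : linear (fun s : A => S (alpha * x) * g * S (S a * alpha * s)) by multilin.
    transitivity (eps t *: (S (alpha * x) * g * S (S a * alpha * (d * beta * S c)))).
      rewrite -(linear_forZ l1) -antipode_beta_in (lin_tens_sum l1).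
      by apply: eq_tens_sum => y y'; rewrite !mulrA.
    by rewrite !mulrA.
  - move=> t a d c x; rewrite /h.
    have l1 : linear (fun s : A => S s * g * S (S a * alpha * d * beta)) by multilin.
    have E s s' : S (alpha * s') * g * S (S a * alpha * d * beta * S s) =
        S (S s * alpha * s') * g * S (S a * alpha * d * beta).
      rewrite (antipodeM _ _ (S s)) !mulrA -(mulrA _ g) gS.
      by rewrite -(mulrA (S s)) (antipodeM _ (S s)) !mulrA.
    rewrite E -(linear_forZ l1) -antipode_alpha_in (lin_tens_sum l1).
    by apply: eq_tens_sum => y y'; rewrite E.
have l : linear (fun s : A => S s * g) by multilin.
have l' : linear (fun s : A => S s) by multilin.
transitivity (S (\sw3_(x1, x2, x3 <- phi0) (S x1 * alpha * x2 * beta * S x3)) * g).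
  by rewrite antipode_phi antipode1 mul1r.
transitivity (S (\sw3_(x1, x2, x3 <- phi0) (S x1 * alpha * x2 * beta * S x3)));
  last by rewrite antipode_phi antipode1.
rewrite [LHS](lin_tens_sum l) (lin_tens_sum l'); apply: eq_tens_sum => p x3.
rewrite (lin_tens_sum l) (lin_tens_sum l'); apply: eq_tens_sum => x1 x2.
by rewrite -!mulrA !(antipodeM _ (S x1)) !(antipodeM _ alpha) -!mulrA -gS (mulrA _ g) ag.
Qed.

Lemma qt_uS : S (S u) = u.
Proof. by rewrite -[LHS]mulr1 -qt_uv mulrA -qt_uM -mulrA qt_uv mulr1. Qed.

Lemma qt_u_antipode : u * S u = S u * u.
Proof. by rewrite -[S u in LHS]mulr1 -qt_uv !mulrA qt_uM qt_uS -mulrA qt_uv mulr1. Qed.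

(** S^2 is conjugation by [u], which can be undone. *)
Lemma antipode_surjective h : exists h', S h' = h.
Proof.
exists (S (v * h * u)); rewrite -[LHS]mulr1 -qt_uv mulrA -qt_uM.
by rewrite !mulrA qt_uv mul1r -mulrA qt_uv mulr1.
Qed.

Definition qt_w : A := u * S u.
Local Notation w := qt_w.

(** For h = S(g), passing [u] turns S(g) into S^3(g), and [S] applied to [qt_uM] shows that passing
    S(u) turns it back. *)
Lemma qt_w_central h : w * h = h * w.
Proof.
have [g <-] := antipode_surjective h; rewrite /w qt_u_antipode -mulrA qt_uM.
by rewrite mulrA -antipodeM -qt_uM antipodeM -mulrA.
Qed.

Lemma qt_wS : S w = w.
Proof. by rewrite antipodeM qt_uS. Qed.

Definition qt_wV : A := S v * v.

Lemma qt_wK : w * qt_wV = 1.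
Proof.
by rewrite /w /qt_wV -mulrA (mulrA (S u)) -antipodeM qt_vu antipode1 mul1r qt_uv.
Qed.

Lemma qt_wVK : qt_wV * w = 1.
Proof.
by rewrite /w /qt_wV -mulrA (mulrA v) qt_vu mul1r -antipodeM qt_uv antipode1.
Qed.

(** The inner crossing turns alpha into [braided_alpha = S alpha * u]. Moving this [u] to the right
    makes the outer crossing [S braided_alpha], which supplies the factor [S u]. *)
Lemma antipode_monodromy :
  lift2 (fun a c => S a * alpha * c) (monodromy R) = w * alpha.
Proof.
set g := fun a c : A => _.
have bg : bilinear2 g by rewrite /g; multilin.
have lG := lift2_linear bg.
have l : linear (fun t => lift2 g (tswap R * t)) by exact: (linear_comp lG (mulr_linearl _)).
rewrite /monodromy (lin_expand2 R l).
transitivity (S braided_alpha * u).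
  rewrite /braided_alpha (lin_tens_sum lS) tens_sum_mull; apply: eq_tens_sum => a c.
  transitivity (S a * braided_alpha * c).
    rewrite /braided_alpha tens_sum_mulr tens_sum_mull.
    rewrite -[tswap R](_ : \sw2_(x, y <- R) (y *t x) = _) // tens_sum_mull.
    rewrite (lin_tens_sum lG); apply: eq_tens_sum => x y.
    by rewrite tensM lift2E // /g antipodeM !mulrA.
  rewrite -braided_alphaE -!mulrA qt_uM.
  by rewrite (antipodeM _ (S c)) (antipodeM _ alpha) !mulrA.
by rewrite -braided_alphaE antipodeM /w qt_u_antipode -mulrA -qt_uM mulrA.
Qed.

End Drinfeld.

(** * The counit on alpha, beta and the antipode *)

Section Counit.
Variables (k : fieldType) (A : pzAlgType k) (Q : quasi_hopf A).
Local Notation Delta := (qh_comul Q).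
Local Notation eps := (qh_counit Q).
Local Notation S := (qh_antipode Q).
Local Notation alpha := (qh_alpha Q).
Local Notation beta := (qh_beta Q).
Local Notation u_ := (uleg Q A).
Let leps : linear (eps : A -> k^o). Proof. exact: counit_scalar. Qed.
Let epsM := counitM Q.

Lemma counitZ a x : eps (a *: x) = a * eps x.
Proof. exact: (linear_forZ leps). Qed.

Lemma counit_antipode_alpha h : eps (S h) * eps alpha = eps h * eps alpha.
Proof.
have le : linear (fun s : A => (eps (S s) * eps alpha : k^o)).
  by move=> a x y; rewrite (antipode_linear Q) leps mulrDl scalerAl.
rewrite -[RHS]counitZ -antipode_alpha -[in LHS](comul_counitr Q h).
rewrite [LHS](lin_tens_sum le) [RHS](lin_tens_sum leps); apply: (@eq_tens_sum k _ _ k^o) => x y.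
by rewrite (linear_forZ (antipode_linear Q)) counitZ !epsM -[LHS]mulrA mulrC.
Qed.

(** The counit of [antipode_Phi]: the factor eps(alpha) removes [S] from eps(S(X2)), and the
    reassociator on three erased strands is 1. As a result eps(alpha) can be cancelled. *)
Lemma counit_beta_alpha : eps beta * eps alpha = 1.
Proof.
rewrite -(counit1 Q) -[in RHS](antipode_Phi Q) [RHS](lin_tens_sum leps).
have e : Phi Q u_ u_ u_ = 1 by apply: Phi_uleg_mid; legs.
rewrite -[LHS]mul1r -(counit1 Q) -e [X in X * _ = _](lin_tens_sum leps).
rewrite [LHS](lin_tens_sum (f := fun s : k^o => s * (eps beta * eps alpha) : k^o));
  last by move=> a x y; rewrite mulrDl scalerAl.
apply: (@eq_tens_sum k _ _ k^o) => p X3.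
rewrite tens_sum_mull !(lin_tens_sum leps).
rewrite [LHS](lin_tens_sum (f := fun s : k^o => s * (eps beta * eps alpha) : k^o));
  last by move=> a x y; rewrite mulrDl scalerAl.
apply: (@eq_tens_sum k _ _ k^o) => X1 X2.
rewrite !epsM /uleg !counitZ counit1.
transitivity (eps X1 * eps beta * (eps (S X2) * eps alpha) * eps X3); last by ring.
by rewrite counit_antipode_alpha; ring.
Qed.

Lemma counit_alpha_neq0 : eps alpha != 0.
Proof.
by apply/eqP=> e; have := counit_beta_alpha; rewrite e mulr0 => /esym/eqP; rewrite oner_eq0.
Qed.

Lemma counit_antipode h : eps (S h) = eps h.
Proof. exact: (mulIf counit_alpha_neq0 (counit_antipode_alpha h)). Qed.

End Counit.

(** * The monodromy on invariant forms *)

Section Invariant.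
Variables (k : fieldType) (A : pzAlgType k) (Q : quasi_hopf A).
Variables (R : tens A A) (hR : quasitriangular Q R).
Local Notation Delta := (qh_comul Q).
Local Notation eps := (qh_counit Q).
Local Notation S := (qh_antipode Q).
Local Notation alpha := (qh_alpha Q).
Local Notation beta := (qh_beta Q).
Local Notation phi0 := (inverse (qh_reassoc Q)).
Local Notation w := (qt_w Q R).
Local Notation M := (monodromy R).
Local Notation M_ p q := (tmul p q (monodromy R)).

Variables (B : pzAlgType k) (V : lmodType k).
Implicit Types (p q r : A -> B) (G : B -> V).

Local Notation cab := (cab Q).
Local Notation Phi := (@Phi k A Q B).
Local Notation phi := (@phi k A Q B).

(* An invariant pairing factors through S(a) alpha c, on which the monodromy
   acts as w. *)
Lemma linv_monodromy G p q t : algmor p -> algmor q -> commuting p q ->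
  linear G -> linv Q G p q ->
  G (M_ p q * t) = G (q w * t) /\ G (M_ p q * t) = G (p w * t).
Proof.
move=> mp mq pq lG Gi; pose b a c := G (p a * q c * t).
have lp := algmor_lin mp; have lq := algmor_lin mq.
have bl c : linear (b^~ c).
  by move=> x y z /=; rewrite /b lp !mulrDl -!pzscalerAl lG.
have br a : linear (b a).
  by move=> x y z /=; rewrite /b lq mulrDr mulrDl -pzscalerAr -pzscalerAl lG.
have inv h a c : \sw2_(x, y <- Delta h) b (x * a) (y * c) = eps h *: b a c.
  rewrite /b -Gi tens_sum_mull (lin_tens_sum lG); apply: eq_tens_sum => x y.
  rewrite (algmorM mp) (algmorM mq) !mulrA.
  by rewrite -(mulrA (p x) (p a)) (pq a y) !mulrA.
pose F y := \sw3_(x1, x2, x3 <- phi0) b x1 (x2 * beta * S x3 * y).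
have lF : linear F.
  apply: tens_sum_linear_param => s x3; apply: tens_sum_linear_param => x1 x2.
  exact: (linear_comp (br _) (mulr_linearl _)).
have bE a c : b a c = F (S a * alpha * c).
  rewrite -(pairing_factor bl br inv).
  transitivity (\sw3_(x1, x2, x3 <- phi0) b (x1 * a) (x2 * beta * S x3 * (alpha * c))).
    by do 2 apply: eq_tens_sum => ? ?; rewrite mulrA.
  rewrite (pairing_transpose bl br inv).
  by do 2 apply: eq_tens_sum => ? ?; rewrite !mulrA.
have -> : G (M_ p q * t) = F (w * alpha).
  rewrite -(antipode_monodromy hR) [in RHS](lin_tens_sum lF).
  rewrite tens_sum_mull (lin_tens_sum lG); apply: eq_tens_sum => a c.
  by rewrite -bE.
have e1 : G (q w * t) = b 1 w by rewrite /b (algmor1 mp) mul1r.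
have e2 : G (p w * t) = b w 1 by rewrite /b (algmor1 mq) mulr1.
(* The two values to compare with are F(alpha w) and F(S(w) alpha); both are F(w alpha) because w is
   central and S(w) = w. *)
rewrite e1 e2 !bE antipode1 mul1r mulr1 (qt_wS hR); split=> //.
by rewrite qt_w_central.
Qed.

Section Three.
Variables (p q r : A -> B) (G : B -> V).
Hypotheses (mp : algmor p) (mq : algmor q) (mr : algmor r).
Hypotheses (pq : commuting p q) (pr : commuting p r) (qr : commuting q r).
Hypotheses (lG : linear G).
Let qp := commuting_sym pq.
Let rp := commuting_sym pr.
Let rq := commuting_sym qr.

Let mpq : algmor (cab p q). Proof. legs. Qed.
Let mqr : algmor (cab q r). Proof. legs. Qed.
Let mpr : algmor (cab p r). Proof. legs. Qed.
Let cpqr : commuting (cab p q) r. Proof. legs. Qed.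
Let cqrp : commuting p (cab q r). Proof. legs. Qed.
Let cqpr : commuting q (cab p r). Proof. legs. Qed.

Let w_comm (s f : A -> B) : algmor s -> commuting s f -> forall x, s w * f x = f x * s w.
Proof. by move=> ms sf x; rewrite sf. Qed.

Let w_central (s : A -> B) : algmor s -> forall x, s w * s x = s x * s w.
Proof. by move=> ms x; rewrite -!(algmorM ms) (qt_w_central hR). Qed.

(* The middle strand encircles the two others. *)
Lemma linv_monodromy_middle s : linv Q G (cab p q) r ->
  G (M_ p q * (phi p q r * M_ q r * Phi p q r) * s) = G (q w * s).
Proof.
(* Once [q] is moved in front of [p], the form is a pairing of [q] with the doubled strand of [p]
   and [r], so the monodromy of this pair acts as w on [q]. *)
move=> Gi; pose G' t := G (tmul q p R * phi q p r * t).
have lG' : linear G' by exact: (linear_comp lG (mulr_linearl _)).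
have Gi' : linv Q G' q (cab p r).
  move=> h t; rewrite /G' !mulrA -(mulrA _ (phi q p r)) cab_coassoc' // mulrA.
  have e : tmul q p R * cab (cab q p) r h = cab (cab p q) r h * tmul q p R.
    by apply: tmul_intertwine => a; [apply: R_cab | apply: commutes_tmul].
  by rewrite e -!mulrA Gi.
have [RV VR] : tmul q p R * tmul q p (inverse R) = 1 /\
               tmul q p (inverse R) * tmul q p R = 1.
  by split; [exact: (RK hR mq mp qp) | exact: (RiK hR mq mp qp)].
have [_ e] := linv_monodromy (Phi q p r * tmul q p (inverse R) * s) mq mpr cqpr lG' Gi'.
move: e; rewrite /G' (monodromy_cabr hR) // [M_ p q]monodromyE // !mulrA.
rewrite (mulK1 _ (phiK Q mq mp mr qp qr pr)) (mulK1 _ (phiK Q mq mp mr qp qr pr)).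
rewrite (mulK1 _ RV) => ->; congr (G (_ * _)).
have e1 : q w * (tmul q p R * phi q p r) = tmul q p R * phi q p r * q w.
  have eR : q w * tmul q p R = tmul q p R * q w.
    by apply: tmul_intertwine; [exact: w_central | exact: w_comm].
  have ep : q w * phi q p r = phi q p r * q w.
    apply: tmul_intertwine; last exact: w_comm.
    by apply: tmul_intertwine; [exact: w_central | exact: w_comm].
  by rewrite mulrA eR -mulrA ep mulrA.
by rewrite -e1 -!mulrA (mulrA (phi q p r)) phiK // mul1r RV mulr1.
Qed.

(** An invariant trilinear form is a pairing of [cab p q] with [r], and up to Phi of [p] with
    [cab q r]. The two sides are its values on the full twist, with the doubled monodromy acting as
    w on [r] and on [p] respectively. *)
Lemma linv_full_twist s : linv Q G (cab p q) r ->
  G (M_ p q * (r w * s)) = G (p w * (phi p q r * M_ q r * Phi p q r) * s).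
Proof.
move=> Gi.
have eM : M_ p q * M_ (cab p q) r = M_ (cab p q) r * M_ p q.
  by apply: tmul_intertwine => a; [apply: M_cab | apply: commutes_tmul].
have [e _] := linv_monodromy (M_ p q * s) mpq mr cpqr lG Gi.
transitivity (G (M_ p q * M_ (cab p q) r * s)).
  rewrite eM -mulrA e !mulrA; congr (G (_ * _)).
  by apply: commutes_tmul.
rewrite full_twist //.
pose G' t := G (phi p q r * t).
have lG' : linear G' by exact: (linear_comp lG (mulr_linearl _)).
have Gi' : linv Q G' p (cab q r).
  by move=> h t; rewrite /G' !mulrA cab_coassoc' // -mulrA Gi.
have [_ e'] := linv_monodromy (M_ q r * Phi p q r * s) mp mqr cqrp lG' Gi'.
have eM' : M_ q r * M_ p (cab q r) = M_ p (cab q r) * M_ q r.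
  apply: tmul_intertwiner => a; first exact: M_cab.
  by apply: commutes_tmul => //; exact: commuting_sym.
rewrite -(mulrA (phi p q r)) eM'; move: e'; rewrite /G' !mulrA => ->.
congr (G (_ * _ * _ * _)); apply/esym; apply: tmul_intertwine; last exact: w_comm.
by apply: tmul_intertwine; [exact: w_central | exact: w_comm].
Qed.

End Three.

(** [linv_full_twist] is applied to the form t |-> G(M_pq t). This puts M_pq next to the conjugate
    of M_qr, and together they encircle the strand [q]. *)
Lemma linv_monodromy_sq p q r G s :
  algmor p -> algmor q -> algmor r ->
  commuting p q -> commuting p r -> commuting q r ->
  linear G -> linv Q G (cab p q) r ->
  G (M_ p q * M_ p q * (r w * s)) = G (p w * q w * s).
Proof.
move=> mp mq mr pq pr qr lG Gi.
pose G' t := G (M_ p q * t).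
have lG' : linear G' by exact: (linear_comp lG (mulr_linearl _)).
have Gi' : linv Q G' (cab p q) r.
  move=> h t; rewrite /G' mulrA.
  have -> : M_ p q * cab (cab p q) r h = cab (cab p q) r h * M_ p q.
    by apply: tmul_intertwine => a; [apply: M_cab | apply: commutes_tmul].
  by rewrite -mulrA Gi.
have := linv_full_twist mp mq mr pq pr qr lG' s Gi'.
rewrite /G' !mulrA => ->.
have w_central x : p w * p x = p x * p w.
  by rewrite -!(algmorM mp) (qt_w_central hR).
rewrite -!mulrA.
have e3 t : p w * tmul3 p q r t = tmul3 p q r t * p w.
  apply: tmul_intertwine => x; last exact: pr.
  by apply: tmul_intertwine => y; [exact: w_central | exact: pq].
have e2 : p w * M_ q r = M_ q r * p w.
  by apply: tmul_intertwine => x; [exact: pq | exact: pr].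
have -> : p w * (phi p q r * (M_ q r * (Phi p q r * s))) =
          phi p q r * M_ q r * Phi p q r * (p w * s).
  by rewrite mulrA /phi e3 -mulrA (mulrA (p w)) e2 -mulrA (mulrA (p w)) /Phi e3 !mulrA.
rewrite [X in G X]mulrA (linv_monodromy_middle mp mq mr pq pr qr lG) //.
by rewrite !mulrA pq.
Qed.

End Invariant.

(** * The coproduct of w and the value of the monodromy on beta *)

Section Casimir.
Variables (k : fieldType) (A : pzAlgType k) (Q : quasi_hopf A).
Variables (R : tens A A) (hR : quasitriangular Q R).
Local Notation Delta := (qh_comul Q).
Local Notation eps := (qh_counit Q).
Local Notation S := (qh_antipode Q).
Local Notation alpha := (qh_alpha Q).
Local Notation beta := (qh_beta Q).
Local Notation phi0 := (inverse (qh_reassoc Q)).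
Local Notation w := (qt_w Q R).
Local Notation u := (qt_u Q R).
Local Notation M := (monodromy R).
Let lS := antipode_linear Q.
Let lD := algmor_lin (comul_algmor Q).
Let DM := algmorM (comul_algmor Q).
Let D1 := algmor1 (comul_algmor Q).

Local Ltac multilin :=
  repeat split; intros; move=> ? ? ? /=;
  rewrite ?(mulrDl, mulrDr, lS, =^~ pzscalerAl, =^~ pzscalerAr) //.

Lemma monodromy_comul h : M * Delta h = Delta h * M.
Proof.
have := M_cab hR h (@tensl_algmor k A A) (@tensr_algmor k A A) (@tensl_tensr k A A).
by rewrite /cab !tmul_tensl_tensr.
Qed.

Lemma qt_w_tensor_central (t : tens A A) : (w *t w) * t = t * (w *t w).
Proof.
move: t; apply: tens_lin_ext; [exact: mulr_linearl | exact: mulr_linearr |].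
by move=> a b; rewrite !tensM !(qt_w_central hR).
Qed.

(** [linv_monodromy_sq] gives the identity multiplied on the left by Delta(S(alpha) u). The factor
    Delta(u) is invertible, and Delta(S(alpha)) is cancelled by inserting [antipode_phi], through
    which the defect [N] can be moved. *)
Lemma comul_qt_w : Delta w * (M * M) = w *t w.
Proof.
(* The trilinear form is the pairing of V (x) W with its dual given by ev o c. *)
pose ba := braided_alpha Q R.
pose g (p : tens A A) (c : A) := Delta (S c * ba) * p.
have bg : bilinear2 g.
  by split=> [c|p] a x y; rewrite /g ?mulrDr -?pzscalerAr // lS mulrDl -pzscalerAl lD
    mulrDl -pzscalerAl.
have lG := lift2_linear bg.
have Gi : linv Q (lift2 g) (cab Q leg1 leg2) leg3.
  move=> h; apply: tens_lin_ext.
  - exact: (linear_comp lG (mulr_linearl _)).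
  - exact: scale_linear.
  move=> p c /=; rewrite [cab _ _ _ _](_ : _ = \sw2_(x, y <- Delta h) (Delta x *t y)).
    rewrite tens_sum_mull (lin_tens_sum lG) lift2E // /g.
    rewrite -(linear_forZ (mulr_linearr _)) -(linear_forZ lD) pzscalerAr.
    rewrite -(braided_alpha_inv hR) tens_sum_mulr (lin_tens_sum lD) tens_sum_mull.
    apply: eq_tens_sum => x y; rewrite tensM lift2E // /g [LHS]mulrA -DM.
    by rewrite antipodeM !mulrA.
  apply: eq_tens_sum => x y; rewrite /cab tmul_leg12.
  by rewrite [tensl _ * _]tensM mulr1 mul1r.
have := linv_monodromy_sq hR 1 (@leg1_algmor k A) (@leg2_algmor k A)
  (@leg3_algmor k A) (@leg12 k A) (@leg13 k A) (@leg23 k A) lG Gi.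
rewrite !mulr1 !tmul_leg12 -(algmorM (@tensl_algmor k (tens A A) A)).
rewrite [tensl _ * leg3 _]tensM mulr1 mul1r.
rewrite [leg1 _ * _]tensM tensM !mulr1 mul1r !lift2E // /g antipode1 mul1r (qt_wS hR).
rewrite /ba -(braided_alphaE hR) (qt_w_central hR) (DM _ w) (DM (S alpha) u) => e.
pose wV := qt_wV Q R.
have wwV : (w *t w) * (wV *t wV) = 1 by rewrite tensM (qt_wK hR).
have wVw : (wV *t wV) * (w *t w) = 1 by rewrite tensM (qt_wVK hR).
(* The defect, to be shown equal to 1. It commutes with the image of Delta because M does and w is
   central. *)
have [N NE] : exists N, N = Delta w * (M * M) * (wV *t wV) by exists (Delta w * (M * M) * (wV *t wV)).
have Nc h : GRing.comm (Delta h) N.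
  have cM : GRing.comm (Delta h) M by rewrite /GRing.comm monodromy_comul.
  have cw : GRing.comm (Delta h) (Delta w) by rewrite /GRing.comm -!DM (qt_w_central hR).
  rewrite NE; apply: commrM; first by apply: commrM => //; exact: commrM.
  rewrite /GRing.comm -[LHS]mul1r -wVw -mulrA [X in _ * X]mulrA qt_w_tensor_central.
  by rewrite -mulrA wwV mulr1.
have eN : Delta (S alpha) * N = Delta (S alpha).
  have e' : Delta (S alpha) * Delta u * N = Delta (S alpha) * Delta u.
    by rewrite NE mulrA [X in X * _]mulrA e -mulrA wwV mulr1.
  transitivity (Delta (S alpha) * Delta u * Delta (qt_v Q R)); last first.
    by rewrite -mulrA -DM (qt_uv hR) D1 mulr1.
  by rewrite -e' -!mulrA -(Nc (qt_v Q R)) (mulrA (Delta u)) -DM (qt_uv hR) D1 mul1r.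
have lDS : linear (fun s : A => Delta (S s)) by move=> a x y; rewrite lS lD.
have lDN : linear (fun s : A => Delta (S s) * N) by move=> a x y; rewrite lDS mulrDl -pzscalerAl.
have N1 : N = 1.
  transitivity (Delta (S (\sw3_(x1, x2, x3 <- phi0) (S x1 * alpha * x2 * beta * S x3))) * N).
    by rewrite antipode_phi antipode1 D1 mul1r.
  transitivity (Delta (S (\sw3_(x1, x2, x3 <- phi0) (S x1 * alpha * x2 * beta * S x3))));
    last by rewrite antipode_phi antipode1.
  rewrite [LHS](lin_tens_sum lDN) (lin_tens_sum lDS); apply: eq_tens_sum => p x3.
  rewrite (lin_tens_sum lDN) (lin_tens_sum lDS); apply: eq_tens_sum => x1 x2.
  rewrite -!mulrA !(antipodeM _ (S x1)) !(antipodeM _ alpha) !DM -!mulrA (Nc _).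
  by rewrite (mulrA (Delta (S alpha)) N) eN.
by rewrite -[LHS]mulr1 -wVw mulrA -NE N1 mul1r.
Qed.

(** The counit of T(M) = w alpha: M with both strands erased is 1, and eps(alpha) cancels. *)
Lemma counit_qt_w : eps w = 1.
Proof.
have leps : linear (eps : A -> k^o) := counit_scalar Q.
apply: (mulIf (counit_alpha_neq0 Q)); rewrite mul1r -counitM -(antipode_monodromy hR).
have e : tmul (uleg Q A) (uleg Q A) M = 1.
  by rewrite monodromyE ?(R_ulegl hR) ?mulr1 //; legs.
rewrite -[RHS]mul1r -(counit1 Q) -e [LHS](lin_tens_sum leps).
rewrite [X in _ = X * _](lin_tens_sum leps).
rewrite [RHS](lin_tens_sum (f := fun s : k^o => s * eps alpha : k^o));
  last by move=> a x y; rewrite mulrDl scalerAl.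
apply: (@eq_tens_sum k _ _ k^o) => x y.
by rewrite /uleg !counitM !counitZ counit_antipode counit1 !mulr1 mulrAC.
Qed.

(** The dual of [antipode_monodromy]. The left side [K] defines an invariant copairing, and
    [copairing_factor] writes it as beta times the zigzag with M inserted on strands 2 and 3; this
    zigzag is w. *)
Lemma antipode_monodromy_beta :
  lift2 (fun a c : A => a * beta * S c) M = beta * w.
Proof.
pose g (a c : A) := a * beta * S c.
have bg : bilinear2 g by rewrite /g; multilin.
have lG := lift2_linear bg.
pose K := lift2 g M.
have KE a c : lift2 g (a *t c * M) = a * K * S c.
  rewrite (lin_expand2 M (F := fun t => lift2 g (_ * t))); last first.
    exact: (linear_comp lG (mulr_linearl _)).
  rewrite /K /lift2 tens_sum_mulr tens_sum_mull; apply: eq_tens_sum => x y.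
  by rewrite tensM [LHS]lift2E // /g antipodeM !mulrA.
have Kinv h : \sw2_(x, y <- Delta h) (x * K * S y) = eps h *: K.
  transitivity (lift2 g (Delta h * M)).
    rewrite (lin_expand2 (Delta h) (F := fun t => lift2 g (t * M))); last first.
      exact: (linear_comp lG (mulr_linearr _)).
    by apply: eq_tens_sum => x y; rewrite KE.
  rewrite -monodromy_comul (lin_expand2 M (F := fun t => lift2 g (t * _))); last first.
    exact: (linear_comp lG (mulr_linearr _)).
  rewrite /K /lift2 (lin_tens_sum (f := fun s => eps h *: s)); last exact: scale_linear.
  apply: eq_tens_sum => a c; rewrite [in RHS]/g -antipode_beta_in.
  rewrite -[LHS]/(lift2 g _).
  rewrite (lin_expand2 (Delta h) (F := fun t => lift2 g (_ * t))); last first.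
    exact: (linear_comp lG (mulr_linearl _)).
  by apply: eq_tens_sum => x y; rewrite tensM lift2E.
pose b' (a c : A) := a * K * S c.
have bl c : linear (b'^~ c) by rewrite /b'; multilin.
have br a : linear (b' a) by rewrite /b'; multilin.
have b'_inv h a c : \sw2_(x, y <- Delta h) b' (a * x) (c * y) = eps h *: b' a c.
  rewrite /b' -(mulrA a) pzscalerAr pzscalerAl -Kinv tens_sum_mull tens_sum_mulr.
  by apply: eq_tens_sum => x y; rewrite antipodeM !mulrA.
have tz := zigzag_trilinear Q; have lZ := lift3_linear tz.
have Zr := zigzag_rinv Q; have Zl := zigzag_linv Q.
have -> : lift2 (fun a c : A => a * beta * S c) M = b' 1 1.
  by rewrite /b' antipode1 mulr1 mul1r.
rewrite -(copairing_factor bl br b'_inv).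
(* The full twist carries the monodromy from the copairing on strands 2, 3 to the pairing on strands
   1, 2, where it acts as w. The two monodromies with a doubled strand are erased by invariance. *)
have -> : w = lift3 (zigzag Q) (phi Q leg1 leg2 leg3 * tmul leg2 leg3 M).
  have m1 := @leg1_algmor k A; have m2 := @leg2_algmor k A; have m3 := @leg3_algmor k A.
  have c12 := @leg12 k A; have c13 := @leg13 k A; have c23 := @leg23 k A.
  have m12 : algmor (cab Q (@leg1 k A) leg2) by legs.
  have c123 : commuting (cab Q (@leg1 k A) leg2) leg3 by legs.
  have FT := full_twist hR m1 m2 m3 c12 c13 c23.
  have -> : phi Q leg1 leg2 leg3 * tmul leg2 leg3 M = phi Q leg1 leg2 leg3 * tmul leg2 leg3 M * tmul leg1 (uleg Q _) M.
    by rewrite [tmul leg1 _ M]monodromyE ?(R_ulegl hR) ?(R_ulegr hR) ?mulr1 //; legs.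
  rewrite -(rinv_tmul2 lZ Zr) -[X in lift3 _ X]mulr1 -(PhiK Q m1 m2 m3 c12 c13 c23) mulrA -FT.
  have -> : tmul leg1 leg2 M * tmul (cab Q leg1 leg2) leg3 M =
            tmul (cab Q leg1 leg2) leg3 M * tmul leg1 leg2 M.
    by apply: tmul_intertwine => a; [apply: M_cab | apply: commutes_tmul].
  rewrite -mulrA (linv_tmul1 lZ Zl).
  have -> : tmul (uleg Q _) leg3 M = 1 :> tens (tens A A) A.
    by rewrite monodromyE ?(R_ulegl hR) ?(R_ulegr hR) ?mulr1 //; legs.
  rewrite mul1r (linv_monodromy hR _ m1 m2 c12 lZ Zl).2 lift3Ml //.
  rewrite -[LHS]mulr1 -[1 in LHS](antipode_phi Q) tens_sum_mulr /phi tmul_legs.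
  apply: eq_tens_sum => p x3; rewrite tens_sum_mulr; apply: eq_tens_sum => x1 x2.
  by rewrite /zigzag !mul1r antipodeM (qt_wS hR) -(qt_w_central hR (S x1)) !mulrA.
rewrite /phi tmul_legs.
rewrite (lin_expand3 phi0 (F := fun t => lift3 (zigzag Q) (t * _))); last first.
  exact: (linear_comp lZ (mulr_linearr _)).
do 2 (rewrite tens_sum_mulr; apply: eq_tens_sum => ? ?).
rewrite [X in lift3 _ X]tens_sum_mulr (lin_tens_sum lZ) /b' /K /lift2 !mul1r !(tens_sum_mulr, tens_sum_mull).
apply: eq_tens_sum => x y.
by rewrite !tensM !mulr1 !mul1r lift3E // /zigzag /g antipodeM !mulrA.
Qed.

End Casimir.

(** * Adjoining a square root *)

Section AdjoinSqrt.
Variables (k : fieldType) (H : algType k) (w : H).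
Hypothesis w_central : forall h : H, w * h = h * w.

Local Notation A := (adjoin_sqrt w).
Local Notation i := (adjoin_in w).
Local Notation theta := (adjoin_theta w).
Local Notation rel := ('X ^+ 2 - w%:P : {poly H}).
Local Notation qt := (@quot_of k (poly_alg H) (fun p : {poly H} => p = rel) : {poly H} -> A).

Let qtM (x y : {poly H}) : qt x * qt y = qt (x * y).
Proof. exact: quot_mulE. Qed.

Let qtD (x y : {poly H}) : qt x + qt y = qt (x + y).
Proof. exact: quot_addE. Qed.

Lemma adjoin_in_algmor : algmor (i : H -> A).
Proof.
split=> [a x y|].
  rewrite /adjoin_in; transitivity (qt ((a%:A : H) *: x%:P + y%:P)).
    by rewrite polyCD -mul_polyC -polyCM mulr_algl.
  rewrite -qtD; congr (_ + _); apply/esym; exact: quot_scaleE.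
split=> // x y; rewrite /adjoin_in polyCM; exact/esym/qtM.
Qed.

Lemma adjoin_theta_sq : theta * theta = i w.
Proof.
transitivity (qt ('X * 'X)); first exact: qtM.
apply/quot_ofP; rewrite -[X in ideal_gen _ X]mul1r -[X in ideal_gen _ X]mulr1 -expr2.
exact: ideal_gen_mul.
Qed.

Lemma adjoin_thetaC h : theta * i h = i h * theta.
Proof.
transitivity (qt ('X * h%:P)); first exact: qtM.
by rewrite -commr_polyX; apply/esym/qtM.
Qed.

Lemma adjoin_decomp (x : A) : exists ab : H * H, x = i ab.1 + i ab.2 * theta.
Proof.
elim/quot_ind: x => p; elim/poly_ind: p => [|p c [[a b] /= e]].
  exists (0, 0) => /=; have l := linear_for0 (algmor_lin adjoin_in_algmor).
  by rewrite l mul0r addr0.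
(* Horner step: (a + b theta) theta + c with theta^2 = w. *)
exists (b * w + c, a) => /=.
transitivity (qt (p * 'X + c%:P)); first by [].
rewrite -qtD -qtM [qt p]e mulrDl -mulrA adjoin_theta_sq.
have m := adjoin_in_algmor.
by rewrite (linear_forD (algmor_lin m)) (algmorM m) -[LHS]addrA [LHS]addrC.
Qed.

Let rel_central (p : {poly H}) : rel * p = p * rel.
Proof.
rewrite mulrBl mulrBr; congr (_ - _); first by rewrite commr_polyXn.
by apply/polyP => j; rewrite coefCM coefMC.
Qed.

(** The generator is central because w is, so the two-sided ideal consists of its left multiples. *)
Let ideal_multiple (p : {poly H}) :
  @ideal_gen k (poly_alg H) (fun p : {poly H} => p = rel) p -> exists q, p = q * rel.
Proof.
elim=> [|x y _ [q ->] _ [r ->]|a g b ->].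
- by exists 0; rewrite mul0r.
- by exists (q + r); rewrite mulrDl.
by exists (a * b); rewrite -mulrA rel_central mulrA.
Qed.

(** A nonzero multiple of the monic polynomial X^2 - w has degree at least 2, which gives the
    freeness of H(theta) on 1 and theta. *)
Lemma adjoin_inj0 (a b : H) : i a + i b * theta = 0 -> a = 0 /\ b = 0.
Proof.
move=> e; have {}e : qt (b *: 'X + a%:P) = qt 0.
  have -> : b *: 'X + a%:P = a%:P + b%:P * 'X by rewrite mul_polyC addrC.
  by rewrite -qtD -qtM.
move/quot_ofP: e; rewrite subr0 => /ideal_multiple[q e].
have q0 : q = 0.
  apply/eqP/negPn/negP => q0.
  have := size_Mmonic q0 (monicXnsubC w (isT : 0 < 2)%N).
  rewrite -e size_XnsubC // => se.
  have := size_polyD (b *: 'X) a%:P.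
  rewrite se leqNgt => /negP; apply; rewrite gtn_max.
  apply/andP; split.
    apply: leq_ltn_trans (size_scale_leq _ _) _.
    by rewrite size_polyX addn3 /= !ltnS lt0n size_poly_eq0.
  apply: leq_ltn_trans (size_polyC_leq1 _) _.
  by rewrite addn3.
move: e; rewrite q0 mul0r => e; split.
  by have := congr1 (fun p : {poly H} => p`_0) e;
    rewrite coefD coefZ coefX coefC coef0 mulr0 add0r.
by have := congr1 (fun p : {poly H} => p`_1) e;
  rewrite coefD coefZ coefX coefC coef0 mulr1 addr0.
Qed.

Let li := algmor_lin adjoin_in_algmor.

Lemma adjoin_coord_uniq (a b a' b' : H) :
  i a + i b * theta = i a' + i b' * theta -> a = a' /\ b = b'.
Proof.
move=> e; have sub x y : i (x - y) = i x - i y.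
  by rewrite (linear_forD li) -scaleN1r (linear_forZ li) scaleN1r.
have [] := @adjoin_inj0 (a - a') (b - b').
  rewrite !sub mulrBl addrACA -opprD; apply/eqP; rewrite subr_eq0; exact/eqP.
by move=> /eqP; rewrite subr_eq0 => /eqP -> /eqP; rewrite subr_eq0 => /eqP ->.
Qed.

Lemma adjoin_in_inj : injective i.
Proof.
move=> a b e; have [] // := @adjoin_coord_uniq a 0 b 0.
by rewrite e.
Qed.

Lemma adjoin_theta_central (x : A) : theta * x = x * theta.
Proof.
have [[a b] /= ->] := adjoin_decomp x.
by rewrite mulrDl mulrDr mulrA !adjoin_thetaC.
Qed.

End AdjoinSqrt.

(** * Maps of tensor products and central elements *)

Section Naturality.
Variable k : fieldType.

Lemma tmap_comp (U V U' V' U'' V'' : lmodType k) (f : U' -> U'') (g : V' -> V'')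
    (f' : U -> U') (g' : V -> V') t :
  linear f -> linear g -> linear f' -> linear g' ->
  tmap f g (tmap f' g' t) = tmap (f \o f') (g \o g') t.
Proof.
move=> lf lg lf' lg'; rewrite [LHS](lin_tens_sum (tmap_linear lf lg)).
by apply: eq_tens_sum => u v; rewrite tmapE.
Qed.

Lemma tmap_tassoc (U V W U' V' W' : lmodType k) (f : U -> U') (g : V -> V')
    (h : W -> W') t : linear f -> linear g -> linear h ->
  tassoc (tmap f (tmap g h) t) = tmap (tmap f g) h (tassoc t).
Proof.
move=> lf lg lh; have lgh := tmap_linear lg lh; have lfg := tmap_linear lf lg.
rewrite [LHS](lin_tens_sum (@tassoc_linear _ _ _ _)).
rewrite [RHS](lin_tens_sum (tmap_linear lfg lh)); apply: eq_tens_sum => u p.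
rewrite [RHS](lin_tens_sum (tmap_linear lfg lh)).
pose F (q : tens V' W') := tassoc (f u *t q).
have lF : linear F by move=> a x y; rewrite /F tensorDr tensorZr tassoc_linear.
rewrite [LHS](lin_tens_sum lF); apply: eq_tens_sum => v w.
by rewrite /F tassocE !tmapE.
Qed.

Lemma tmap_tswap (U V U' V' : lmodType k) (f : U -> U') (g : V -> V') t :
  linear f -> linear g -> tswap (tmap f g t) = tmap g f (tswap t).
Proof.
move=> lf lg; rewrite [LHS](lin_tens_sum (@tswap_linear _ _ _)).
rewrite [RHS](lin_tens_sum (tmap_linear lg lf)).
by apply: eq_tens_sum => u v; rewrite tswapE tmapE.
Qed.

Lemma tswapK (U V : lmodType k) (t : tens U V) : tswap (tswap t) = t.
Proof.
move: t; apply: (tens_lin_ext (f := fun t => tswap (tswap t)) (g := id)) => //.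
  by apply: linear_comp; exact: tswap_linear.
by move=> u v; rewrite !tswapE.
Qed.

Lemma lift2_tmap (U V U' V' W : lmodType k) (f : U -> U') (g : V -> V')
    (F : U' -> V' -> W) t : bilinear2 F ->
  lift2 F (tmap f g t) = lift2 (fun a b => F (f a) (g b)) t.
Proof.
move=> bF; rewrite [LHS](lin_tens_sum (lift2_linear bF)).
by apply: eq_tens_sum => u v; rewrite lift2E.
Qed.

Lemma lift3_tmap (U V W U' V' W' X : lmodType k) (f : U -> U') (g : V -> V')
    (h : W -> W') (F : U' -> V' -> W' -> X) t : trilinear F ->
  lift3 F (tmap (tmap f g) h t) = lift3 (fun a b c => F (f a) (g b) (h c)) t.
Proof.
move=> tF; rewrite [LHS](lin_tens_sum (lift3_linear tF)).
apply: eq_tens_sum => p c.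
pose G (q : tens U' V') := lift3 F (q *t h c).
have lG : linear G.
  by move=> a x y; rewrite /G tensorDl tensorZl (lift3_linear tF).
rewrite [LHS](lin_tens_sum lG); apply: eq_tens_sum => a b.
by rewrite /G lift3E.
Qed.

Lemma tmap_algmor (A A' B B' : pzAlgType k) (f : A -> A') (g : B -> B') :
  algmor f -> algmor g -> algmor (tmap f g).
Proof.
move=> mf mg; have -> : tmap f g = tmul (tensl \o f) (tensr \o g).
  by apply/funext => t; apply: eq_tens_sum => a b; rewrite tensor_tensl_tensr.
by legs.
Qed.

Lemma tswap_algmor (A B : pzAlgType k) : algmor (@tswap k A B).
Proof.
have -> : @tswap k A B = tmul tensr tensl.
  by apply/funext => t; apply: eq_tens_sum => a b; rewrite tensor_tensl_tensr tensl_tensr.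
by legs.
Qed.

Lemma tassoc_algmor (A B C : pzAlgType k) : algmor (@tassoc k A B C).
Proof.
have -> : @tassoc k A B C = tmul (tensl \o tensl) (tmul (tensl \o tensr) tensr).
  apply/funext => t; apply: eq_tens_sum => a p.
  rewrite tens_sum_mulr; apply: eq_tens_sum => b c.
  by rewrite !tensM !mulr1 !mul1r.
have c : commuting ((tensl : tens A B -> tens (tens A B) C) \o tensl) (tensl \o tensr).
  move=> a b; have m := algmorM (@tensl_algmor k (tens A B) C).
  by rewrite /= -[LHS]m -[RHS]m tensl_tensr.
by apply: tmul_algmor; [leg|leg|apply: commuting_tmulr => //; exact: (commuting_comp _ (@tensl_tensr k (tens A B) C))].
Qed.

Definition central (A : pzAlgType k) (x : A) := forall y, x * y = y * x.

Lemma tensl_central (A B : pzAlgType k) (x : A) :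
  central x -> central (tensl x : tens A B).
Proof.
move=> cx; apply: tens_lin_ext; [exact: mulr_linearl | exact: mulr_linearr |].
by move=> a b; rewrite !tensM cx mul1r mulr1.
Qed.

Lemma tensr_central (A B : pzAlgType k) (x : B) :
  central x -> central (tensr x : tens A B).
Proof.
move=> cx; apply: tens_lin_ext; [exact: mulr_linearl | exact: mulr_linearr |].
by move=> a b; rewrite !tensM cx mul1r mulr1.
Qed.

Lemma tensor_central (A B : pzAlgType k) (x : A) (y : B) :
  central x -> central y -> central (x *t y).
Proof.
by move=> cx cy z; rewrite tensor_tensl_tensr -mulrA (tensr_central cy) mulrA tensl_central // mulrA.
Qed.

Lemma conj_algmor (A : pzAlgType k) (x y : A) : x * y = 1 -> y * x = 1 ->
  algmor (fun z => x * z * y).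
Proof.
move=> xy yx; split; first exact: (linear_comp (mulr_linearr _) (mulr_linearl _)).
split=> [|a b]; first by rewrite mulr1.
by rewrite !mulrA -(mulrA _ y x) yx mulr1.
Qed.

End Naturality.
#[local] Hint Resolve tswap_algmor tassoc_algmor : legs_db.

(** * The inverse monodromy *)

Section InverseMonodromy.
Variables (k : fieldType) (A : pzAlgType k) (Q : quasi_hopf A).
Variables (R : tens A A) (hR : quasitriangular Q R).
Local Notation Delta := (qh_comul Q).
Local Notation M := (monodromy R).
Local Notation w := (qt_w Q R).

Lemma monodromy_invertible : invertible M.
Proof.
have [RV VR] := invertibleW (R_invertible hR).
have m := tswap_algmor A A.
exists (inverse R * tswap (inverse R)); rewrite /monodromy; split.
  by rewrite mulrA (mulK1 _ RV) -(algmorM m) RV algmor1.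
by rewrite mulrA -(mulrA (inverse R)) -(algmorM m) VR (algmor1 m) mulr1 VR.
Qed.

Let MV := (invertibleW monodromy_invertible).1.
Let VM := (invertibleW monodromy_invertible).2.

Lemma inverse_monodromy_comul h : inverse M * Delta h = Delta h * inverse M.
Proof.
rewrite -[LHS]mulr1 -MV mulrA -(mulrA _ (Delta h)) -(monodromy_comul hR).
by rewrite mulrA VM mul1r.
Qed.

Lemma comul_qt_wE : Delta w = (w *t w) * (inverse M * inverse M).
Proof.
have e : M * M * (inverse M * inverse M) = 1 by rewrite mulrA -(mulrA M M) MV mulr1 MV.
by rewrite -(comul_qt_w hR) -mulrA e mulr1.
Qed.

(** The flip of M = R_21 R is R R_21, its conjugate by [R]. This will be the intertwining relation
    at theta. *)
Lemma tswap_inverse_monodromy : tswap (inverse M) * R = R * inverse M.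
Proof.
have m := tswap_algmor A A.
have e : tswap M * R = R * M.
  rewrite (algmorM m) /monodromy mulrA; congr (_ * _ * _).
  exact: tswapK.
rewrite -[LHS]mulr1 -MV mulrA -(mulrA _ R M) -e mulrA -(algmorM m) VM algmor1 //.
by rewrite mul1r.
Qed.

(** On each side of the full twist the two monodromies commute, so inversion does not reverse their
    order. This will be coassociativity at theta. *)
Lemma full_twist_inverse (B : pzAlgType k) (p q r : A -> B) :
  algmor p -> algmor q -> algmor r ->
  commuting p q -> commuting p r -> commuting q r ->
  tmul q r (inverse M) * tmul p (cab Q q r) (inverse M) =
  Phi Q p q r * (tmul p q (inverse M) * tmul (cab Q p q) r (inverse M)) * phi Q p q r.
Proof.
move=> mp mq mr pq pr qr; have FT := full_twist hR mp mq mr pq pr qr.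
have K (s t : A -> B) : algmor s -> algmor t -> commuting s t ->
    tmul s t M * tmul s t (inverse M) = 1 /\ tmul s t (inverse M) * tmul s t M = 1.
  move=> ms mt st; have m := tmul_algmor ms mt st.
  by rewrite -!(algmorM m) MV VM (algmor1 m).
have mpq : algmor (cab Q p q) by legs.
have mqr : algmor (cab Q q r) by legs.
have cpqr : commuting (cab Q p q) r by legs.
have cqrp : commuting p (cab Q q r) by legs.
have [a1 a2] := K _ _ mp mq pq; have [b1 b2] := K _ _ mpq mr cpqr.
have [c1 c2] := K _ _ mq mr qr; have [d1 d2] := K _ _ mp mqr cqrp.
have e : tmul q r M * tmul p (cab Q q r) M = tmul p (cab Q q r) M * tmul q r M.
  apply: tmul_intertwiner => a; first exact: M_cab.
  by apply: commutes_tmul => //; exact: commuting_sym.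
have e' : tmul p q M * tmul (cab Q p q) r M = tmul (cab Q p q) r M * tmul p q M.
  by apply: tmul_intertwine => a; [apply: M_cab | apply: commutes_tmul].
set X := LHS; set Y := RHS.
have XL : X * (tmul p (cab Q q r) M * tmul q r M) = 1.
  by rewrite /X mulrA -(mulrA _ _ (tmul p _ M)) d2 mulr1.
have FT' : tmul p (cab Q q r) M * tmul q r M =
    Phi Q p q r * (tmul (cab Q p q) r M * tmul p q M) * phi Q p q r.
  rewrite -e' FT -e !mulrA PhiK // mul1r.
  by rewrite -!mulrA PhiK // mulr1.
have LY : (tmul p (cab Q q r) M * tmul q r M) * Y = 1.
  rewrite FT' /Y !mulrA (mulK1 _ (phiK Q mp mq mr pq pr qr)).
  by rewrite (mulK1 _ a1) (mulK1 _ b1) PhiK.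
by rewrite -[LHS]mulr1 -LY mulrA XL mul1r.
Qed.

(** This will be the counit axiom at theta. *)
Lemma tmul_uleg_inverse_monodromy : tmul id (uleg Q A) (inverse M) = 1 /\
  tmul (uleg Q A) id (inverse M) = 1.
Proof.
have h (s t : A -> A) : algmor s -> algmor t -> commuting s t -> tmul s t M = 1 ->
    tmul s t (inverse M) = 1.
  move=> ms mt st e; have m := tmul_algmor ms mt st.
  by rewrite -[LHS]mul1r -e -(algmorM m) MV (algmor1 m).
by split; apply: h; try legs; rewrite monodromyE ?(R_ulegl hR) ?(R_ulegr hR) ?mulr1 //; legs.
Qed.

(** T applied to M M^-1 = 1: the factor M stands next to alpha and gives w alpha, and w is
    central. *)
Lemma antipode_inverse_monodromy :
  w * lift2 (fun a c : A => qh_antipode Q a * qh_alpha Q * c) (inverse M) = qh_alpha Q.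
Proof.
set g := fun a c : A => _.
have bg : bilinear2 g.
  by split=> [c|a] x y z; rewrite /g ?mulrDr -?pzscalerAr // antipode_linear !mulrDl -!pzscalerAl.
have lG := lift2_linear bg.
transitivity (lift2 g (M * inverse M)); last first.
  by rewrite MV lift2E // /g antipode1 mul1r mulr1.
rewrite (lin_expand2 (inverse M) (F := fun t => lift2 g (M * t))); last first.
  exact: (linear_comp lG (mulr_linearl _)).
rewrite /lift2 tens_sum_mulr; apply: eq_tens_sum => a c.
transitivity (qh_antipode Q a * (w * qh_alpha Q) * c).
  by rewrite /g (mulrA (qh_antipode Q a)) -(qt_w_central hR (qh_antipode Q a)) -!(mulrA w).
rewrite -(antipode_monodromy hR) tens_sum_mulr tens_sum_mull -[RHS]/(lift2 g _).
rewrite (lin_expand2 M (F := fun t => lift2 g (t * _))); last first.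
  exact: (linear_comp lG (mulr_linearr _)).
by apply: eq_tens_sum => x y; rewrite tensM lift2E // /g antipodeM !mulrA.
Qed.

Lemma antipode_inverse_monodromy_beta :
  w * lift2 (fun a c : A => a * qh_beta Q * qh_antipode Q c) (inverse M) = qh_beta Q.
Proof.
set g := fun a c : A => _.
have bg : bilinear2 g.
  by split=> [c|a] x y z; rewrite /g ?mulrDl -?pzscalerAl // antipode_linear !mulrDr -!pzscalerAr.
have lG := lift2_linear bg.
transitivity (lift2 g (inverse M * M)); last first.
  by rewrite VM lift2E // /g antipode1 mul1r mulr1.
rewrite (lin_expand2 (inverse M) (F := fun t => lift2 g (t * M))); last first.
  exact: (linear_comp lG (mulr_linearr _)).
rewrite /lift2 tens_sum_mulr; apply: eq_tens_sum => a c.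
transitivity (a * (qh_beta Q * w) * qh_antipode Q c).
  by rewrite /g -(qt_w_central hR (qh_beta Q)) (mulrA a) -(qt_w_central hR a) -!(mulrA w).
rewrite -(antipode_monodromy_beta hR) tens_sum_mulr tens_sum_mull -[RHS]/(lift2 g _).
rewrite (lin_expand2 M (F := fun t => lift2 g (_ * t))); last first.
  exact: (linear_comp lG (mulr_linearl _)).
by apply: eq_tens_sum => x y; rewrite tensM lift2E // /g antipodeM !mulrA.
Qed.

End InverseMonodromy.

(** * Representations *)

Lemma sum_tens_exchange (k : fieldType) (U V W : lmodType k) (I : finType)
    (t : tens U V) (f : I -> U -> V -> W) :
  \sum_j (\sw2_(a, b <- t) f j a b) = \sw2_(a, b <- t) (\sum_j f j a b).
Proof. exact: exchange_big. Qed.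

Section Representations.
Variables (k : fieldType) (A : pzAlgType k) (Q : quasi_hopf A).
Implicit Types V W X : rep A.

Lemma rep_braidingE (r : tens A A) V W (t : tens V W) :
  rep_braiding r t = tswap (tens_act r t).
Proof.
rewrite /tens_act (lin_tens_sum (@tswap_linear _ _ _)).
apply: eq_tens_sum => a b; rewrite (lin_tens_sum (@tswap_linear _ _ _)).
by apply: eq_tens_sum => v v'; rewrite tswapE.
Qed.

Lemma tens_act_tswap (r : tens A A) V W (t : tens V W) :
  tens_act r (tswap t) = tswap (tens_act (tswap r) t).
Proof.
have lt (U U' : lmodType k) := @tswap_linear k U U'.
move: r; apply: (tens_lin_ext (f := fun r => tens_act r (tswap t))
  (g := fun r => tswap (tens_act (tswap r) t))).
- by move=> a x y; exact: tens_act_linearl.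
- by move=> a x y; rewrite lt tens_act_linearl lt.
move=> a b; rewrite tswapE; move: t.
apply: (tens_lin_ext (f := fun t => tens_act (a *t b) (tswap t))
  (g := fun t => tswap (tens_act (b *t a) t))).
- by move=> c x y; rewrite lt tens_act_linearr.
- by move=> c x y; rewrite tens_act_linearr lt.
by move=> v v'; rewrite tswapE !tens_actE tswapE.
Qed.

Lemma double_braiding (r : tens A A) V W (t : tens V W) :
  rep_braiding r (rep_braiding r t) = tens_act (tswap r * r) t.
Proof. by rewrite !rep_braidingE tens_act_tswap tswapK -tens_actM. Qed.

Lemma tens_act_tensor (a b : A) V W (t : tens V W) :
  tens_act (a *t b) t = tmap (@rep_act _ _ V a) (@rep_act _ _ W b) t.
Proof.
have la := @rep_act_linearr _ _ V a; have lb := @rep_act_linearr _ _ W b.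
move: t; apply: tens_lin_ext; [exact: tens_act_linearr | exact: tmap_linear |].
by move=> v v'; rewrite tens_actE tmapE.
Qed.

Lemma tens_act3_linear V W X (r : tens (tens A A) A) :
  linear (@tens_act3 _ _ V W X r).
Proof.
apply: tens_sum_linear_param => p c; apply: tens_sum_linear.
split=> [x|q] a y z /=.
  by rewrite tens_act_linearr tensorDl tensorZl.
by rewrite rep_act_linearr tensorDr tensorZr.
Qed.

Lemma tens_act3E V W X (r : tens (tens A A) A) (v : V) (y : W) (x : X) :
  tens_act3 r (v *t y *t x) =
  \sw3_(a, b, c <- r) (rep_act a v *t rep_act b y *t rep_act c x).
Proof.
apply: eq_tens_sum => p c.
rewrite tens_sum_tensor; last first.
  split=> [x'|q] a z z' /=.
    by rewrite tens_act_linearr tensorDl tensorZl.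
  by rewrite rep_act_linearr tensorDr tensorZr.
rewrite (lin_expand2 p (F := fun p => tens_act p (v *t y) *t rep_act c x)).
  by apply: eq_tens_sum => a b; rewrite tens_actE.
by move=> a z z'; rewrite tens_act_linearl tensorDl tensorZl.
Qed.

Local Notation S := (qh_antipode Q).

Lemma rep_ev_bilinear V :
  bilinear2 (fun (g : rep_dual Q V) (v : V) => (g : 'Hom(V, k^o)) (rep_act (qh_alpha Q) v) : k^o).
Proof.
split=> [v|g] a x y /=; first by rewrite add_lfunE scale_lfunE.
by rewrite rep_act_linearr linearP.
Qed.

Lemma rep_ev_linear V : linear (@rep_ev _ _ Q V).
Proof. exact: lift2_linear (rep_ev_bilinear V). Qed.

Lemma rep_evE V (g : rep_dual Q V) (v : V) :
  rep_ev (g *t v) = (g : 'Hom(V, k^o)) (rep_act (qh_alpha Q) v).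
Proof. exact: lift2E (rep_ev_bilinear V) g v. Qed.

Lemma rep_lunit_bilinear V : bilinear2 (fun (c : k^o) (v : V) => (c : k) *: v).
Proof.
split=> [v|c] a x y /=; first by rewrite scalerDl scalerA.
by rewrite scalerDr !scalerA mulrC.
Qed.

Lemma rep_lunit_linear V : linear (@rep_lunit _ _ V).
Proof. exact: lift2_linear (rep_lunit_bilinear V). Qed.

Lemma rep_lunitE V (c : k^o) (v : V) : rep_lunit (c *t v) = (c : k) *: v.
Proof. exact: lift2E (rep_lunit_bilinear V) c v. Qed.

(** Expanding S(x3) v in the basis contracts the dual bases of the coevaluation, and [antipode_phi]
    removes what remains: the categorical dual of a morphism is its plain transpose. *)
Lemma rep_dual_morphismE V W (f : V -> W) (g : rep_dual Q W) (v : V) :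
  is_rep_morphism f ->
  (rep_dual_morphism f g : 'Hom(V, k^o)) v = (g : 'Hom(W, k^o)) (f v).
Proof.
move=> [lf fa].
pose F t : rep_dual Q V :=
  rep_lunit (tmap (@rep_ev _ _ Q W) id (tmap (tmap id f) (@id (rep_dual Q V)) t)).
have lmf : linear (tmap (@id (rep_dual Q W)) f) by exact: tmap_linear.
have lF : linear F.
  apply: (linear_comp (@rep_lunit_linear (rep_dual Q V))).
  apply: linear_comp; first exact: tmap_linear (@rep_ev_linear W) (@linear_id _ _).
  exact: tmap_linear.
have FE h (y : V) (c : rep_dual Q V) :
    F (h *t y *t c) = ((h : 'Hom(W, k^o)) (rep_act (qh_alpha Q) (f y)) : k) *: c.
  rewrite /F (tmapE lmf (@linear_id _ _)) (tmapE (@linear_id _ _) lf).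
  by rewrite (tmapE (@rep_ev_linear W) (@linear_id _ _)) rep_lunitE rep_evE.
pose G (t : tens V (rep_dual Q V)) := F (rep_assoc_inv Q (g *t t)).
have lG : linear G.
  move=> a x y; rewrite /G /rep_assoc_inv tensorDr tensorZr.
  by rewrite (@tassoc_linear _ _ _ _ a) tens_act3_linear lF.
pose b (j : 'I_(\dim {:V})) : V := (vbasis {:V})`_j.
pose c (j : 'I_(\dim {:V})) : rep_dual Q V := linfun (coord (vbasis {:V}) j : V -> k^o).
transitivity ((G (\sum_j (rep_act (qh_beta Q) (b j) *t c j)) : 'Hom(V, k^o)) v).
  by rewrite /rep_dual_morphism /rep_coev scale1r.
have lE : linear (fun h : rep_dual Q V => (h : 'Hom(V, k^o)) v).
  by move=> a x y; rewrite add_lfunE scale_lfunE.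
rewrite (linear_for_sum lG) (linear_for_sum lE).
pose K (j : 'I_(\dim {:V})) x1 x2 x3 : k^o :=
  (g : 'Hom(W, k^o)) (f (rep_act (S x1 * qh_alpha Q * x2 * qh_beta Q) (b j))) *
  coord (vbasis {:V}) j (rep_act (S x3) v).
transitivity (\sum_j \sw3_(x1, x2, x3 <- inverse (qh_reassoc Q)) K j x1 x2 x3).
  apply: eq_bigr => j _; rewrite /G /rep_assoc_inv tassocE tens_act3E.
  rewrite (lin_tens_sum lF) (lin_tens_sum lE); apply: (@eq_tens_sum k _ _ k^o) => p x3.
  rewrite (lin_tens_sum lF) (lin_tens_sum lE); apply: (@eq_tens_sum k _ _ k^o) => x1 x2.
  rewrite FE scale_lfunE /K; congr (_ * _).
    by rewrite [_ (rep_act _ _)]dual_actE !fa -!rep_actM.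
  rewrite [LHS]dual_actE lfunE; by [].
have lA : linear (fun y => (g : 'Hom(W, k^o)) (f (rep_act y v))).
  by move=> a x y; rewrite rep_act_linearl lf linearP.
transitivity ((g : 'Hom(W, k^o)) (f (rep_act (\sw3_(x1, x2, x3 <- inverse (qh_reassoc Q))
   (S x1 * qh_alpha Q * x2 * qh_beta Q * S x3)) v))); last by rewrite antipode_phi rep_act1.
rewrite [RHS](lin_tens_sum lA) [LHS](@sum_tens_exchange k _ _ k^o); apply: (@eq_tens_sum k _ _ k^o) => p x3.
rewrite [RHS](lin_tens_sum lA) [LHS](@sum_tens_exchange k _ _ k^o); apply: (@eq_tens_sum k _ _ k^o) => x1 x2.
rewrite /K rep_actM; set y := S x1 * _ * _ * _.
rewrite {2}(coord_vbasis (memvf (rep_act (S x3) v))).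
have lB : linear (fun z : V => (g : 'Hom(W, k^o)) (f (rep_act y z)) : k^o).
  by move=> a z z'; rewrite rep_act_linearr lf linearP.
rewrite [RHS](linear_for_sum lB); apply: eq_bigr => j _.
by rewrite (linear_forZ lB) mulrC.
Qed.

End Representations.

(** * Ribbon twists from central elements *)

Section Ribbon.
Variables (k : fieldType) (A : pzAlgType k) (Q : quasi_hopf A) (R : tens A A).
Variables t : A.
Hypotheses (ti : invertible t) (tC : central t).
Hypothesis Dt : qh_comul Q t = (t *t t) * (tswap R * R).
Hypothesis St : qh_antipode Q t = t.

(** Centrality makes the action of [t] a natural morphism, [Dt] is the compatibility with the double
    braiding, and [St] the one with duals, since the dual morphism is a transpose. *)
Lemma ribbon_twist_central : ribbon_twist Q R (fun V v => @rep_act _ _ V t v).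
Proof.
have [tV Vt] := invertibleW ti.
have mor (V : rep A) : is_rep_morphism (@rep_act _ _ V t).
  split; first exact: rep_act_linearr.
  by move=> a v; rewrite -!rep_actM tC.
split.
- move=> V; split=> //; exists (@rep_act _ _ V (inverse t)) => v.
    by rewrite -rep_actM Vt rep_act1.
  by rewrite -rep_actM tV rep_act1.
- by move=> V W f [_ fa] v; rewrite fa.
- move=> V W x; rewrite double_braiding -tens_act_tensor -tens_actM -Dt.
  by [].
move=> V g; apply/lfunP => v; rewrite rep_dual_morphismE //.
by rewrite [LHS]dual_actE St.
Qed.

End Ribbon.

(** * The quasi-Hopf structure on H(theta) *)

Section Quadratic.
Variables (k : fieldType) (H A : pzAlgType k) (i : H -> A) (theta : A) (w : H).
Hypotheses (im : algmor i) (thetaC : central theta) (theta2 : theta * theta = i w).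
Hypothesis quad_decomp : forall x, exists ab : H * H, x = i ab.1 + i ab.2 * theta.
Hypothesis quad_uniq : forall a b a' b',
  i a + i b * theta = i a' + i b' * theta -> a = a' /\ b = b'.

Let li := algmor_lin im.

(** Freeness on 1 and theta is abstracted from the polynomial construction: the coordinates are
    picked by choice, and [quad_uniq] computes them. *)
Definition quad_coord (x : A) : H * H := sval (cid (quad_decomp x)).

Lemma quad_coordP x : x = i (quad_coord x).1 + i (quad_coord x).2 * theta.
Proof. exact: svalP (cid (quad_decomp x)). Qed.

Lemma quad_coordE a b : quad_coord (i a + i b * theta) = (a, b).
Proof.
have := quad_coordP (i a + i b * theta); case: (quad_coord _) => c d /=.
by move=> /quad_uniq[-> ->].
Qed.

Lemma quad_ind (P : A -> Prop) :
  (forall a b, P (i a + i b * theta)) -> forall x, P x.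
Proof. by move=> h x; rewrite (quad_coordP x). Qed.

Lemma quad_linE a (x x' y y' : H) :
  a *: (i x + i x' * theta) + (i y + i y' * theta) =
  i (a *: x + y) + i (a *: x' + y') * theta.
Proof. by rewrite !li mulrDl -pzscalerAl scalerDr addrACA. Qed.

Lemma quad_mulE (x x' y y' : H) :
  (i x + i x' * theta) * (i y + i y' * theta) =
  i (x * y + x' * y' * w) + i (x * y' + x' * y) * theta.
Proof.
have iM := algmorM im; have iD := linear_forD li.
rewrite !(mulrDl, mulrDr, iD, iM) -!addrA; congr (_ + _).
rewrite -(mulrA (i x') theta (i y)) thetaC !mulrA.
rewrite -(mulrA (i x') theta (i y')) thetaC !mulrA.
rewrite -(mulrA _ theta theta) theta2.
by rewrite [LHS]addrA [LHS]addrC.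
Qed.

Section Lift.
Variables (V : lmodType k) (f g : H -> V).

Definition quad_lift (x : A) : V := f (quad_coord x).1 + g (quad_coord x).2.

Lemma quad_liftE a b : quad_lift (i a + i b * theta) = f a + g b.
Proof. by rewrite /quad_lift quad_coordE. Qed.

Hypotheses (lf : linear f) (lg : linear g).

Lemma quad_lift_in a : quad_lift (i a) = f a.
Proof.
rewrite -[i a]addr0 -(mul0r theta) -(linear_for0 li) quad_liftE.
by rewrite (linear_for0 lg) addr0.
Qed.

Lemma quad_lift_theta : quad_lift theta = g 1.
Proof.
rewrite -[theta]add0r -(linear_for0 li) -[X in _ + X]mul1r.
rewrite -(algmor1 im) quad_liftE.
by rewrite (linear_for0 lf) add0r.
Qed.

Lemma quad_lift_linear : linear quad_lift.
Proof.
move=> a; elim/quad_ind => x x'; elim/quad_ind => y y'.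
by rewrite quad_linE !quad_liftE lf lg scalerDr addrACA.
Qed.

End Lift.

Lemma quad_lin_ext (V : lmodType k) (F G : A -> V) : linear F -> linear G ->
  (forall a, F (i a) = G (i a)) -> (forall a, F (i a * theta) = G (i a * theta)) ->
  forall x, F x = G x.
Proof.
move=> lF lG e e'; elim/quad_ind => a b.
by rewrite (linear_forD lF) (linear_forD lG) e e'.
Qed.

Lemma quad_algmor_ext (B : pzAlgType k) (F G : A -> B) : algmor F -> algmor G ->
  (forall a, F (i a) = G (i a)) -> F theta = G theta -> forall x, F x = G x.
Proof.
move=> mF mG e e'; apply: quad_lin_ext => //; try exact: algmor_lin.
by move=> a; rewrite (algmorM mF) (algmorM mG) e e'.
Qed.

(** The universal property of H(theta): [z] is an admissible image of theta when it commutes with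
    the image of [f] and squares to f(w). *)
Lemma quad_lift_algmor (B : pzAlgType k) (f : H -> B) (z : B) : algmor f ->
  (forall h, z * f h = f h * z) -> z * z = f w ->
  algmor (quad_lift f (fun h => f h * z)).
Proof.
move=> mf zf zz; have lf := algmor_lin mf; have fM := algmorM mf.
have lg : linear (fun h => f h * z) by move=> a x y; rewrite lf mulrDl -pzscalerAl.
split; first exact: quad_lift_linear.
split; first by rewrite -(algmor1 im) quad_lift_in // algmor1.
elim/quad_ind => x x'; elim/quad_ind => y y'.
rewrite quad_mulE !quad_liftE !(linear_forD lf) !fM.
rewrite !(mulrDl, mulrDr) -zz -!addrA; congr (_ + _).
rewrite -(mulrA (f x') z (f y)) zf !mulrA -(mulrA (f x') z (f y')) zf !mulrA.
by rewrite [LHS]addrC -[LHS]addrA.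
Qed.

Section Extension.
Variables (Q : quasi_hopf H) (R : tens H H) (hR : quasitriangular Q R).
Hypothesis wE : w = qt_w Q R.
Local Notation Delta := (qh_comul Q).
Local Notation eps := (qh_counit Q).
Local Notation S := (qh_antipode Q).
Local Notation alpha := (qh_alpha Q).
Local Notation beta := (qh_beta Q).
Local Notation M := (monodromy R).
Local Notation Phi0 := (qh_reassoc Q).
Local Notation i2 := (tmap i i).
Local Notation i3 := (tmap i2 i).

Let wC h : w * h = h * w. Proof. by rewrite wE; exact: qt_w_central. Qed.
Let i2m : algmor i2. Proof. exact: tmap_algmor. Qed.
Let li2 := algmor_lin i2m.
Let i3m : algmor i3. Proof. exact: tmap_algmor. Qed.
Let li3 := algmor_lin i3m.
Let mD := comul_algmor Q.

Lemma quad_inverse_monodromy :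
  inverse (tswap (i2 R) * i2 R) = i2 (inverse M).
Proof.
rewrite tmap_tswap // -(algmorM i2m).
by have [_ ->] := algmor_inverse i2m (monodromy_invertible hR).
Qed.

Definition theta_comul : tens A A := (theta *t theta) * i2 (inverse M).
Local Notation Z := theta_comul.

Let ttC : central (theta *t theta : tens A A).
Proof. exact: tensor_central. Qed.

Let Z_comm h : Z * i2 (Delta h) = i2 (Delta h) * Z.
Proof.
rewrite /Z -mulrA -(algmorM i2m) (inverse_monodromy_comul hR) (algmorM i2m).
by rewrite [LHS]mulrA (ttC (i2 (Delta h))) -mulrA.
Qed.

(** Here Delta(w) M^2 = w (x) w enters: it makes [theta_comul] an admissible image of theta. *)
Let Z_sq : Z * Z = i2 (Delta w).
Proof.
have -> : Delta w = (w *t w) * (inverse M * inverse M) by rewrite wE comul_qt_wE.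
rewrite !(algmorM i2m) /Z -mulrA (mulrA _ _ (i2 _)).
rewrite -ttC !mulrA tensM theta2 -[LHS]mulrA -[RHS]mulrA; congr (_ * _).
by rewrite (tmapE li li).
Qed.

Definition quad_comul : A -> tens A A :=
  quad_lift (i2 \o Delta) (fun h => i2 (Delta h) * Z).
Definition quad_counit : A -> k :=
  quad_lift (eps : H -> k^o) (eps : H -> k^o).
Definition quad_antipode : A -> A :=
  quad_lift (i \o S) (fun h => i (S h) * theta).

Definition quad_data : quasi_hopf_data A :=
  QuasiHopfData quad_comul quad_counit (i3 (qh_reassoc Q)) quad_antipode
    (i (qh_alpha Q)) (i (qh_beta Q)).

Local Notation Delta' := quad_comul.
Local Notation eps' := quad_counit.
Local Notation S' := quad_antipode.
Local Notation D' := quad_data.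

Let i2Dm : algmor (i2 \o Delta : H -> tens A A).
Proof. exact: algmor_comp. Qed.

Lemma quad_comul_algmor : algmor Delta'.
Proof. exact: (quad_lift_algmor i2Dm Z_comm Z_sq). Qed.
Let mD' := quad_comul_algmor.

Lemma quad_comul_in h : Delta' (i h) = i2 (Delta h).
Proof.
apply: quad_lift_in.
exact: (linear_comp (mulr_linearr Z) (algmor_lin i2Dm)).
Qed.

Lemma quad_comul_theta : Delta' theta = Z.
Proof.
rewrite /quad_comul quad_lift_theta; last exact: (algmor_lin i2Dm).
by rewrite (algmor1 mD) (algmor1 i2m) mul1r.
Qed.

Let leps : linear (eps : H -> k^o). Proof. exact: counit_scalar. Qed.

Lemma quad_counit_linear : linear (eps' : A -> k^o).
Proof. exact: (quad_lift_linear leps leps). Qed.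

Lemma quad_counit_in h : eps' (i h) = eps h.
Proof. exact: (@quad_lift_in k^o eps eps leps h). Qed.

Lemma quad_counit_theta : eps' theta = 1.
Proof.
transitivity (eps 1); last exact: counit1.
exact: (@quad_lift_theta k^o eps eps leps).
Qed.

Lemma quad_counit1 : eps' 1 = 1.
Proof. by rewrite -(algmor1 im) quad_counit_in counit1. Qed.

(** The product of the theta parts produces a factor w, so this comes down to eps(w) = 1. *)
Lemma quad_counitM x y : eps' (x * y) = eps' x * eps' y.
Proof.
move: x y; elim/quad_ind => x x'; elim/quad_ind => y y'.
rewrite quad_mulE /quad_counit !quad_liftE !(linear_forD leps).
rewrite !(counitM Q : {morph eps : x y / x * y}).
have -> : eps w = 1 by rewrite wE counit_qt_w.
by ring.
Qed.

Let lSi : linear (i \o S). Proof. exact: linear_comp li (antipode_linear Q). Qed.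
Let lSit : linear (fun h => i (S h) * theta).
Proof. by move=> a x y; rewrite (antipode_linear Q) li mulrDl -pzscalerAl. Qed.

Lemma quad_antipode_in h : S' (i h) = i (S h).
Proof. exact: quad_lift_in. Qed.

Lemma quad_antipode_theta : S' theta = theta.
Proof.
by rewrite /quad_antipode quad_lift_theta // antipode1 (algmor1 im) mul1r.
Qed.

Lemma quad_antipode_linear : linear S'.
Proof. exact: quad_lift_linear. Qed.

Lemma quad_antipode1 : S' 1 = 1.
Proof. by rewrite -(algmor1 im) quad_antipode_in antipode1. Qed.

(** The product of the theta parts comes down to S(w) = w, and centrality of w restores the
    order. *)
Lemma quad_antipodeM x y : S' (x * y) = S' y * S' x.
Proof.
move: x y; elim/quad_ind => x x'; elim/quad_ind => y y'.
rewrite quad_mulE /quad_antipode !quad_liftE /= quad_mulE.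
have lS := antipode_linear Q; have SM := antipodeM Q.
rewrite !(linear_forD lS).
have Sw : S w = w by rewrite wE qt_wS.
have e : S (x' * y' * w) = S y' * S x' * w by rewrite (SM _ w) Sw wC (SM x').
by rewrite e (SM x y) (SM x y') (SM x' y) [S y' * _ + _]addrC.
Qed.
Local Opaque quad_comul quad_counit quad_antipode.

Let lD' := algmor_lin mD'.
Let leps' : linear (eps' : A -> k^o) := quad_counit_linear.
Let lS' : linear S' := quad_antipode_linear.

Lemma quad_reassoc_inverse :
  invertible (i3 Phi0) /\ inverse (i3 Phi0) = i3 (inverse Phi0).
Proof. exact: algmor_inverse i3m (reassoc_invertible Q). Qed.

Lemma quad_assoc_comul_in (t : tens H H) :
  tassoc (tmap id Delta' (i2 t)) = i3 (tassoc (tmap id Delta t)).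
Proof.
rewrite tmap_comp //; try legs.
have -> : Delta' \o i = i2 \o Delta by apply/funext => h; exact: quad_comul_in.
have lD := algmor_lin mD.
by rewrite -(tmap_tassoc _ li li li) tmap_comp; legs.
Qed.

Lemma quad_comul_assoc_in (t : tens H H) :
  tmap Delta' id (i2 t) = i3 (tmap Delta id t).
Proof.
have lD := algmor_lin mD.
rewrite !tmap_comp //; try legs.
by have -> : Delta' \o i = i2 \o Delta by apply/funext => h; exact: quad_comul_in.
Qed.

Section Theta.
Variables (B : pzAlgType k) (p q r : A -> B).
Hypotheses (mp : algmor p) (mq : algmor q) (mr : algmor r).
Hypotheses (pq : commuting p q) (pr : commuting p r) (qr : commuting q r).

Lemma tmul_theta_comul : tmul p q Z = p theta * q theta * tmul (p \o i) (q \o i) (inverse M).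
Proof.
rewrite /theta_comul (algmorM (tmul_algmor mp mq pq)) tmulE ?tmul_tmap //; try legs.
Qed.

Lemma quad_cab_in h : cab D' p q (i h) = cab Q (p \o i) (q \o i) h.
Proof.
transitivity (tmul p q (Delta' (i h))); first by [].
by rewrite quad_comul_in // tmul_tmap //; legs.
Qed.

Lemma quad_cab_theta :
  cab D' p q theta = p theta * q theta * tmul (p \o i) (q \o i) (inverse M).
Proof.
transitivity (tmul p q (Delta' theta)); first by [].
by rewrite quad_comul_theta // tmul_theta_comul.
Qed.

End Theta.

(** Conjugation by the reassociator is an algebra map, so it suffices to compare the two sides on H
    and at theta. *)
Lemma quad_coassoc h :
  tassoc (tmap id Delta' (Delta' h)) =
  i3 Phi0 * tmap Delta' id (Delta' h) * inverse (i3 Phi0).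
Proof.
have [ivP ivE] := quad_reassoc_inverse; have [PV VP] := invertibleW ivP.
move: h; apply: (quad_algmor_ext (F := fun h => tassoc (tmap id Delta' (Delta' h)))
  (G := fun h => i3 Phi0 * tmap Delta' id (Delta' h) * inverse (i3 Phi0))).
- apply: (algmor_comp (tassoc_algmor _ _ _)); apply: (algmor_comp _ mD').
  exact: tmap_algmor.
- apply: (algmor_comp (conj_algmor PV VP)); apply: (algmor_comp _ mD').
  exact: tmap_algmor.
- move=> a; rewrite quad_comul_in // quad_assoc_comul_in quad_comul_assoc_in.
  rewrite ivE -!(algmorM i3m).
  by have [[_ _ _ [-> _ _ _]] _ _ _ _] := qh_axioms Q.
(* At theta both sides carry the same central factor, one theta in each strand; what is left is
   [full_twist_inverse]. *)
have m1 := @leg1_algmor k A; have m2 := @leg2_algmor k A; have m3 := @leg3_algmor k A.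
have c12 := @leg12 k A; have c13 := @leg13 k A; have c23 := @leg23 k A.
have l1 := algmor_lin m1; have l2 := algmor_lin m2; have l3 := algmor_lin m3.
have mq23 : algmor (cab D' (@leg2 k A) leg3) by exact: cab_algmor.
have mq12 : algmor (cab D' (@leg1 k A) leg2) by exact: cab_algmor.
have c123 : commuting (cab D' (@leg1 k A) leg2) leg3 by exact: commuting_cabl.
have c123' : commuting leg1 (cab D' (@leg2 k A) leg3) by exact: commuting_cabr.
have C1 : central (leg1 theta) by apply/tensl_central/tensl_central.
have C2 : central (leg2 theta) by apply/tensl_central/tensr_central.
have C3 : central (leg3 theta) by apply/tensr_central.
rewrite quad_comul_theta //.
have -> : tassoc (tmap id Delta' Z) = tmul leg1 (cab D' leg2 leg3) Z.
  rewrite -[LHS]tmul_legs tmul_assoc ?tmul_tmap //; try legs.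
have -> : tmap Delta' id Z = tmul (cab D' leg1 leg2) leg3 Z.
  rewrite -[LHS]tmul_legs tmul_tmap //; try legs.
rewrite !tmul_theta_comul // !quad_cab_theta //.
have -> : cab D' leg2 leg3 \o i = cab Q (leg2 \o i) (leg3 \o i).
  by apply/funext => h; exact: quad_cab_in.
have -> : cab D' leg1 leg2 \o i = cab Q (leg1 \o i) (leg2 \o i).
  by apply/funext => h; exact: quad_cab_in.
have mi1 : algmor (leg1 \o i) by exact: algmor_comp.
have mi2 : algmor (leg2 \o i) by exact: algmor_comp.
have mi3 : algmor (leg3 \o i) by exact: algmor_comp.
have d12 : commuting (leg1 \o i) (leg2 \o i) by move=> x y; exact: c12.
have d13 : commuting (leg1 \o i) (leg3 \o i) by move=> x y; exact: c13.
have d23 : commuting (leg2 \o i) (leg3 \o i) by move=> x y; exact: c23.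
have FT := full_twist_inverse hR mi1 mi2 mi3 d12 d13 d23.
have eP t : i3 t = tmul3 (leg1 \o i) (leg2 \o i) (leg3 \o i) t.
  rewrite -[LHS]tmul_legs tmul_tmap //; try legs.
  by congr (tmul _ _ _); apply/funext => s /=; rewrite tmul_tmap; legs.
rewrite ivE !eP -/(Phi Q _ _ _) -/(phi Q _ _ _).
transitivity (leg1 theta * leg2 theta * leg3 theta *
  (tmul (leg2 \o i) (leg3 \o i) (inverse M) *
   tmul (leg1 \o i) (cab Q (leg2 \o i) (leg3 \o i)) (inverse M))).
  by rewrite !mulrA.
rewrite FT.
set P := Phi _ _ _ _; set X := tmul _ _ _; set Y := tmul _ _ _; set P' := phi _ _ _ _.
rewrite -[in RHS](mulrA (leg1 theta * leg2 theta)) -(C3 X) !mulrA.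
by rewrite -(C1 P) -!mulrA !(mulrA P) -(C2 P) -!mulrA !(mulrA P) -(C3 P) -!mulrA.
Qed.

Lemma quad_uleg_algmor : algmor (uleg D' A).
Proof.
split=> [a x y|]; first by rewrite /uleg [qh_counit _ _]leps' scalerDl scalerA.
split=> [|x y].
  by rewrite /uleg [qh_counit _ _]quad_counit1 scale1r.
by rewrite /uleg [qh_counit _ _]quad_counitM -pzscalerAl mul1r scalerA.
Qed.

Lemma quad_counitr h : \sw2_(h1, h2 <- Delta' h) (eps' h2 *: h1) = h.
Proof.
have mu := quad_uleg_algmor; have lu := algmor_lin mu.
have c : commuting (@id A) (uleg D' A) by exact: commuting_ulegr.
transitivity (tmul id (uleg D' A) (Delta' h)).
  by apply: eq_tens_sum => x y; rewrite /uleg -pzscalerAr mulr1.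
have e : uleg D' A \o i = i \o uleg Q H.
  apply/funext => x; rewrite /= /uleg (linear_forZ li) (algmor1 im).
  by rewrite [qh_counit _ _]quad_counit_in.
have m := tmul_algmor (@algmor_id _ A) mu c.
have E t : tmul id (uleg D' A) (i2 t) = i (tmul id (uleg Q H) t).
  rewrite tmul_tmap // e [RHS](lin_tens_sum li).
  by apply: eq_tens_sum => x y; rewrite (algmorM im).
move: h; apply: (quad_algmor_ext (F := tmul id (uleg D' A) \o Delta') (G := id)) => //.
- exact: algmor_comp.
- move=> a /=; rewrite quad_comul_in E; congr i.
  exact: (congr1 (fun f => f a) (cab_uleg Q (@linear_id _ H))).
rewrite /= quad_comul_theta (algmorM m) E tmulE //.
rewrite (tmul_uleg_inverse_monodromy hR).1 (algmor1 im) mulr1.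
by rewrite /uleg [qh_counit _ _]quad_counit_theta scale1r mulr1.
Qed.

Lemma quad_counitl h : \sw2_(h1, h2 <- Delta' h) (eps' h1 *: h2) = h.
Proof.
have mu := quad_uleg_algmor; have lu := algmor_lin mu.
have c : commuting (uleg D' A) (@id A) by exact: commuting_ulegl.
transitivity (tmul (uleg D' A) id (Delta' h)).
  by apply: eq_tens_sum => x y; rewrite /uleg -pzscalerAl mul1r.
have e : uleg D' A \o i = i \o uleg Q H.
  apply/funext => x; rewrite /= /uleg (linear_forZ li) (algmor1 im).
  by rewrite [qh_counit _ _]quad_counit_in.
have m := tmul_algmor mu (@algmor_id _ A) c.
have E t : tmul (uleg D' A) id (i2 t) = i (tmul (uleg Q H) id t).
  rewrite tmul_tmap // e [RHS](lin_tens_sum li).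
  by apply: eq_tens_sum => x y; rewrite (algmorM im).
move: h; apply: (quad_algmor_ext (F := tmul (uleg D' A) id \o Delta') (G := id)) => //.
- exact: algmor_comp.
- move=> a /=; rewrite quad_comul_in E; congr i.
  exact: (congr1 (fun f => f a) (uleg_cab Q (@linear_id _ H))).
rewrite /= quad_comul_theta (algmorM m) E tmulE //.
rewrite (tmul_uleg_inverse_monodromy hR).2 (algmor1 im) mulr1.
by rewrite /uleg [qh_counit _ _]quad_counit_theta scale1r mul1r.
Qed.

(** [Delta'] is only applied to the image of H here, so this is the pentagon of H under the fourth
    tensor power of [i]. *)
Lemma quad_pentagon :
  tmap tassoc id (tassoc ((1 : A) *t i3 Phi0)) *
  tmap (fun t => tassoc (tmap id Delta' t)) id (i3 Phi0) * (i3 Phi0 *t (1 : A)) =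
  tassoc (tmap id Delta' (i3 Phi0)) * tmap (tmap Delta' id) id (i3 Phi0).
Proof.
have i4m : algmor (tmap i3 i) by exact: tmap_algmor.
have lD := algmor_lin mD.
have lA (C : pzAlgType k) : linear (@tassoc k C C C) by exact: tassoc_linear.
have lT : linear (fun t : tens H H => tassoc (tmap id Delta t)).
  by apply: (linear_comp (lA _)); legs.
have lT' : linear (fun t : tens A A => tassoc (tmap id Delta' t)).
  by apply: (linear_comp (lA _)); legs.
have [[_ _ _ [_ _ e _]] _ _ _ _] := qh_axioms Q.
move: (congr1 (tmap i3 i) e); rewrite !(algmorM i4m).
have -> : tmap i3 i (tmap tassoc id (tassoc ((1 : H) *t Phi0))) =
          tmap tassoc id (tassoc ((1 : A) *t i3 Phi0)).
  rewrite tmap_comp //; try legs.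
  have -> : i3 \o tassoc = tassoc \o tmap i i2.
    by apply/funext => t; rewrite /= tmap_tassoc.
  have -> : (1 : A) *t i3 Phi0 = tmap i i3 ((1 : H) *t Phi0).
    by rewrite tmapE // (algmor1 im).
  rewrite tmap_tassoc // tmap_comp //; try legs.
have -> : tmap i3 i (tmap (fun t => tassoc (tmap id Delta t)) id Phi0) =
          tmap (fun t => tassoc (tmap id Delta' t)) id (i3 Phi0).
  rewrite !tmap_comp //; try legs.
  congr (tmap _ _ _); apply/funext => t.
  by rewrite /= quad_assoc_comul_in.
have -> : tmap i3 i (Phi0 *t (1 : H)) = i3 Phi0 *t (1 : A).
  by rewrite tmapE // (algmor1 im).
have -> : tmap i3 i (tassoc (tmap id Delta Phi0)) = tassoc (tmap id Delta' (i3 Phi0)).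
  rewrite -tmap_tassoc // !tmap_comp //; try legs.
  congr (tassoc (tmap _ _ _)); apply/funext => t.
  by rewrite /= quad_comul_in.
have -> : tmap i3 i (tmap (tmap Delta id) id Phi0) = tmap (tmap Delta' id) id (i3 Phi0).
  rewrite !tmap_comp //; try legs.
  congr (tmap _ _ _); apply/funext => t.
  by rewrite /= quad_comul_assoc_in.
by [].
Qed.

Lemma quad_reassoc_counit :
  \sw3_(X1, X2, X3 <- i3 Phi0) (eps' X2 *: (X1 *t X3)) = 1.
Proof.
pose g (x y z : A) := eps' y *: (x *t z).
have tg : trilinear g.
  repeat split; intros; move=> ? ? ? /=; rewrite /g.
  - by rewrite tensorDl tensorZl scalerDr !scalerA mulrC.
  - by rewrite leps' scalerDl scalerA.
  by rewrite tensorDr tensorZr scalerDr !scalerA mulrC.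
rewrite -[LHS]/(lift3 g (i3 Phi0)) lift3_tmap //.
have [[_ _ _ [_ _ _ e]] _ _ _ _] := qh_axioms Q.
rewrite -(algmor1 i2m) -[X in i2 X]e.
rewrite [RHS](lin_tens_sum li2); apply: eq_tens_sum => t z.
rewrite [RHS](lin_tens_sum li2); apply: eq_tens_sum => x y.
by rewrite /g (linear_forZ li2) tmapE // quad_counit_in.
Qed.

(** The sum is not multiplicative in [h], so it is compared on [i a] and on [i a * theta]. For theta
    alone ([GZ]) the two copies of theta combine to w, and [antipode_inverse_monodromy] gives
    alpha. *)
Lemma quad_antipode_alpha h :
  \sw2_(h1, h2 <- Delta' h) (S' h1 * i alpha * h2) = eps' h *: i alpha.
Proof.
have SM' := quad_antipodeM.
pose g (a c : A) := S' a * i alpha * c.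
have bg : bilinear2 g.
  split=> [c|a]; last exact: mulr_linearl.
  exact: (linear_comp (mulr_linearr c) (linear_comp (mulr_linearr _) lS')).
have lG := lift2_linear bg.
have GM t a c : lift2 g (t * (a *t c)) = S' a * lift2 g t * c.
  rewrite (lin_expand2 t (F := fun t => lift2 g (t * _))); last first.
    exact: (linear_comp lG (mulr_linearr _)).
  rewrite /lift2 tens_sum_mulr tens_sum_mull; apply: eq_tens_sum => x y.
  by rewrite tensM [LHS]lift2E // /g SM' !mulrA.
have Gi t : lift2 g (i2 t) = i (lift2 (fun a c : H => S a * alpha * c) t).
  rewrite lift2_tmap // [RHS](lin_tens_sum li); apply: eq_tens_sum => x y.
  by rewrite /g quad_antipode_in // !(algmorM im).
have GZ : lift2 g Z = i alpha.
  rewrite -[in RHS](antipode_inverse_monodromy hR) -wE (algmorM im) -Gi -theta2.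
  rewrite /theta_comul; move: (i2 _); apply: tens_lin_ext.
  - exact: (linear_comp lG (mulr_linearl _)).
  - exact: (linear_comp (mulr_linearl _) lG).
  move=> x y; rewrite tensM !lift2E // /g SM' quad_antipode_theta //.
  rewrite -(thetaC (S' x)) -(mulrA theta (S' x)) mulrA.
  by rewrite -(mulrA theta _ theta) -(thetaC (S' x * i alpha)) !mulrA.
transitivity (lift2 g (Delta' h)); first by [].
move: h; apply: quad_lin_ext.
- exact: (linear_comp lG lD').
- by move=> a x y; rewrite leps' scalerDl scalerA.
- move=> a; rewrite quad_comul_in // Gi quad_counit_in // -(linear_forZ li).
  by rewrite -antipode_alpha.
(* theta is put first, so that its coproduct stands next to alpha and [GM] peels off [Delta a] from
   the outside. For beta it stays last. *)
move=> a; rewrite -thetaC (algmorM mD') quad_comul_in // quad_comul_theta //.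
rewrite quad_counitM quad_counit_theta // mul1r quad_counit_in //.
rewrite -(linear_forZ li) -antipode_alpha (lin_tens_sum li).
rewrite (lin_expand2 (Delta a) (F := fun t => lift2 g (Z * i2 t))); last first.
  exact: (linear_comp lG (linear_comp (mulr_linearl _) li2)).
apply: eq_tens_sum => x y.
by rewrite (tmapE li li) GM GZ quad_antipode_in // -!(algmorM im).
Qed.

Lemma quad_antipode_beta h :
  \sw2_(h1, h2 <- Delta' h) (h1 * i beta * S' h2) = eps' h *: i beta.
Proof.
have SM' := quad_antipodeM.
pose g (a c : A) := a * i beta * S' c.
have bg : bilinear2 g.
  split=> [c|a]; last exact: (linear_comp (mulr_linearl _) lS').
  exact: (linear_comp (mulr_linearr _) (mulr_linearr _)).
have lG := lift2_linear bg.
have GM t a c : lift2 g (a *t c * t) = a * lift2 g t * S' c.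
  rewrite (lin_expand2 t (F := fun t => lift2 g (_ * t))); last first.
    exact: (linear_comp lG (mulr_linearl _)).
  rewrite /lift2 tens_sum_mulr tens_sum_mull; apply: eq_tens_sum => x y.
  by rewrite tensM [LHS]lift2E // /g SM' !mulrA.
have Gi t : lift2 g (i2 t) = i (lift2 (fun a c : H => a * beta * S c) t).
  rewrite lift2_tmap // [RHS](lin_tens_sum li); apply: eq_tens_sum => x y.
  by rewrite /g quad_antipode_in // !(algmorM im).
have GZ : lift2 g Z = i beta.
  rewrite -[in RHS](antipode_inverse_monodromy_beta hR) -wE (algmorM im) -Gi -theta2.
  rewrite /theta_comul; move: (i2 _); apply: tens_lin_ext.
  - exact: (linear_comp lG (mulr_linearl _)).
  - exact: (linear_comp (mulr_linearl _) lG).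
  move=> x y; rewrite tensM !lift2E // /g SM' quad_antipode_theta //.
  by rewrite !mulrA -(thetaC (_ * S' y)) !mulrA.
transitivity (lift2 g (Delta' h)); first by [].
move: h; apply: quad_lin_ext.
- exact: (linear_comp lG lD').
- by move=> a x y; rewrite leps' scalerDl scalerA.
- move=> a; rewrite quad_comul_in // Gi quad_counit_in // -(linear_forZ li).
  by rewrite -antipode_beta.
move=> a; rewrite (algmorM mD') quad_comul_in // quad_comul_theta //.
rewrite quad_counitM quad_counit_theta // mulr1 quad_counit_in //.
rewrite -(linear_forZ li) -antipode_beta (lin_tens_sum li).
rewrite (lin_expand2 (Delta a) (F := fun t => lift2 g (i2 t * Z))); last first.
  exact: (linear_comp lG (linear_comp (mulr_linearr _) li2)).
apply: eq_tens_sum => x y.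
by rewrite (tmapE li li) GM GZ quad_antipode_in // -!(algmorM im).
Qed.

Lemma quad_antipode_Phi :
  \sw3_(X1, X2, X3 <- i3 Phi0) (X1 * i beta * S' X2 * i alpha * X3) = 1.
Proof.
pose g (x y z : A) := x * i beta * S' y * i alpha * z.
have tg : trilinear g.
  split=> [c|a b]; last exact: mulr_linearl.
  split=> [b|a]; apply: (linear_comp (mulr_linearr c)); apply: (linear_comp (mulr_linearr _)).
    exact: (linear_comp (mulr_linearr _) (mulr_linearr _)).
  exact: (linear_comp (mulr_linearl _) lS').
rewrite -[LHS]/(lift3 g (i3 Phi0)) lift3_tmap //.
rewrite -(algmor1 im) -(antipode_Phi Q).
do 2 (rewrite [RHS](lin_tens_sum li); apply: eq_tens_sum => ? ?).
by rewrite /g quad_antipode_in // -!(algmorM im).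
Qed.

Lemma quad_antipode_phi :
  \sw3_(x1, x2, x3 <- inverse (i3 Phi0)) (S' x1 * i alpha * x2 * i beta * S' x3) = 1.
Proof.
rewrite quad_reassoc_inverse.2.
pose g (x y z : A) := S' x * i alpha * y * i beta * S' z.
have tg : trilinear g.
  split=> [c|a b]; last exact: (linear_comp (mulr_linearl _) lS').
  split=> [b|a]; apply: (linear_comp (mulr_linearr (S' c))); apply: (linear_comp (mulr_linearr _)).
    exact: (linear_comp (mulr_linearr _) (linear_comp (mulr_linearr _) lS')).
  exact: mulr_linearl.
rewrite -[LHS]/(lift3 g (i3 _)) lift3_tmap //.
rewrite -(algmor1 im) -(antipode_phi Q).
do 2 (rewrite [RHS](lin_tens_sum li); apply: eq_tens_sum => ? ?).
by rewrite /g !quad_antipode_in // -!(algmorM im).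
Qed.

Lemma quad_is_quasi_hopf : is_quasi_hopf D'.
Proof.
split.
- split; first exact: mD'.
  + split; first exact: leps'.
    by split; [exact: quad_counit1 | exact: quad_counitM].
  + exact: quad_reassoc_inverse.1.
  split; [exact: quad_coassoc | | exact: quad_pentagon | exact: quad_reassoc_counit].
  by move=> h; split; [exact: quad_counitr | exact: quad_counitl].
- by split; [exact: lS' | exact: quad_antipode1 | exact: quad_antipodeM].
- by move=> h; split; [exact: quad_antipode_alpha | exact: quad_antipode_beta].
- exact: quad_antipode_Phi.
exact: quad_antipode_phi.
Qed.

(** * Quasitriangularity and the inverse of theta *)

Section Hexagon.
Variables (B : pzAlgType k) (p q r : A -> B).
Hypotheses (mp : algmor p) (mq : algmor q) (mr : algmor r).

Lemma tmul3_quad_in t : tmul3 p q r (i3 t) = tmul3 (p \o i) (q \o i) (r \o i) t.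
Proof.
rewrite tmul_tmap //; try legs.
by congr (tmul _ _ _); apply/funext => s; rewrite /= tmul_tmap; legs.
Qed.

End Hexagon.

Lemma quad_inverse_R : invertible (i2 R) /\ inverse (i2 R) = i2 (inverse R).
Proof. exact: (algmor_inverse i2m (R_invertible hR)). Qed.

(** The hexagons live on the image of H, where they are those of H for the strands composed with
    [i]. Only the intertwining relation involves theta. *)
Lemma quad_quasitriangular : quasitriangular quad_data (i2 R).
Proof.
have m1 := @leg1_algmor k A; have m2 := @leg2_algmor k A; have m3 := @leg3_algmor k A.
have c12 := @leg12 k A; have c13 := @leg13 k A; have c23 := @leg23 k A.
have l1 := algmor_lin m1; have l2 := algmor_lin m2; have l3 := algmor_lin m3.
have mi1 : algmor (leg1 \o i) by exact: algmor_comp.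
have mi2 : algmor (leg2 \o i) by exact: algmor_comp.
have mi3 : algmor (leg3 \o i) by exact: algmor_comp.
have d12 : commuting (leg1 \o i) (leg2 \o i) by move=> x y; exact: c12.
have d13 : commuting (leg1 \o i) (leg3 \o i) by move=> x y; exact: c13.
have d23 : commuting (leg2 \o i) (leg3 \o i) by move=> x y; exact: c23.
have mq23 : algmor (cab D' (@leg2 k A) leg3) by exact: cab_algmor.
have mq12 : algmor (cab D' (@leg1 k A) leg2) by exact: cab_algmor.
have [ivP ivE] := quad_reassoc_inverse.
have [RV VR] := invertibleW quad_inverse_R.1.
have e12 : cab D' leg1 leg2 \o i = cab Q (leg1 \o i) (leg2 \o i).
  by apply/funext => h; exact: quad_cab_in.
have e23 : cab D' leg2 leg3 \o i = cab Q (leg2 \o i) (leg3 \o i).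
  by apply/funext => h; exact: quad_cab_in.
split.
- exact: quad_inverse_R.1.
- rewrite -[LHS]tmul_legs -[RHS]tmul_legs hexagon_legs1 // ivE !tmul3_quad_in //.
  rewrite [LHS]tmul_tmap //; try legs.
  rewrite -[tmul leg1 leg2 \o _]/(cab D' leg1 leg2) !tmul_tmap //; try legs.
  by rewrite e12 (hexagon1 hR).
- rewrite -[LHS]tmul_legs -[RHS]tmul_legs hexagon_legs2 // ivE !tmul3_quad_in //.
  rewrite tmul_assoc // [LHS]tmul_tmap //; try legs.
  rewrite -[tmul leg2 leg3 \o _]/(cab D' leg2 leg3) !tmul_tmap //; try legs.
  by rewrite e23 (hexagon2 hR).
move=> h; change (tswap (Delta' h) * i2 R = i2 R * Delta' h).
(* Written as a conjugation, the relation compares two algebra maps, so H and theta suffice. *)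
have K : forall x, tswap (Delta' x) = i2 R * Delta' x * inverse (i2 R).
  apply: (quad_algmor_ext (F := fun x => tswap (Delta' x))
    (G := fun x => i2 R * Delta' x * inverse (i2 R))).
  - exact: (algmor_comp (tswap_algmor A A) mD').
  - exact: (algmor_comp (conj_algmor RV VR) mD').
  - move=> a; rewrite quad_comul_in quad_inverse_R.2 tmap_tswap // -!(algmorM i2m).
    have [_ _ _ <-] := hR; congr i2.
    by rewrite -mulrA (invertibleW (R_invertible hR)).1 mulr1.
  rewrite quad_comul_theta quad_inverse_R.2 /theta_comul.
  rewrite (algmorM (tswap_algmor A A)) tswapE tmap_tswap //.
  rewrite [i2 R * _]mulrA -(ttC (i2 R)) -!mulrA -!(algmorM i2m); congr (_ * i2 _).
  rewrite mulrA -(tswap_inverse_monodromy hR) -mulrA.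
  by rewrite (invertibleW (R_invertible hR)).1 mulr1.
by rewrite K -mulrA VR mulr1.
Qed.

Definition quad_theta_inv : A := theta * i (qt_wV Q R).

Lemma quad_thetaK : theta * quad_theta_inv = 1.
Proof. by rewrite /quad_theta_inv mulrA theta2 -(algmorM im) wE (qt_wK hR) (algmor1 im). Qed.

Lemma quad_thetaVK : quad_theta_inv * theta = 1.
Proof. by rewrite -thetaC quad_thetaK. Qed.

Lemma quad_theta_invertible : invertible theta.
Proof. by exists quad_theta_inv; split; [exact: quad_thetaK | exact: quad_thetaVK]. Qed.

Lemma quad_theta_inv_central : central (inverse theta).
Proof.
move=> x; have [tV Vt] := invertibleW quad_theta_invertible.
by rewrite -[RHS]mul1r -Vt -!mulrA (mulrA theta) thetaC -mulrA tV mulr1.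
Qed.

(** Inverting Delta(theta) turns M^-1 into M = R_21 R, the double braiding. This is why the twist is
    given by the inverse of theta. *)
Lemma quad_comul_theta_inv : Delta' (inverse theta) =
  (inverse theta *t inverse theta) * (tswap (i2 R) * i2 R).
Proof.
have [tV Vt] := invertibleW quad_theta_invertible.
have mM : i2 (inverse M) * (tswap (i2 R) * i2 R) = 1.
  rewrite tmap_tswap // -!(algmorM i2m).
  by rewrite (invertibleW (monodromy_invertible hR)).2 (algmor1 i2m).
have e : Delta' (inverse theta) * Z = 1.
  by rewrite -quad_comul_theta -(algmorM mD') Vt (algmor1 mD').
have iC : central (inverse theta *t inverse theta : tens A A).
  by apply: tensor_central; exact: quad_theta_inv_central.
have e' : Z * ((inverse theta *t inverse theta) * (tswap (i2 R) * i2 R)) = 1.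
  rewrite /theta_comul mulrA -(mulrA (theta *t theta)) -(iC (i2 _)) (mulrA (theta *t theta)) tensM tV.
  by rewrite -mulrA mM mulr1.
by rewrite -[LHS]mulr1 -e' mulrA e mul1r.
Qed.

Lemma quad_antipode_theta_inv : S' (inverse theta) = inverse theta.
Proof.
have [tV Vt] := invertibleW quad_theta_invertible.
have e : theta * S' (inverse theta) = 1.
  by rewrite -{1}quad_antipode_theta -quad_antipodeM Vt quad_antipode1.
by rewrite -[LHS]mul1r -Vt -mulrA e mulr1.
Qed.

(** Coproduct and counit are multiplicative and the antipode is antimultiplicative, so their values
    on H and at theta determine them. *)
Lemma quad_data_uniq (Q' : quasi_hopf A) :
  (forall h, qh_comul Q' (i h) = i2 (Delta h)) ->
  (forall h, qh_counit Q' (i h) = eps h) ->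
  (forall h, qh_antipode Q' (i h) = i (S h)) ->
  qh_comul Q' theta = Z -> qh_counit Q' theta = 1 -> qh_antipode Q' theta = theta ->
  qh_reassoc Q' = i3 Phi0 -> qh_alpha Q' = i alpha -> qh_beta Q' = i beta ->
  qh_data Q' = quad_data.
Proof.
move=> cD ce cS tD te tS.
have D : qh_comul Q' = Delta'.
  apply/funext; apply: quad_algmor_ext => //.
  - exact: comul_algmor.
  - by move=> a; rewrite cD quad_comul_in.
  by rewrite tD quad_comul_theta.
have E : qh_counit Q' = eps'.
  apply/funext; apply: (@quad_lin_ext k^o) => // [|a|a].
  - exact: counit_scalar.
  - by rewrite ce quad_counit_in.
  by rewrite counitM quad_counitM ce te quad_counit_in quad_counit_theta.
have AS : qh_antipode Q' = S'.
  apply/funext; apply: quad_lin_ext => // [|a|a].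
  - exact: antipode_linear.
  - by rewrite cS quad_antipode_in.
  by rewrite antipodeM quad_antipodeM cS tS quad_antipode_in quad_antipode_theta.
case: (qh_data Q') D E AS => d e p a al be /= -> -> -> -> -> -> //.
Qed.

(** Converts to [extends_to_theta] when [A] is [adjoin_sqrt w]. *)
Definition quad_extends (D : quasi_hopf_data A) : Prop :=
  [/\ [/\ forall h, qh_comul D (i h) = i2 (Delta h),
          forall h, qh_counit D (i h) = eps h
        & forall h, qh_antipode D (i h) = i (S h)],
      [/\ qh_comul D theta = (theta *t theta) * inverse (tswap (i2 R) * i2 R),
          qh_counit D theta = 1
        & qh_antipode D theta = theta]
    & [/\ qh_reassoc D = i3 Phi0, qh_alpha D = i alpha & qh_beta D = i beta]].

Theorem quadratic_extension : exists Q' : quasi_hopf A,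
  [/\ quad_extends Q' /\
        (forall Q'' : quasi_hopf A, quad_extends Q'' -> qh_data Q'' = qh_data Q'),
      quasitriangular Q' (i2 R), invertible theta
    & ribbon_twist Q' (i2 R) (fun V v => rep_act (inverse theta) v)].
Proof.
exists (QuasiHopf quad_is_quasi_hopf); split.
- split=> [|Q'' [[cD ce cS] [tD te tS] [p a b]]].
    split; split=> //; [exact: quad_comul_in | exact: quad_counit_in |
      exact: quad_antipode_in | | exact: quad_counit_theta | exact: quad_antipode_theta].
    by rewrite quad_inverse_monodromy; exact: quad_comul_theta.
  by apply: quad_data_uniq => //; rewrite tD quad_inverse_monodromy.
- exact: quad_quasitriangular.
- exact: quad_theta_invertible.
apply: ribbon_twist_central.
- by exists theta; have [] := invertibleW quad_theta_invertible.
- exact: quad_theta_inv_central.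
- exact: quad_comul_theta_inv.
exact: quad_antipode_theta_inv.
Qed.

End Extension.
End Quadratic.

Theorem proposition5p9 (k : fieldType) (H : algType k) (Q : quasi_hopf H)
    (R : tens H H) (hR : quasitriangular Q R) :
  let u := qt_u Q R in
  let w := u * qh_antipode Q u in
  let i := adjoin_in w in
  let theta := adjoin_theta w in
  injective i /\
  exists Q' : quasi_hopf (adjoin_sqrt w),
    [/\ extends_to_theta Q R Q' /\
          (forall Q'' : quasi_hopf (adjoin_sqrt w),
             extends_to_theta Q R Q'' -> qh_data Q'' = qh_data Q'),
        quasitriangular Q' (tmap i i R),
        invertible theta
      & ribbon_twist Q' (tmap i i R)
          (fun V v => rep_act (inverse theta) v)].
Proof.
move=> u w i theta.
have wC : forall h : H, w * h = h * w := qt_w_central hR.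
split; first exact: adjoin_in_inj.
have im : algmor (i : H -> adjoin_sqrt w) := adjoin_in_algmor w.
have tC : central theta := @adjoin_theta_central k H w.
have t2 : theta * theta = i w := adjoin_theta_sq w.
have dec := @adjoin_decomp k H w.
have unq := @adjoin_coord_uniq k H w wC.
have wE : w = qt_w Q R by [].
exact: (quadratic_extension im tC t2 dec unq hR wE).
Qed.
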